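(* Let $d\ge 1$, let $M$ be a $d\times d$ integer matrix all of whose eigenvalues $\lambda$ satisfy $|\lambda|>1$, and let $P$ be a $d\times d$ integer matrix with $p:=|\det P|\neq 0$ which is an admissible oversampling matrix for $M$ (see context). Let $\Psi=\{\psi_1,\dots,\psi_n\}\subset L^2(\mathbb{R}^d)$. Then the affine system $$X(\Psi)=\{D^jT_k\psi_i : j\in\mathbb{Z},\ k\in\mathbb{Z}^d,\ i\in\{1,\dots,n\}\}$$ is a frame (respectively, an orthonormal basis) for $L^2(\mathbb{R}^d)$ with frame bounds $A,B$ if and only if $$\mathbf{X}(S\Psi):=\{\mathbf{D}^j\mathbf{T}_{P^{-1}k}S\psi_i : j\in\mathbb{Z},\ k\in\mathbb{Z}^d,\ i\in\{1,\dots,n\}\}$$ is a frame (respectively, an orthonormal basis) for $H$ with the same frame bounds $A,B$. Moreover, the projection of $\mathbf{X}(S\Psi)$ onto the first component of $H$ (the component indexed by $q=0$) is the oversampled affine system $$X^P(\Psi)=\Big\{\tfrac{1}{\sqrt{p}}D^jT_{P^{-1}k}\psi_i : j\in\mathbb{Z},\ k\in\mathbb{Z}^d,\ i\in\{1,\dots,n\}\Big\}.$$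
   Context: For $f\in L^2(\mathbb{R}^d)$: $Df(x)=\sqrt{|\det M|}\,f(Mx)$ and, for $u\in\mathbb{R}^d$, $T_uf(x)=f(x-u)$. A family $\{e_i\}_{i\in I}$ in a Hilbert space $K$ is a frame with bounds $A,B>0$ if $A\|f\|^2\le\sum_i|\langle f,e_i\rangle|^2\le B\|f\|^2$ for all $f\in K$. $P$ is an admissible oversampling matrix for $M$ if $PMP^{-1}$ has integer entries and $M^{-1}\mathbb{Z}^d\cap P^{-1}\mathbb{Z}^d=\mathbb{Z}^d$. Put $M'=PMP^{-1}$. Let $\{\theta_r : 0\le r\le p-1\}$ be a complete set of representatives of $P^{-1}\mathbb{Z}^d/\mathbb{Z}^d$ with $\theta_0=0$, and $\{\theta^*_q : 0\le q\le p-1\}$ a complete set of representatives of $(P^* )^{-1}\mathbb{Z}^d/\mathbb{Z}^d$ with $\theta^*_0=0$ ($P^*$ the transpose). Under admissibility, $M$ induces a permutation $\sigma$ of $\{0,\dots,p-1\}$ by $M\theta_r\equiv\theta_{\sigma(r)}\bmod\mathbb{Z}^d$, and $M'^*$ induces a permutation $\sigma^*$ by $M'^*\theta^*_q\equiv\theta^*_{\sigma^*(q)}\bmod\mathbb{Z}^d$. Let $H=L^2(\mathbb{R}^d)\oplus\cdots\oplus L^2(\mathbb{R}^d)$ ($p$ copies), with elements written $(f_q)_{0\le q\le p-1}$. Define unitaries on $H$: $\mathbf{T}_{P^{-1}k}(f_q)_q=(e^{2\pi i k\cdot\theta^*_q}T_{P^{-1}k}f_q)_q$ for $k\in\mathbb{Z}^d$,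 and $\mathbf{D}(f_q)_q=(Df_{(\sigma^* )^{-1}(q)})_q$. Define the isometry $S:L^2(\mathbb{R}^d)\to H$, $Sf=\frac{1}{\sqrt p}(f,\dots,f)$. *)

(* Defs.v *)
From HB Require Import structures.
From mathcomp Require Import all_boot all_order all_algebra.
From mathcomp Require Import all_classical all_reals all_analysis.
From mathcomp Require Import complex fingroup perm.
Set Implicit Arguments. Unset Strict Implicit. Unset Printing Implicit Defensive.
Import Order.TTheory GRing.Theory Num.Theory.
Import numFieldNormedType.Exports.
Local Open Scope classical_set_scope.
Local Open Scope ring_scope.

Section AffineDefs.
Context (R : realType).
Local Notation C := (R[i]).

(* ---------- points of R^d, functions R^d -> C ---------- *)
(* Points of R^d are row vectors; a matrix A acts as x |-> A x, i.e. x *m A^T. *)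
Definition mact d (A : 'M[R]_d) (x : 'rV[R]_d) : 'rV[R]_d := x *m A^T.
Definition intmx d (A : 'M[int]_d) : 'M[R]_d := map_mx (fun z : int => z%:~R) A.
Definition intrv d (k : 'rV[int]_d) : 'rV[R]_d := map_mx (fun z : int => z%:~R) k.
(* x is a point of the lattice Z^d *)
Definition in_Zd d (x : 'rV[R]_d) : Prop := exists k : 'rV[int]_d, x = intrv k.

Definition tup2rv d (t : d.-tuple R) : 'rV[R]_d := \row_i tnth t i.

(* Lebesgue integral over R^d of a nonnegative function, as the iterated
   one-dimensional Lebesgue integral (Tonelli). *)
Fixpoint iint (d : nat) : (d.-tuple R -> \bar R) -> \bar R :=
  match d return (d.-tuple R -> \bar R) -> \bar R with
  | 0 => fun f => f [tuple]
  | d'.+1 => fun f =>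
      (\int[@lebesgue_measure R]_x iint (fun t : d'.-tuple R => f (cons_tuple x t)))%E
  end.
Definition Rdint d (f : 'rV[R]_d -> \bar R) : \bar R := iint (f \o @tup2rv d).

(* Borel measurability on R^d (product sigma-algebra on d-tuples) *)
Definition Rdmeas d (f : 'rV[R]_d -> R) : Prop :=
  measurable_fun setT (f \o @tup2rv d).

Definition cabs2 (z : C) : R := complex.Re z ^+ 2 + complex.Im z ^+ 2.

Definition inL2 d (f : 'rV[R]_d -> C) : Prop :=
  [/\ Rdmeas (fun x => complex.Re (f x)), Rdmeas (fun x => complex.Im (f x))
    & (Rdint (fun x => (cabs2 (f x))%:E) < +oo)%E].

(* integral of a real integrable function: int g^+ - int g^- *)
Definition Rdrint d (g : 'rV[R]_d -> R) : R :=
  fine (Rdint (fun x => (Num.max (g x) 0)%:E)) -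
  fine (Rdint (fun x => (Num.max (- g x) 0)%:E)).
Definition Rdcint d (h : 'rV[R]_d -> C) : C :=
  Complex (Rdrint (fun x => complex.Re (h x))) (Rdrint (fun x => complex.Im (h x))).

(* inner product <f, g> = int f conj(g) on L^2(R^d) *)
Definition ipL2 d (f g : 'rV[R]_d -> C) : C := Rdcint (fun x => f x * (g x)^*).

(* ---------- abstract frames / orthonormal bases ---------- *)
Definition is_frame (V : Type) (I : choiceType) (inK : V -> Prop) (ip : V -> V -> C)
    (e : I -> V) (A B : R) : Prop :=
  [/\ 0 < A, 0 < B, (forall i, inK (e i)) &
    forall f, inK f ->
      ((A * complex.Re (ip f f))%:E <= \esum_(i in [set: I]) (cabs2 (ip f (e i)))%:E)%E /\
      (\esum_(i in [set: I]) (cabs2 (ip f (e i)))%:E <= (B * complex.Re (ip f f))%:E)%E].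

Definition is_onb (V : Type) (I : eqType) (inK : V -> Prop) (ip : V -> V -> C)
    (e : I -> V) : Prop :=
  [/\ (forall i, inK (e i)),
      (forall i j, ip (e i) (e j) = if i == j then 1 else 0) &
      (* completeness: only the zero vector (norm 0) is orthogonal to all e_i *)
      forall f, inK f -> (forall i, ip f (e i) = 0) -> ip f f = 0].

(* ---------- operators on L^2(R^d) ---------- *)
Definition rc (x : R) : C := Complex x 0.
Definition expi (t : R) : C := Complex (cos t) (sin t).

Definition Dil d (M : 'M[int]_d) (f : 'rV[R]_d -> C) : 'rV[R]_d -> C :=
  fun x => rc (Num.sqrt `|(\det M)%:~R : R|) * f (mact (intmx M) x).
(* the inverse operator D^{-1} f (x) = |det M|^{-1/2} f (M^{-1} x) *)
Definition Dilinv d (M : 'M[int]_d) (f : 'rV[R]_d -> C) : 'rV[R]_d -> C :=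
  fun x => rc (Num.sqrt `|(\det M)%:~R : R|)^-1 * f (mact (invmx (intmx M)) x).
Definition Tr d (u : 'rV[R]_d) (f : 'rV[R]_d -> C) : 'rV[R]_d -> C :=
  fun x => f (x - u).

(* integer powers of an invertible operator T with inverse U *)
Definition opow (V : Type) (T U : V -> V) (j : int) : V -> V :=
  match j with Posz n => iter n T | Negz n => iter n.+1 U end.

(* ---------- the space H = L^2(R^d)^p ---------- *)
Definition inH d p (F : 'I_p -> 'rV[R]_d -> C) : Prop := forall q, inL2 (F q).
Definition ipH d p (F G : 'I_p -> 'rV[R]_d -> C) : C := \sum_(q < p) ipL2 (F q) (G q).

Definition bDil d p (M : 'M[int]_d) (s : {perm 'I_p}) (F : 'I_p -> 'rV[R]_d -> C) :
  'I_p -> 'rV[R]_d -> C := fun q => Dil M (F (s^-1 q)%g).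
Definition bDilinv d p (M : 'M[int]_d) (s : {perm 'I_p}) (F : 'I_p -> 'rV[R]_d -> C) :
  'I_p -> 'rV[R]_d -> C := fun q => Dilinv M (F (s q)).

Definition dotv d (x y : 'rV[R]_d) : R := \sum_(i < d) x ord0 i * y ord0 i.

(* bold T_{P^{-1}k} *)
Definition bTr d p (P : 'M[int]_d) (thetas : 'I_p -> 'rV[R]_d) (k : 'rV[int]_d)
    (F : 'I_p -> 'rV[R]_d -> C) : 'I_p -> 'rV[R]_d -> C :=
  fun q x => expi (2 * pi * dotv (intrv k) (thetas q)) *
             Tr (mact (invmx (intmx P)) (intrv k)) (F q) x.

Definition Sop d p (f : 'rV[R]_d -> C) : 'I_p -> 'rV[R]_d -> C :=
  fun _ x => rc (Num.sqrt (p%:R : R))^-1 * f x.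

(* ---------- affine systems ---------- *)
Definition affine_sys d n (M : 'M[int]_d) (Psi : 'I_n -> 'rV[R]_d -> C)
    (jki : int * 'rV[int]_d * 'I_n) : 'rV[R]_d -> C :=
  let: (j, k, i) := jki in
  opow (Dil M) (Dilinv M) j (Tr (intrv k) (Psi i)).

Definition bold_affine_sys d p n (M P : 'M[int]_d) (thetas : 'I_p -> 'rV[R]_d)
    (s : {perm 'I_p}) (Psi : 'I_n -> 'rV[R]_d -> C)
    (jki : int * 'rV[int]_d * 'I_n) : 'I_p -> 'rV[R]_d -> C :=
  let: (j, k, i) := jki in
  opow (bDil M s) (bDilinv M s) j (bTr P thetas k (@Sop d p (Psi i))).

Definition oversampled_affine_sys d p n (M P : 'M[int]_d) (Psi : 'I_n -> 'rV[R]_d -> C)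
    (jki : int * 'rV[int]_d * 'I_n) : 'rV[R]_d -> C :=
  let: (j, k, i) := jki in
  fun x => rc (Num.sqrt (p%:R : R))^-1 *
    opow (Dil M) (Dilinv M) j (Tr (mact (invmx (intmx P)) (intrv k)) (Psi i)) x.

(* ---------- admissible oversampling matrix ---------- *)
Definition admissible d (M P : 'M[int]_d) : Prop :=
  (exists M' : 'M[int]_d, intmx P *m intmx M *m invmx (intmx P) = intmx M') /\
  (forall x : 'rV[R]_d,
      ((exists k, x = mact (invmx (intmx M)) (intrv k)) /\
       (exists k, x = mact (invmx (intmx P)) (intrv k))) <-> in_Zd x).

(* complete set of representatives of (A^{-1} Z^d) / Z^d, indexed by 'I_p,
   with the representative of index 0 equal to 0 *)
Definition reps d p (A : 'M[R]_d) (th : 'I_p -> 'rV[R]_d) : Prop :=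
  [/\ (forall q, exists k, th q = mact (invmx A) (intrv k)),
      (forall q q', in_Zd (th q - th q') -> q = q'),
      (forall k, exists q, in_Zd (mact (invmx A) (intrv k) - th q)) &
      (forall q : 'I_p, val q = 0%N -> th q = 0)].

End AffineDefs.

(* Main.v *)
Require Import Defs.
From HB Require Import structures.
From mathcomp Require Import all_boot all_order all_algebra.
From mathcomp Require Import all_classical all_reals all_analysis measurable_realfun.
From mathcomp Require Import complex fingroup perm ring lra zify.
Set Implicit Arguments. Unset Strict Implicit. Unset Printing Implicit Defensive.
Import Order.TTheory GRing.Theory Num.Theory.
Import numFieldNormedType.Exports.
Local Open Scope classical_set_scope.
Local Open Scope ring_scope.

(** The characters of Z^d / PZ^d split H: with k_s representatives of the classes and
    V_s g = (p^(-1/2) e^(2 pi i k_s . theta*_q) g)_q, the ranges of the isometries V_s are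
    orthogonal and span H.  If J is a multiple of the order of sigma*, then
      D^j T_(P^(-1) k) S psi = V_s (T_u (D^j T_m psi)),   u = M^J P^(-1) k_s,
    for all j >= -J, where k = M'^(j+J) k_s + P m; so up to the scale -J the bold system is
    a direct sum of translates of the affine system.  The scales j < -J of the affine system
    contribute little to T_(-u) f: by Cauchy-Schwarz and a change of variables their
    contribution is bounded, for f supported in a box, by the integral of |psi|^2 against the
    number of (l, m) with M^l (y + m) close to -P^(-1) k_s, which is bounded because M is
    expanding and tends to 0 almost everywhere as J grows, provided k_s <> 0.  This gives the
    lower frame bound; the converse follows by testing on S f.  For orthonormal bases,
    completeness is turned into a frame bound by Parseval's identity (Riesz-Fischer). *)

(** * Lebesgue measure on R^d *)

Section LebesgueRd.
Context (R : realType).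
Local Notation leb := (@lebesgue_measure R).

(** The translation u changes with J, so the pieces T_(-u) f have no limit vector to work with: the
    lower bound is estimated at each large J, and the error must be small although the translate
    moves. The upper bound needs no limit, since a finite subfamily lies in the scales j >= -J for
    some J, and neither does orthonormality, which involves two vectors at a time. The order of
    sigma enters because the bold dilation permutes components: at scale j, component q carries a
    character evaluated at sigma^(-j) q. As sigma^J = 1, this is undone by the nonnegative power
    M'^(j+J), which keeps the index k integral; negative powers of M' would not. Coarse scales are
    numbered from -J downwards, j = -(J+l). Applying M^(-J) then turns u into the fixed offset w =
    P^(-1) k_s and shrinks the supporting box to a point, so the sets to be counted no longer
    involve J. For w = 0 the count would be unbounded, because a y close to 0 has M^l y close to 0
    for many l; this is why the representatives k_s must be nonzero. *)

Lemma sigma_finite_pushforward d1 d2 (T1 : measurableType d1) (T2 : measurableType d2)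
  (m : set T1 -> \bar R) (f : T1 -> T2) (g : T2 -> T1) :
  sigma_finite setT m -> measurable_fun setT g -> cancel f g -> sigma_finite setT (pushforward m f).
Proof.
move=> [F TF Foo] mg fK.
exists (fun n => g @^-1` F n).
  apply/seteqP; split=> // x _.
  have : setT (g x) by []. by rewrite TF => -[n _ Fn]; exists n.
move=> n; have [mF Fn] := Foo n; split.
  by rewrite -[X in measurable X]setTI; exact: mg.
rewrite /pushforward (_ : f @^-1` (g @^-1` F n) = F n)//.
by apply/seteqP; split=> x /=; rewrite fK.
Qed.

Section push.
Context d1 d2 (T1 : measurableType d1) (T2 : measurableType d2).
Variables (m : {measure set T1 -> \bar R}) (f : T1 -> T2).
Hypothesis mf : measurable_fun setT f.

(* The measurability proof is an argument so that the measure structure can be inferred. *)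
Definition pushmeas (_ : measurable_fun setT f) := pushforward m f.
Local Notation pm := (pushmeas mf).

Let pushmeas0 : pm set0 = 0%E.
Proof. by rewrite /pm /pushforward preimage_set0 measure0. Qed.

Let pushmeas_ge0 A : (0 <= pm A)%E.
Proof. exact: measure_ge0. Qed.

Let pushmeas_sigma_additive : semi_sigma_additive pm.
Proof. exact: measure_semi_sigma_additive. Qed.

HB.instance Definition _ := isMeasure.Build _ _ _ pm
  pushmeas0 pushmeas_ge0 pushmeas_sigma_additive.

Hypothesis sf : sigma_finite setT pm.
Definition pushmeas_sf (_ : sigma_finite setT pm) := pm.
HB.instance Definition _ := Measure.on (pushmeas_sf sf).
HB.instance Definition _ := Measure_isSigmaFinite.Build _ _ _ (pushmeas_sf sf) sf.
End push.

Lemma sigma_finite_product d1 d2 (T1 : measurableType d1) (T2 : measurableType d2)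
    (m1 : {sigma_finite_measure set T1 -> \bar R})
    (m2 : {sigma_finite_measure set T2 -> \bar R}) :
  sigma_finite setT (m1 \x m2)%E.
Proof.
have /sigma_finiteP[F [TF ndF Foo]] := sigma_finiteT m1.
have /sigma_finiteP[G [TG ndG Goo]] := sigma_finiteT m2.
exists (fun n => F n `*` G n).
  apply/seteqP; split=> // -[x y] _.
  have : setT x by []. have : setT y by []. rewrite TF TG => -[k _ Gk] [n _ Fn].
  exists (maxn n k) => //; split => /=.
  - by move: x Fn; exact/subsetPset/ndF/leq_maxl.
  - by move: y Gk; exact/subsetPset/ndG/leq_maxr.
move=> k; have [? ?] := Foo k; have [? ?] := Goo k; split.
  exact: measurableX.
by rewrite product_measure1E// lte_mul_pinfty// ge0_fin_numE.
Qed.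

Lemma measurable_cons_pair d :
  measurable_fun setT (fun p : measurableTypeR R * d.-tuple R => cons_tuple p.1 p.2 : d.+1.-tuple R).
Proof. exact: measurable_cons. Qed.

Lemma measurable_uncons d : measurable_fun setT
  (fun t : d.+1.-tuple R => ((thead t : measurableTypeR R), [tuple of behead t])).
Proof.
apply: measurable_fun_pair; first exact: measurable_tnth.
exact: measurable_behead.
Qed.

Lemma iint_measureP d : exists m : {sigma_finite_measure set (d.-tuple R) -> \bar R},
  forall f : d.-tuple R -> \bar R, measurable_fun setT f -> (forall x, 0 <= f x)%E ->
  iint f = (\int[m]_x f x)%E.
Proof.
elim: d => [|d [m IH]].
  exists \d_([tuple] : 0.-tuple R).
  by move=> f mf f0; rewrite /= integral_dirac ?diracT ?mul1e.
pose m0 := (leb \x m)%E.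
pose f := fun p : measurableTypeR R * d.-tuple R => cons_tuple p.1 p.2 : d.+1.-tuple R.
have mf : measurable_fun setT f by exact: measurable_cons_pair.
have sf : sigma_finite setT (pushmeas m0 mf).
  apply: (sigma_finite_pushforward _ (@measurable_uncons d)).
    exact: sigma_finite_product.
  move=> -[x t].
  by congr pair; apply: val_inj.
exists (pushmeas_sf sf) => g mg g0 /=.
rewrite (ge0_integral_pushforward mf)// (fubini_tonelli1 (g \o f))//=; last first.
  exact: measurableT_comp.
apply: eq_integral => x _; rewrite IH//.
have mx : measurable_fun setT (fun t : d.-tuple R => ((x : measurableTypeR R), t)).
  exact: measurable_fun_pair.
exact: (measurableT_comp mg (measurableT_comp mf mx)).
Qed.

Definition lebesgueRd d := sval (cid (iint_measureP d)).

Lemma iintE d (f : d.-tuple R -> \bar R) : measurable_fun setT f ->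
  (forall x, 0 <= f x)%E -> iint f = (\int[lebesgueRd d]_x f x)%E.
Proof. by rewrite /lebesgueRd; case: cid => m /= H; exact: H. Qed.

Definition Rdemeas d (f : 'rV[R]_d -> \bar R) : Prop :=
  measurable_fun [set: d.-tuple R] (f \o @tup2rv R d).

Lemma RdintE d (f : 'rV[R]_d -> \bar R) : Rdemeas f -> (forall x, 0 <= f x)%E ->
  Rdint f = (\int[lebesgueRd d]_t f (tup2rv t))%E.
Proof. by move=> mf f0; apply: iintE => // x; exact: f0. Qed.

Definition rv2tup d (x : 'rV[R]_d) : d.-tuple R := [tuple x ord0 i | i < d].

Lemma rv2tupK d : cancel (@rv2tup d) (@tup2rv R d).
Proof. by move=> x; apply/rowP => i; rewrite mxE tnth_mktuple. Qed.

Lemma measurable_affine d e (A : 'M[R]_(d, e)) (b : 'rV[R]_e) :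
  measurable_fun setT (fun t : d.-tuple R => rv2tup (tup2rv t *m A + b)).
Proof.
apply/measurable_fun_tnthP => i.
rewrite [X in measurable_fun _ X](_ : _ =
  (fun t : d.-tuple R => (\sum_j tnth t j * A j i) + b ord0 i)); last first.
  apply/funext => t /=; rewrite tnth_mktuple !mxE; congr (_ + _).
  by apply: eq_bigr => j _; rewrite mxE.
apply: measurable_funD => //.
apply: measurable_sum => j.
by apply: measurable_funM => //; exact: measurable_tnth.
Qed.

Lemma Rdemeas_affine d e (f : 'rV[R]_e -> \bar R) (A : 'M[R]_(d, e)) b :
  Rdemeas f -> Rdemeas (fun x => f (x *m A + b)).
Proof.
move=> mf; rewrite /Rdemeas (_ : _ \o _ =
    (f \o @tup2rv R e) \o (fun t : d.-tuple R => rv2tup (tup2rv t *m A + b))).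
  exact: (measurableT_comp mf (measurable_affine _ _)).
by apply/funext => t /=; rewrite rv2tupK.
Qed.

Lemma Rdmeas_affine d e (f : 'rV[R]_e -> R) (A : 'M[R]_(d, e)) b :
  Rdmeas f -> Rdmeas (fun x => f (x *m A + b)).
Proof.
move=> mf; rewrite /Rdmeas (_ : _ \o _ =
    (f \o @tup2rv R e) \o (fun t : d.-tuple R => rv2tup (tup2rv t *m A + b))).
  exact: (measurableT_comp mf (measurable_affine _ _)).
by apply/funext => t /=; rewrite rv2tupK.
Qed.

(** By uniqueness of Lebesgue measure it suffices that |a| times the image measure of x |-> a x + b
    has the right value on half-open intervals. For a < 0 the preimage is closed on the other side,
    hence the two cases. *)
Lemma integral_affine (f : R -> \bar R) (a b : R) : a != 0 ->
  measurable_fun setT f -> (forall x, 0 <= f x)%E ->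
  (`|a|%:E * \int[leb]_x f (a * x + b)%R = \int[leb]_x f x)%E.
Proof.
move=> a0 mf f0.
pose phi (x : measurableTypeR R) : measurableTypeR R := a * x + b.
have mphi : measurable_fun setT phi.
  by apply: measurable_funD => //; apply: measurable_funM.
pose pm : {measure set (measurableTypeR R) -> \bar R} :=
  pushmeas leb mphi.
pose na : {nonneg R} := NngNum (normr_ge0 a).
have E : forall A, measurable A -> leb A = mscale na pm A.
  apply: lebesgue_measure_unique => _ [[x y]] _ <-.
  rewrite /= /mscale/= /pushforward.
  case: (ltgtP 0 a) a0 => // a0 _.
  - rewrite (_ : phi @^-1` _ = `](x - b) / a, (y - b) / a]%classic); last first.
      apply/seteqP; split=> z /=; rewrite !in_itv/= /phi;
      by rewrite ltr_pdivrMr// ler_pdivlMr// ltrBlDr lerBrDr (mulrC z).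
    rewrite !lebesgue_measure_itv/= !lte_fin ltr_pM2r ?invr_gt0// ltrD2r.
    case: ltP => _; last by rewrite mule0.
    rewrite -!EFinB -EFinM gtr0_norm//; congr EFin.
    by field; rewrite gt_eqF.
  - rewrite (_ : phi @^-1` _ = `[(y - b) / a, (x - b) / a[%classic); last first.
      apply/seteqP; split=> z /=; rewrite !in_itv/= /phi;
      by rewrite ltr_ndivlMr// ler_ndivrMr// ltrBlDr lerBrDr (mulrC z) andbC.
    rewrite !lebesgue_measure_itv/= !lte_fin ltr_nM2r ?invr_lt0// ltrD2r.
    case: ltP => _; last by rewrite mule0.
    rewrite -!EFinB -EFinM ltr0_norm//; congr EFin.
    by field; rewrite lt_eqF.
rewrite [RHS](eq_measure_integral (mscale na pm)); last first.
  by move=> A mA _; exact: E.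
rewrite ge0_integral_mscale//=; congr (_ * _)%E.
by rewrite (ge0_integral_pushforward mphi).
Qed.
End LebesgueRd.

(** * Linear change of variables *)

Section ChangeOfVariables.
Context (R : realType).
Local Notation leb := (@lebesgue_measure R).

Lemma tup2rv_cons d (x : R) (t : d.-tuple R) :
  tup2rv (cons_tuple x t) = row_mx x%:M (tup2rv t) :> 'rV[R]_(1 + d).
Proof.
apply/rowP => i; rewrite [LHS]mxE [RHS]mxE; case: splitP => j ij.
  rewrite mxE ord1 eqxx mulr1n (tnth_nth 0)/= ij.
  by rewrite ord1.
by rewrite mxE !(tnth_nth 0)/= ij.
Qed.

Lemma Rdint_row d (f : 'rV[R]_(1 + d) -> \bar R) :
  Rdint (d := 1 + d) f = (\int[leb]_x Rdint (fun y : 'rV_d => f (row_mx x%:M y)))%E.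
Proof.
rewrite /Rdint /=; apply: eq_integral => x _; congr iint.
by apply/funext => t /=; rewrite tup2rv_cons.
Qed.

Lemma Rdemeas_row d (f : 'rV[R]_(1 + d) -> \bar R) : Rdemeas (d := 1 + d) f ->
  measurable_fun setT
    (fun p : measurableTypeR R * d.-tuple R => f (row_mx p.1%:M (tup2rv p.2))).
Proof.
move=> mf.
rewrite [X in measurable_fun _ X](_ : _ =
  (f \o @tup2rv R (1 + d)) \o
  (fun p : measurableTypeR R * d.-tuple R => cons_tuple p.1 p.2 : d.+1.-tuple R)).
  exact: (measurableT_comp mf (@measurable_cons_pair R d)).
by apply/funext => p /=; rewrite tup2rv_cons.
Qed.

Lemma Rdemeas_rowr d (f : 'rV[R]_(1 + d) -> \bar R) (x : R) :
  Rdemeas (d := 1 + d) f -> Rdemeas (fun y : 'rV_d => f (row_mx x%:M y)).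
Proof.
move=> mf; rewrite (_ : (fun y => _) =
  (fun y : 'rV_d => f (y *m row_mx 0 1%:M + row_mx x%:M 0))).
  exact: (@Rdemeas_affine R d (1 + d) f).
by apply/funext => y; rewrite mul_mx_row mulmx0 mulmx1 add_row_mx add0r addr0.
Qed.

Lemma measurable_Rdint_row d (f : 'rV[R]_(1 + d) -> \bar R) :
  Rdemeas (d := 1 + d) f -> (forall x, 0 <= f x)%E ->
  measurable_fun setT
    (fun x : measurableTypeR R => Rdint (fun y : 'rV_d => f (row_mx x%:M y))).
Proof.
move=> mf f0.
have := measurable_fun_fubini_tonelli_F (m2 := lebesgueRd R d) _ (Rdemeas_row mf) (fun=> f0 _).
by congr (measurable_fun _ _); apply/funext => x; rewrite RdintE//; exact: Rdemeas_rowr.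
Qed.

Lemma Rdemeas_integral_row d (f : 'rV[R]_(1 + d) -> \bar R) :
  Rdemeas (d := 1 + d) f -> (forall x, 0 <= f x)%E ->
  Rdemeas (fun y : 'rV_d => \int[leb]_x f (row_mx x%:M y))%E.
Proof.
move=> mf f0.
exact: (measurable_fun_fubini_tonelli_G (m1 := leb) _ (Rdemeas_row mf) (fun=> f0 _)).
Qed.

(** The opposite order of integration, for maps whose first output coordinate depends on the
    remaining variables. *)
Lemma Rdint_row_tonelli d (f : 'rV[R]_(1 + d) -> \bar R) :
  Rdemeas (d := 1 + d) f -> (forall x, 0 <= f x)%E ->
  Rdint (d := 1 + d) f = Rdint (fun y : 'rV_d => \int[leb]_x f (row_mx x%:M y))%E.
Proof.
move=> mf f0; rewrite Rdint_row RdintE; last 2 first.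
- exact: Rdemeas_integral_row.
- by move=> x; exact: integral_ge0.
rewrite -(fubini_tonelli (m1 := leb) (m2 := lebesgueRd R d) _ (Rdemeas_row mf) (fun=> f0 _)).
by apply: eq_integral => x _; rewrite RdintE//; exact: Rdemeas_rowr.
Qed.

Lemma Rdint_ge0 d (f : 'rV[R]_d -> \bar R) : (forall x, 0 <= f x)%E -> (0 <= Rdint f)%E.
Proof.
rewrite /Rdint; elim: d f => [|d IH] f f0; first exact: f0.
rewrite -/(Rdint (d := 1 + d) f) Rdint_row.
by apply: integral_ge0 => x _; apply: IH.
Qed.

Lemma RdintZ d (f : 'rV[R]_d -> \bar R) (k : R) : Rdemeas f ->
  (forall x, 0 <= f x)%E -> 0 <= k -> (Rdint (fun x => k%:E * f x) = k%:E * Rdint f)%E.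
Proof.
move=> mf f0 k0; rewrite !RdintE//; last 2 first.
- by apply: emeasurable_funM.
- by move=> x; rewrite mule_ge0.
by rewrite ge0_integralZl.
Qed.

Lemma scalar_mx11D (u v : R) : (u + v)%:M = u%:M + v%:M :> 'M[R]_1.
Proof. by apply/matrixP => i j; rewrite !mxE mulrnDl. Qed.

(** The translation [b] belongs to the predicate because the induction on the dimension applies it
    to the lower block with a shift that depends on the coordinate held fixed. *)
Definition change_var d (A : 'M[R]_d) := forall (f : 'rV[R]_d -> \bar R) b,
  Rdemeas f -> (forall x, 0 <= f x)%E ->
  (`|\det A|%:E * Rdint (fun x => f (x *m A + b)%R) = Rdint f)%E.

Lemma change_varM d (A B : 'M[R]_d) : change_var A -> change_var B ->
  change_var (A *m B).
Proof.
move=> cA cB f b mf f0.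
rewrite det_mulmx normrM mulrC EFinM -muleA.
have := cA (fun z => f (z *m B + b)) 0 (Rdemeas_affine _ _ mf) (fun=> f0 _).
rewrite -(cB f b)// => <-; congr (_ * (_ * Rdint _))%E.
by apply/funext => x; rewrite addr0 mulmxA.
Qed.

Lemma change_var_ublock d (a : R) (v : 'rV[R]_d) (D : 'M[R]_d) :
  a != 0 -> change_var D -> change_var (block_mx a%:M v 0 D : 'M[R]_(1 + d)).
Proof.
move=> a0 cD f b mf f0; set c := lsubmx b ord0 ord0.
rewrite det_ublock det_scalar1 normrM EFinM -muleA.
have mfA : Rdemeas (fun x : 'rV_(1 + d) => f (x *m block_mx a%:M v 0 D + b)).
  exact: (@Rdemeas_affine R (1 + d) (1 + d) f _ b mf).
rewrite Rdint_row -ge0_integralZl//=; last 2 first.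
- exact: (measurable_Rdint_row mfA).
- by move=> x _; exact: Rdint_ge0.
have E x : (`|\det D|%:E * Rdint (fun y : 'rV_d =>
    f (row_mx x%:M y *m block_mx a%:M v 0 D + b)%R) =
    Rdint (fun y : 'rV_d => f (row_mx (a * x + c)%:M y)))%E.
  rewrite -(cD (fun y => f (row_mx (a * x + c)%:M y)) (x *: v + rsubmx b));
    [|exact: Rdemeas_rowr|by []].
  congr (_ * Rdint _)%E; apply/funext => y; congr f.
  rewrite mul_row_block mulmx0 addr0 -[b in LHS]hsubmxK add_row_mx.
  congr row_mx; last by rewrite mul_scalar_mx addrCA addrA addrC addrA.
  by rewrite -scalar_mxM mulrC scalar_mx11D /c -mx11_scalar.
under eq_integral do rewrite E.
rewrite (@integral_affine R (fun x => Rdint (fun y : 'rV_d => f (row_mx x%:M y)))) -?Rdint_row//.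
- exact: measurable_Rdint_row.
- by move=> x; exact: Rdint_ge0.
Qed.

(** Here the first coordinate becomes a x + y v + c, so x is integrated first, with y fixed and y v
    absorbed into the one-dimensional translation. *)
Lemma change_var_lblock d (a : R) (v : 'cV[R]_d) (D : 'M[R]_d) :
  a != 0 -> change_var D -> change_var (block_mx a%:M 0 v D : 'M[R]_(1 + d)).
Proof.
move=> a0 cD f b mf f0.
rewrite det_lblock det_scalar1 normrM mulrC EFinM -muleA.
have mfA : Rdemeas (fun x : 'rV_(1 + d) => f (x *m block_mx a%:M 0 v D + b)).
  exact: (@Rdemeas_affine R (1 + d) (1 + d) f _ b mf).
rewrite Rdint_row_tonelli//.
have E y : (`|a|%:E * \int[leb]_x
    f (row_mx x%:M y *m block_mx a%:M 0 v D + b)%R =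
    \int[leb]_x f (row_mx x%:M (y *m D + rsubmx b)))%E.
  set z := y *m D + rsubmx b.
  rewrite -(@integral_affine R (fun x => f (row_mx x%:M z)) a ((y *m v) ord0 ord0 + lsubmx b ord0 ord0))//.
    congr (_ * _)%E; apply: eq_integral => x _; congr f.
    rewrite mul_row_block mulmx0 add0r -[b in LHS]hsubmxK add_row_mx; congr row_mx.
    by rewrite !scalar_mx11D addrA -!mx11_scalar -scalar_mxM (mulrC a).
  rewrite (_ : (fun x => _) = (fun x : R => (fun w : 'rV_d => f (row_mx x%:M w)) z))//.
  have mz : measurable_fun setT (fun x : measurableTypeR R => (x, rv2tup z)).
    exact: measurable_fun_pair.
  have := measurableT_comp (Rdemeas_row mf) mz.
  by congr measurable_fun; apply/funext => x /=; rewrite rv2tupK.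
rewrite -RdintZ; last 3 first.
- exact: (Rdemeas_integral_row mfA).
- by move=> y; exact: integral_ge0.
- by [].
under [X in Rdint X]funext do rewrite E.
rewrite (cD (fun y : 'rV_d => \int[leb]_x f (row_mx x%:M y))%E).
- by rewrite Rdint_row_tonelli.
- exact: Rdemeas_integral_row.
- by move=> y; exact: integral_ge0.
Qed.

Lemma change_var0 (A : 'M[R]_0) : change_var A.
Proof.
move=> f b mf f0; rewrite det_mx00 normr1 mul1e.
by congr Rdint; apply/funext => x; congr f; rewrite !thinmx0.
Qed.

(** Because of the shift [b], this is translation invariance of the integral. *)
Lemma change_var1 d : change_var (1%:M : 'M[R]_d).
Proof.
elim: d => [|d IH]; first exact: change_var0.
rewrite (_ : 1%:M = (1%:M : 'M[R]_(1 + d)))// scalar_mx_block.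
by apply: change_var_ublock; rewrite ?oner_eq0.
Qed.

(* Gaussian elimination: a zero pivot is removed by a transvection, then A = L U blockwise. *)
Lemma change_var_unit d (A : 'M[R]_d) : A \in unitmx -> change_var A.
Proof.
elim: d A => [|d IH] A; first by move=> _; exact: change_var0.
rewrite -[d.+1]/(1 + d)%N in A *.
suff H (B : 'M[R]_(1 + d)) : B \in unitmx -> ulsubmx B ord0 ord0 != 0 -> change_var B.
  move=> uA; have [a0|] := eqVneq (ulsubmx A ord0 ord0) 0; last exact: H.
  have [i ci] : exists i, dlsubmx A i ord0 != 0.
    apply/existsP; apply: contraTT uA; rewrite negb_exists => /forallP c0.
    rewrite unitmxE -[A]submxK [ulsubmx A]mx11_scalar a0.
    rewrite (_ : dlsubmx A = 0) ?det_ublock ?det_scalar1 ?mul0r ?unitr0//.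
    by apply/matrixP => j k; rewrite ord1 [RHS]mxE; apply/eqP; have := c0 j; rewrite negbK.
  pose E (v : 'rV[R]_d) : 'M[R]_(1 + d) := block_mx 1%:M v 0 1%:M.
  have cE v : change_var (E v).
    by apply: change_var_ublock; [rewrite oner_eq0|exact: change_var1].
  (* Multiplying by [E v] on the left adds a lower row to the first one, which puts the nonzero
     entry [dlsubmx A i ord0] at the pivot. *)
  pose v := delta_mx 0 i : 'rV[R]_d.
  have EK : E (- v) *m E v = 1%:M.
    rewrite mulmx_block !mulmx1 !mul1mx !mulmx0 !mul0mx !addr0 add0r addrN.
    by rewrite -scalar_mx_block.
  rewrite -[A]mul1mx -EK -mulmxA; apply: change_varM => //; apply: H.
    by rewrite unitmx_mul uA andbT; case/mulmx1_unit: EK.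
  rewrite -[A]submxK mulmx_block block_mxKul mul1mx mxE a0 add0r.
  by rewrite -rowE mxE.
move=> uB; set a := ulsubmx B ord0 ord0 => a0.
pose D := drsubmx B - a^-1 *: (dlsubmx B *m ursubmx B).
have BE : B = (block_mx 1%:M 0 (a^-1 *: dlsubmx B) 1%:M : 'M[R]_(1 + d)) *m
              block_mx a%:M (ursubmx B) 0 D.
  rewrite mulmx_block !mul1mx !mul0mx !addr0.
  rewrite mul_mx_scalar scalerA divff// scale1r -scalemxAl addrC subrK.
  by rewrite -[LHS]submxK [ulsubmx B]mx11_scalar.
rewrite BE; apply: change_varM.
  by apply: change_var_lblock; [rewrite oner_eq0|exact: change_var1].
apply: change_var_ublock => //; apply: IH.
move: uB; rewrite {1}BE unitmx_mul => /andP[_].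
by rewrite !unitmxE det_ublock unitrM => /andP[].
Qed.

End ChangeOfVariables.

(** * The inner product of L^2(R^d) *)

Section ComplexFacts.
Context (R : realType).
Local Notation C := R[i].

Lemma Re_conj_complex (z : C) : complex.Re z^* = complex.Re z.
Proof. by case: z. Qed.
Lemma Im_conj_complex (z : C) : complex.Im z^* = - complex.Im z.
Proof. by case: z. Qed.
Lemma ReD (z w : C) : complex.Re (z + w) = complex.Re z + complex.Re w.
Proof. by case: z; case: w. Qed.
Lemma ImD (z w : C) : complex.Im (z + w) = complex.Im z + complex.Im w.
Proof. by case: z; case: w. Qed.
Lemma ReM (z w : C) :
  complex.Re (z * w) = complex.Re z * complex.Re w - complex.Im z * complex.Im w.
Proof. by case: z; case: w. Qed.
Lemma ImM (z w : C) :
  complex.Im (z * w) = complex.Re z * complex.Im w + complex.Im z * complex.Re w.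
Proof. by case: z => a b; case: w => a' b' /=; rewrite addrC. Qed.
Lemma complexE (z w : C) : complex.Re z = complex.Re w -> complex.Im z = complex.Im w -> z = w.
Proof. by case: z; case: w => a b c d /= -> ->. Qed.

Lemma cabs2_ge0 (z : C) : 0 <= cabs2 z.
Proof. by rewrite /cabs2 addr_ge0 ?sqr_ge0. Qed.
Lemma cabs2M (z w : C) : cabs2 (z * w) = cabs2 z * cabs2 w.
Proof. by rewrite /cabs2 ReM ImM; ring. Qed.
Lemma cabs2_rc (x : R) : cabs2 (rc x) = x ^+ 2.
Proof. by rewrite /cabs2 /= expr0n addr0. Qed.
Lemma mulcJ (z : C) : z * z^* = rc (cabs2 z).
Proof.
apply: complexE; rewrite ?ReM ?ImM Re_conj_complex Im_conj_complex /cabs2 /=; ring.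
Qed.
Lemma cabs2_eq0 (z : C) : cabs2 z = 0 -> z = 0.
Proof.
move=> /eqP; rewrite /cabs2 paddr_eq0 ?sqr_ge0// !sqrf_eq0 => /andP[/eqP a /eqP b].
exact: complexE.
Qed.
Lemma cabs20 : cabs2 (0 : C) = 0. Proof. by rewrite /cabs2 /= expr0n addr0. Qed.
Lemma rcM (x y : R) : rc (x * y) = rc x * rc y.
Proof. by apply: complexE; rewrite /= ?ReM ?ImM /=; ring. Qed.
Lemma rcD (x y : R) : rc (x + y) = rc x + rc y.
Proof. by apply: complexE; rewrite /= ?ReM ?ImM /= ?addr0. Qed.
Lemma rcN (x : R) : rc (- x) = - rc x.
Proof. by apply: complexE; rewrite /= ?oppr0. Qed.
Lemma rc0 : rc (0 : R) = 0. Proof. by []. Qed.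
Lemma conj_rc (x : R) : (rc x)^* = rc x.
Proof. by apply: complexE; rewrite ?Re_conj_complex ?Im_conj_complex /= ?oppr0. Qed.

Lemma cabs2D_le (z w : C) : cabs2 (z + w) <= 2 * cabs2 z + 2 * cabs2 w.
Proof.
rewrite /cabs2 ReD ImD.
have := sqr_ge0 (complex.Re z - complex.Re w).
have := sqr_ge0 (complex.Im z - complex.Im w).
nra.
Qed.

End ComplexFacts.

Section L2.
Context (R : realType) (d : nat).
Local Notation C := R[i].
Local Notation V := ('rV[R]_d).
Local Notation mu := (lebesgueRd R d).

Definition Rdintegrable (g : V -> R) :=
  mu.-integrable setT (EFin \o g \o @tup2rv R d).
Definition rint (g : V -> R) := Rintegral mu setT (g \o @tup2rv R d).

Lemma RdrintE (g : V -> R) : Rdintegrable g -> Rdrint g = rint g.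
Proof.
move=> ig; have /integrableP[mg _] := ig.
have mg' : Rdmeas g by exact/measurable_EFinP.
rewrite /rint /Rintegral integralE fineB; last 2 first.
- exact: integrable_pos_fin_num.
- exact: integrable_neg_fin_num.
have E (h : V -> R) : Rdmeas h -> (Rdint (fun x => (Num.max (h x) 0)%:E) =
    \int[mu]_x ((EFin \o h \o @tup2rv R d)^\+)%E x)%E.
  move=> mh; rewrite RdintE.
  - by apply: eq_integral => t _; rewrite funeposE/= EFin_max.
  - by apply/measurable_EFinP; apply: measurable_maxr.
  - by move=> x; rewrite lee_fin le_max lexx orbT.
rewrite /Rdrint E// E; last exact: measurableT_comp.
congr (_ - fine _); apply: eq_integral => t _.
by rewrite funeposE funenegE/= EFinN.
Qed.

Definition nrm2 (f : V -> C) := rint (fun x => cabs2 (f x)).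

Lemma Rdmeas_cabs2 (f : V -> C) : Rdmeas (fun x => complex.Re (f x)) ->
  Rdmeas (fun x => complex.Im (f x)) -> Rdmeas (fun x => cabs2 (f x)).
Proof.
by move=> m1 m2; apply: measurable_funD; apply: measurable_funX.
Qed.

Lemma inL2P (f : V -> C) : inL2 f <->
  [/\ Rdmeas (fun x => complex.Re (f x)), Rdmeas (fun x => complex.Im (f x))
    & Rdintegrable (fun x => cabs2 (f x))].
Proof.
split=> -[m1 m2 H]; split=> //; have mc := Rdmeas_cabs2 m1 m2.
  apply/integrableP; split; first exact/measurable_EFinP.
  move: H; rewrite RdintE; last 2 first.
  - exact/measurable_EFinP.
  - by move=> x; rewrite lee_fin cabs2_ge0.
  by under [X in (_ -> X < _)%E]eq_integral do rewrite gee0_abs ?lee_fin ?cabs2_ge0//.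
rewrite RdintE; last 2 first.
- exact/measurable_EFinP.
- by move=> x; rewrite lee_fin cabs2_ge0.
move/integrableP : H => [_].
by under eq_integral do rewrite gee0_abs ?lee_fin ?cabs2_ge0//.
Qed.

Lemma Rdintegrable_le (g h : V -> R) : Rdmeas g -> Rdintegrable h ->
  (forall x, `|g x| <= h x) -> Rdintegrable g.
Proof.
move=> mg ih gh; apply: le_integrable ih => //; first exact/measurable_EFinP.
by move=> t _; rewrite /= lee_fin (le_trans (gh _))// ler_norm.
Qed.

Lemma RdintegrableD (g h : V -> R) : Rdintegrable g -> Rdintegrable h ->
  Rdintegrable (fun x => g x + h x).
Proof. by move=> ig ih; have := integrableD measurableT ig ih. Qed.

Lemma RdintegrableN (g : V -> R) : Rdintegrable g -> Rdintegrable (fun x => - g x).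
Proof. by move=> ig; have := integrableN ig. Qed.

Lemma RdintegrableZ (k : R) (g : V -> R) : Rdintegrable g -> Rdintegrable (fun x => k * g x).
Proof. by move=> ig; have := integrableZl measurableT k ig. Qed.

Lemma rintD (g h : V -> R) : Rdintegrable g -> Rdintegrable h ->
  rint (fun x => g x + h x) = rint g + rint h.
Proof. by move=> ig ih; rewrite /rint -RintegralD. Qed.

Lemma rintZ k (g : V -> R) : Rdintegrable g -> rint (fun x => k * g x) = k * rint g.
Proof. by move=> ig; rewrite /rint -RintegralZl. Qed.

Lemma rintN (g : V -> R) : Rdintegrable g -> rint (fun x => - g x) = - rint g.
Proof.
move=> ig; rewrite -mulN1r -rintZ//; congr rint.
by apply/funext => x; rewrite mulN1r.
Qed.

(** Dominated by |uv| <= u^2 + v^2. The maps [u] and [v] stand for real or imaginary part, so that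
    one statement covers the four products in an inner product. *)
Lemma inL2_prod (f g : V -> C) (u v : C -> R) : inL2 f -> inL2 g ->
  Rdmeas (fun x => u (f x)) -> Rdmeas (fun x => v (g x)) ->
  (forall z, u z ^+ 2 <= cabs2 z) -> (forall z, v z ^+ 2 <= cabs2 z) ->
  Rdintegrable (fun x => u (f x) * v (g x)).
Proof.
move=> /inL2P[_ _ if2] /inL2P[_ _ ig2] mu_ mv_ Hu Hv.
apply: (Rdintegrable_le _ (RdintegrableD if2 ig2)); first exact: measurable_funM.
move=> x; have := Hu (f x); have := Hv (g x); rewrite normrM.
have := sqr_ge0 (`|u (f x)| - `|v (g x)|).
rewrite -(real_normK (num_real (u _))) -(real_normK (num_real (v _))).
have := normr_ge0 (u (f x)); have := normr_ge0 (v (g x)).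
nra.
Qed.

Lemma Re2_le (z : C) : complex.Re z ^+ 2 <= cabs2 z.
Proof. by rewrite /cabs2 lerDl sqr_ge0. Qed.
Lemma Im2_le (z : C) : complex.Im z ^+ 2 <= cabs2 z.
Proof. by rewrite /cabs2 lerDr sqr_ge0. Qed.

Lemma inL2_prods (f g : V -> C) : inL2 f -> inL2 g ->
  [/\ Rdintegrable (fun x => complex.Re (f x) * complex.Re (g x)),
      Rdintegrable (fun x => complex.Im (f x) * complex.Im (g x)),
      Rdintegrable (fun x => complex.Re (f x) * complex.Im (g x)) &
      Rdintegrable (fun x => complex.Im (f x) * complex.Re (g x))].
Proof.
move=> Lf Lg; have [mf1 mf2 _] := Lf; have [mg1 mg2 _] := Lg.
by split; apply: inL2_prod => // z; rewrite ?Re2_le ?Im2_le.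
Qed.

Lemma ipL2E (f g : V -> C) : inL2 f -> inL2 g -> ipL2 f g =
  Complex (rint (fun x => complex.Re (f x) * complex.Re (g x)) +
           rint (fun x => complex.Im (f x) * complex.Im (g x)))
          (rint (fun x => complex.Im (f x) * complex.Re (g x)) -
           rint (fun x => complex.Re (f x) * complex.Im (g x))).
Proof.
move=> Lf Lg; have [i1 i2 i3 i4] := inL2_prods Lf Lg.
rewrite /ipL2 /Rdcint; congr Complex.
- rewrite -rintD// -RdrintE; last exact: RdintegrableD.
  by congr Rdrint; apply/funext => x; rewrite ReM Re_conj_complex Im_conj_complex mulrN opprK.
- rewrite -rintN// -rintD//; last exact: RdintegrableN.
  rewrite -RdrintE; last by apply: RdintegrableD => //; exact: RdintegrableN.
  by congr Rdrint; apply/funext => x; rewrite ImM Re_conj_complex Im_conj_complex mulrN addrC.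
Qed.

Lemma inL20 : inL2 (fun _ : V => 0 : C).
Proof.
apply/inL2P; split; [exact: measurable_cst|exact: measurable_cst|].
rewrite /Rdintegrable (_ : _ \o _ = cst 0%E); first exact: integrable0.
by apply/funext => t /=; rewrite cabs20.
Qed.

Lemma inL2D (f g : V -> C) : inL2 f -> inL2 g -> inL2 (fun x => f x + g x).
Proof.
move=> /inL2P[f1 f2 f3] /inL2P[g1 g2 g3].
have m1 : Rdmeas (fun x => complex.Re (f x + g x)).
  rewrite (_ : (fun x => _) = (fun x => complex.Re (f x) + complex.Re (g x))).
    exact: measurable_funD.
  by apply/funext => x; rewrite ReD.
have m2 : Rdmeas (fun x => complex.Im (f x + g x)).
  rewrite (_ : (fun x => _) = (fun x => complex.Im (f x) + complex.Im (g x))).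
    exact: measurable_funD.
  by apply/funext => x; rewrite ImD.
apply/inL2P; split => //.
apply: (Rdintegrable_le _ (RdintegrableD (RdintegrableZ 2 f3) (RdintegrableZ 2 g3))).
  exact: Rdmeas_cabs2.
by move=> x; rewrite ger0_norm ?cabs2_ge0// cabs2D_le.
Qed.

Lemma inL2Z (c : C) (f : V -> C) : inL2 f -> inL2 (fun x => c * f x).
Proof.
move=> /inL2P[f1 f2 f3].
apply/inL2P; split.
- rewrite (_ : (fun x => _) = (fun x => complex.Re c * complex.Re (f x) - complex.Im c * complex.Im (f x))).
    by apply: measurable_funB; apply: measurable_funM.
  by apply/funext => x; rewrite ReM.
- rewrite (_ : (fun x => _) = (fun x => complex.Re c * complex.Im (f x) + complex.Im c * complex.Re (f x))).
    by apply: measurable_funD; apply: measurable_funM.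
  by apply/funext => x; rewrite ImM.
rewrite (_ : (fun x => _) = (fun x => cabs2 c * cabs2 (f x))).
  exact: RdintegrableZ.
by apply/funext => x; rewrite cabs2M.
Qed.

Lemma ipJ (f g : V -> C) : inL2 f -> inL2 g -> ipL2 g f = (ipL2 f g)^*.
Proof.
move=> Lf Lg; rewrite !ipL2E//.
apply: complexE; rewrite ?Re_conj_complex ?Im_conj_complex /= ?opprB;
[congr (_ + _)|congr (_ - _)]; congr rint; apply/funext => x; exact: mulrC.
Qed.

Lemma ipDl (f g h : V -> C) : inL2 f -> inL2 g -> inL2 h ->
  ipL2 (fun x => f x + g x) h = ipL2 f h + ipL2 g h.
Proof.
move=> Lf Lg Lh; have Lfg := inL2D Lf Lg; rewrite !ipL2E//.
have [i1 i2 i3 i4] := inL2_prods Lf Lh; have [j1 j2 j3 j4] := inL2_prods Lg Lh.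
have E (u v : C -> R) : (forall z w, u (z + w) = u z + u w) ->
  Rdintegrable (fun x => u (f x) * v (h x)) -> Rdintegrable (fun x => u (g x) * v (h x)) ->
  rint (fun x => u (f x + g x) * v (h x)) =
  rint (fun x => u (f x) * v (h x)) + rint (fun x => u (g x) * v (h x)).
  move=> uD k1 k2; rewrite -rintD//; congr rint; apply/funext => x.
  by rewrite uD mulrDl.
apply: complexE; rewrite ?ReD ?ImD /= !E// ?ReD ?ImD//; try exact: ReD; try exact: ImD.
  by rewrite addrACA.
by rewrite opprD addrACA.
Qed.

Lemma ipZl (c : C) (f h : V -> C) : inL2 f -> inL2 h ->
  ipL2 (fun x => c * f x) h = c * ipL2 f h.
Proof.
move=> Lf Lh; have Lcf := inL2Z c Lf; rewrite !ipL2E//.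
have [i1 i2 i3 i4] := inL2_prods Lf Lh.
have ER (v : C -> R) : Rdintegrable (fun x => complex.Re (f x) * v (h x)) ->
  Rdintegrable (fun x => complex.Im (f x) * v (h x)) ->
  rint (fun x => complex.Re (c * f x) * v (h x)) =
  complex.Re c * rint (fun x => complex.Re (f x) * v (h x)) -
  complex.Im c * rint (fun x => complex.Im (f x) * v (h x)).
  move=> k1 k2; rewrite -rintZ// -rintZ// -rintN; last exact: RdintegrableZ.
  rewrite -rintD; [|exact: RdintegrableZ|by apply: RdintegrableN; exact: RdintegrableZ].
  by congr rint; apply/funext => x; rewrite ReM; ring.
have EI (v : C -> R) : Rdintegrable (fun x => complex.Re (f x) * v (h x)) ->
  Rdintegrable (fun x => complex.Im (f x) * v (h x)) ->
  rint (fun x => complex.Im (c * f x) * v (h x)) =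
  complex.Re c * rint (fun x => complex.Im (f x) * v (h x)) +
  complex.Im c * rint (fun x => complex.Re (f x) * v (h x)).
  move=> k1 k2; rewrite -rintZ// -rintZ//.
  rewrite -rintD; [|exact: RdintegrableZ|exact: RdintegrableZ].
  by congr rint; apply/funext => x; rewrite ImM; ring.
by apply: complexE; rewrite ?ReM ?ImM /= !ER// !EI//; ring.
Qed.

Lemma ip_ff (f : V -> C) : inL2 f -> ipL2 f f = rc (nrm2 f).
Proof.
move=> Lf; have [i1 i2 i3 i4] := inL2_prods Lf Lf; rewrite ipL2E//.
apply: complexE => /=.
  by rewrite -rintD//; congr rint; apply/funext => x; rewrite /cabs2 !expr2.
by apply/eqP; rewrite subr_eq0; apply/eqP; congr rint; apply/funext => x; rewrite mulrC.
Qed.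

Lemma nrm2_ge0 (f : V -> C) : 0 <= nrm2 f.
Proof. by apply: Rintegral_ge0 => t _; rewrite cabs2_ge0. Qed.

Lemma ipZr (c : C) (f h : V -> C) : inL2 f -> inL2 h ->
  ipL2 f (fun x => c * h x) = c^* * ipL2 f h.
Proof.
move=> Lf Lh; rewrite ipJ//; last exact: inL2Z.
by rewrite ipZl// rmorphM/= -ipJ.
Qed.

Lemma ipDr (f g h : V -> C) : inL2 f -> inL2 g -> inL2 h ->
  ipL2 f (fun x => g x + h x) = ipL2 f g + ipL2 f h.
Proof.
move=> Lf Lg Lh; rewrite ipJ//; last exact: inL2D.
by rewrite ipDl// rmorphD/= -!ipJ.
Qed.

Lemma ip0l (h : V -> C) : inL2 h -> ipL2 (fun=> 0) h = 0.
Proof.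
move=> Lh; rewrite -[RHS](mul0r (ipL2 (fun=> 0) h)) -ipZl//; last exact: inL20.
by congr ipL2; apply/funext => x; rewrite mul0r.
Qed.

Lemma inL2_sum (I : Type) (r : seq I) (F : I -> V -> C) : (forall i, inL2 (F i)) ->
  inL2 (fun x => \sum_(i <- r) F i x).
Proof.
move=> LF; elim: r => [|i r IH].
  rewrite (_ : (fun x => _) = fun=> 0); first exact: inL20.
  by apply/funext => x; rewrite big_nil.
rewrite (_ : (fun x => _) = fun x => F i x + \sum_(i <- r) F i x); first exact: inL2D.
by apply/funext => x; rewrite big_cons.
Qed.

Lemma ip_suml (I : Type) (r : seq I) (F : I -> V -> C) (h : V -> C) :
  (forall i, inL2 (F i)) -> inL2 h ->
  ipL2 (fun x => \sum_(i <- r) F i x) h = \sum_(i <- r) ipL2 (F i) h.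
Proof.
move=> LF Lh; elim: r => [|i r IH].
  rewrite [RHS]big_nil -[RHS](ip0l Lh); congr ipL2.
  by apply/funext => x; rewrite big_nil.
rewrite [RHS]big_cons -IH -ipDl//; last exact: inL2_sum.
by congr ipL2; apply/funext => x; rewrite big_cons.
Qed.

Lemma ip_sumr (I : Type) (r : seq I) (F : I -> V -> C) (h : V -> C) :
  (forall i, inL2 (F i)) -> inL2 h ->
  ipL2 h (fun x => \sum_(i <- r) F i x) = \sum_(i <- r) ipL2 h (F i).
Proof.
move=> LF Lh; rewrite ipJ//; last exact: inL2_sum.
by rewrite ip_suml// rmorph_sum/=; apply: eq_bigr => i _; rewrite -ipJ.
Qed.

Lemma nrm2_sub (f g : V -> C) (c : C) : inL2 f -> inL2 g ->
  rc (nrm2 (fun x => f x + c * g x)) =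
  rc (nrm2 f) + c^* * ipL2 f g + c * (ipL2 f g)^* + rc (cabs2 c * nrm2 g).
Proof.
move=> Lf Lg; have Lcg := inL2Z c Lg; have Ls := inL2D Lf Lcg.
rewrite -ip_ff// ipDl// !ipDr// ipZr// !ipZl// ipZr// -ipJ//.
by rewrite !ip_ff// rcM -mulcJ; ring.
Qed.

Lemma cauchy_schwarz (f g : V -> C) : inL2 f -> inL2 g ->
  cabs2 (ipL2 f g) <= nrm2 f * nrm2 g.
Proof.
move=> Lf Lg; set c := ipL2 f g; set a := nrm2 f; set b := nrm2 g.
(* The square norm of f - t <f,g> g, as a polynomial in the real variable t. *)
have H (t : R) : 0 <= a - 2 * t * cabs2 c + t ^+ 2 * cabs2 c * b.
  have E := @nrm2_sub f g (- rc t * c) Lf Lg.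
  have : 0 <= nrm2 (fun x => f x + - rc t * c * g x) by exact: nrm2_ge0.
  have -> : nrm2 (fun x => f x + - rc t * c * g x) =
     a - 2 * t * cabs2 c + t ^+ 2 * cabs2 c * b; last by [].
  have : rc (nrm2 (fun x => f x + - rc t * c * g x)) =
     rc (a - 2 * t * cabs2 c + t ^+ 2 * cabs2 c * b); last by case.
  rewrite E -/c -/a -/b rmorphM rmorphN/= conj_rc cabs2M.
  rewrite (_ : cabs2 (- rc t) = t ^+ 2); last by rewrite -rcN cabs2_rc sqrrN.
  have -> : - rc t * c^* * c = - rc (t * cabs2 c) by rewrite rcM -mulcJ; ring.
  have -> : - rc t * c * c^* = - rc (t * cabs2 c) by rewrite rcM -mulcJ; ring.
  by rewrite -!rcN -!rcD; congr rc; ring.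
have a0 : 0 <= a := nrm2_ge0 f; have b0 : 0 <= b := nrm2_ge0 g.
have c0 := cabs2_ge0 c.
case: (ltgtP 0 b) b0 => // [b0 _|b0 _].
  (* The minimum of the quadratic polynomial is at t = 1/b. *)
  have := H b^-1; rewrite -(ler_pM2r b0) mul0r.
  rewrite [X in _ <= X -> _](_ : _ = a * b - cabs2 c) ?subr_ge0//.
  by field; rewrite gt_eqF.
rewrite -b0 mulr0 leNgt; apply/negP => cp.
(* With b = 0 the polynomial is affine of slope -2 |<f,g>|^2; this t gives it the negative value -(a
   + 2). *)
have := H ((a + 1) / cabs2 c); rewrite -b0 mulr0 addr0.
rewrite [X in _ <= X -> _](_ : _ = - (a + 2)); last by field; rewrite gt_eqF.
by rewrite oppr_ge0; move: a0; lra.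
Qed.

End L2.

(** * Completeness of L^2 and Parseval's identity *)

Section RieszFischer.
Context (R : realType).
Local Notation C := R[i].

(* The weights 2^k make square-summability of the increments imply their summability. *)
Lemma cvg_complex_telescope (z : nat -> C) (w : R) :
  (forall n, \sum_(0 <= k < n) 2 ^+ k * cabs2 (z k.+1 - z k) <= w) ->
  exists l : C, [/\ (complex.Re (z n) @[n --> \oo] --> complex.Re l),
    (complex.Im (z n) @[n --> \oo] --> complex.Im l) &
    forall n, cabs2 (l - z n) <= 2 * 2^-1 ^+ n * w].
Proof.
move=> zw.
have h2 (n : nat) : 0 < (2^-1 : R) ^+ n by rewrite exprn_gt0 ?invr_gt0.
have t0 (k : nat) : 0 <= (2 : R) ^+ k * cabs2 (z k.+1 - z k).
  by rewrite mulr_ge0 ?cabs2_ge0 ?exprn_ge0.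
(* The factor 2 lost in [cabs2D_le] at each step is regained by passing from 2^-n to 2^-(n+1). *)
have H1 k n : cabs2 (z (n + k)%N - z n) <=
    2 * 2^-1 ^+ n * \sum_(n <= l < n + k) 2 ^+ l * cabs2 (z l.+1 - z l).
  elim: k n => [|k IH] n.
    by rewrite addn0 subrr cabs20 big_geq// mulr0.
  rewrite -addSnnS (_ : z (n.+1 + k)%N - z n = (z n.+1 - z n) + (z (n.+1 + k)%N - z n.+1)); last by ring.
  apply: (le_trans (cabs2D_le _ _)).
  rewrite (big_ltn (n := (n.+1 + k)%N)) ?leq_addr// [leRHS]mulrDr lerD//.
    by rewrite mulrA -[2 * _ ^+ n * _]mulrA -exprMn mulVf ?pnatr_eq0// expr1n mulr1.
  apply: (le_trans (ler_wpM2l _ (IH _))) => //.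
  by rewrite exprS !mulrA mulfK ?pnatr_eq0.
have H k n : cabs2 (z (n + k)%N - z n) <= 2 * 2^-1 ^+ n * w.
  apply: (le_trans (H1 _ _)); apply: ler_wpM2l; first by rewrite mulr_ge0 ?ltW.
  apply: le_trans (zw (n + k)%N).
  rewrite [leRHS](big_cat_nat (n := n))//= ?leq_addr// lerDr.
  by rewrite sumr_ge0.
have w0 : 0 <= w by have := zw 0%N; rewrite big_geq.
have small (e : R) : 0 < e -> exists n, 2 * 2^-1 ^+ n * w < e.
  move=> e0; have : (2 * w) * (2^-1 : R) ^+ n @[n --> \oo] --> (2 * w) * 0.
    by apply: cvgMr; apply: cvg_expr; rewrite ger0_norm ?invr_ge0// invf_lt1// ltr1n.
  rewrite mulr0 => /cvgr_lt /(_ e e0)[N _ /(_ N (leqnn N))/= HN].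
  by exists N; rewrite mulrAC.
have cv (u : C -> R) : (forall a b, u (a - b) = u a - u b) ->
    (forall a, u a ^+ 2 <= cabs2 a) -> cvgn (fun n => u (z n)).
  move=> uB u2; apply: cauchy_cvg; apply: cauchy_exP => e e0.
  have [n Hn] := small (e ^+ 2) (exprn_gt0 2 e0).
  exists (u (z n)); exists n => // m /= nm.
  rewrite /ball/= -(subnKC nm) distrC -uB.
  rewrite -(@ltr_pXn2r _ 2)// ?nnegrE ?ltW// real_normK ?num_real//.
  exact: le_lt_trans (u2 _) (le_lt_trans (H _ _) Hn).
have cR : cvgn (fun n => complex.Re (z n)).
  by apply: cv; [by move=> [? ?] [? ?]|exact: Re2_le].
have cI : cvgn (fun n => complex.Im (z n)).
  by apply: cv; [by move=> [? ?] [? ?]|exact: Im2_le].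
exists (Complex (limn (fun n => complex.Re (z n))) (limn (fun n => complex.Im (z n)))).
split=> // n; set l := Complex _ _.
have : cabs2 (z m - z n) @[m --> \oo] --> cabs2 (l - z n).
  have E a : cabs2 (a - z n) = (complex.Re a - complex.Re (z n)) * (complex.Re a - complex.Re (z n)) +
    (complex.Im a - complex.Im (z n)) * (complex.Im a - complex.Im (z n)).
    by case: a => ? ?; case: (z n) => ? ?; rewrite /cabs2 /= !expr2.
  under eq_fun do rewrite E. rewrite E.
  by apply: cvgD; apply: cvgM; apply: cvgB => //; exact: cvg_cst.
move=> /[dup] /(cvg_lim (@Rhausdorff R)) <- cl.
apply: limr_le; first by apply/cvg_ex; eexists; exact: cl.
exists n => // m /= nm; rewrite -(subnKC nm); exact: H.
Qed.

Context (d : nat).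
Local Notation V := ('rV[R]_d).
Local Notation mu := (lebesgueRd R d).

Lemma nrm2E (f : V -> C) : inL2 f ->
  (\int[mu]_t (cabs2 (f (tup2rv t)))%:E)%E = (nrm2 f)%:E.
Proof.
move=> /inL2P[_ _ i]; rewrite /nrm2 /rint /Rintegral fineK//.
exact: (integrable_fin_num _ i).
Qed.

Lemma inL2N (f : V -> C) : inL2 f -> inL2 (fun x => - f x).
Proof.
move=> Lf; rewrite (_ : (fun x => _) = fun x => -1 * f x); first exact: inL2Z.
by apply/funext => x; rewrite mulN1r.
Qed.

Lemma inL2B (f g : V -> C) : inL2 f -> inL2 g -> inL2 (fun x => f x - g x).
Proof. by move=> Lf Lg; apply: inL2D => //; exact: inL2N. Qed.

(** The weighted sum W of the squared increments has integral at most sum_k 2^k 4^-k = 2, hence is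
    finite almost everywhere. Where it is finite the sequence converges pointwise with |g - f_k|^2
    <= 2 * 2^-k * W, and integrating gives the stated rate. *)
Lemma riesz_fischer (f : nat -> V -> C) : (forall k, inL2 (f k)) ->
  (forall k, nrm2 (fun x => f k.+1 x - f k x) <= 4^-1 ^+ k) ->
  exists2 g, inL2 g & forall k, nrm2 (fun x => g x - f k x) <= 4 * 2^-1 ^+ k.
Proof.
move=> Lf fS.
pose D k (x : V) : R := 2 ^+ k * cabs2 (f k.+1 x - f k x).
pose W (x : V) : \bar R := (\sum_(0 <= k <oo) (D k x)%:E)%E.
have D0 k x : 0 <= D k x by rewrite mulr_ge0 ?cabs2_ge0 ?exprn_ge0.
have LD k : inL2 (fun x => f k.+1 x - f k x) by exact: inL2B.
have iD k : Rdintegrable (D k).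
  by apply: RdintegrableZ; have /inL2P[] := LD k.
have mD k : measurable_fun setT (fun t : d.-tuple R => (D k (tup2rv t))%:E).
  by have /integrableP[] := iD k.
have mW : measurable_fun setT (fun t : d.-tuple R => W (tup2rv t)).
  apply: ge0_emeasurable_sum => //.
  by move=> k t _ _; rewrite lee_fin.
have W0 x : (0 <= W x)%E by apply: nneseries_ge0 => k _ _; rewrite lee_fin.
have iW : (\int[mu]_t W (tup2rv t) <= 2%:E)%E.
  rewrite integral_nneseries//; last by move=> n t _; rewrite lee_fin.
  apply: lime_le.
    by apply: is_cvg_nneseries => n _ _; apply: integral_ge0 => t _; rewrite lee_fin.
  apply: nearW => n.
  have E k : (\int[mu]_t (D k (tup2rv t))%:E)%E = (2 ^+ k * nrm2 (fun x => f k.+1 x - f k x))%:E.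
    have mc : measurable_fun setT (fun t : d.-tuple R => (cabs2 (f k.+1 (tup2rv t) - f k (tup2rv t)))%:E).
      by have /inL2P[m1 m2 _] := LD k; apply/measurable_EFinP; exact: (Rdmeas_cabs2 m1 m2).
    rewrite EFinM -nrm2E// -(ge0_integralZl _ measurableT mc).
    - by apply: eq_integral => t _; rewrite -EFinM.
    - by move=> t _; rewrite lee_fin cabs2_ge0.
    - by rewrite lee_fin exprn_ge0.
  under eq_bigr do rewrite E.
  rewrite sumEFin lee_fin.
  apply: (@le_trans _ _ (\sum_(0 <= k < n) 2^-1 ^+ k)).
    apply: ler_sum => k _; apply: (le_trans (ler_wpM2l _ (fS k))).
      by rewrite exprn_ge0.
    rewrite -exprMn (_ : 2 * 4^-1 = 2^-1 :> R)//; by field.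
  have -> : \sum_(0 <= k < n) (2^-1 : R) ^+ k = 2 - 2 * 2^-1 ^+ n.
    elim: n => [|n IH]; first by rewrite big_geq// expr0 mulr1 subrr.
    by rewrite big_nat_recr//= IH exprS; lra.
  by rewrite gerBl mulr_ge0// exprn_ge0// invr_ge0.
have partial x : (W x < +oo)%E -> forall n, \sum_(0 <= k < n) D k x <= fine (W x).
  move=> Wx n; rewrite -lee_fin fineK ?ge0_fin_numE// -sumEFin.
  by apply: nneseries_lim_ge => k _ _; rewrite lee_fin.
(* The value 0 where W is infinite makes g an everywhere limit of the measurable functions [f n] cut
   off by the indicator of [A]. *)
have Hex : forall x, exists l : C, if (W x < +oo)%E then
    [/\ (complex.Re (f n x) @[n --> \oo] --> complex.Re l),
    (complex.Im (f n x) @[n --> \oo] --> complex.Im l) &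
    forall n, cabs2 (l - f n x) <= 2 * 2^-1 ^+ n * fine (W x)] else l = 0.
  move=> x; case: (boolP (W x < +oo)%E) => Wx; last by exists 0.
  by apply: cvg_complex_telescope; exact: partial.
have [g Hg] := boolp.choice Hex.
pose A := [set t : d.-tuple R | (W (tup2rv t) < +oo)%E].
have mA : measurable A.
  by have := emeasurable_fun_infty_o measurableT mW +oo%E; rewrite setTI.
have mg (u : C -> R) : (u 0 = 0) -> (forall n, Rdmeas (fun x => u (f n x))) ->
   (forall x, (W x < +oo)%E -> u (f n x) @[n --> \oo] --> u (g x)) ->
   Rdmeas (fun x => u (g x)).
  move=> u0 mu_ ug.
  apply: (@measurable_fun_cvg _ _ _ _
    (fun n (t : d.-tuple R) => u (f n (tup2rv t)) * \1_A t)).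
    by move=> n; apply: measurable_funM => //; exact: mu_.
  move=> t _; rewrite indicE; case: (boolP (W (tup2rv t) < +oo)%E) => Wt.
    rewrite mem_set// (_ : (fun n => _) = (fun n => u (f n (tup2rv t)))).
      exact: ug.
    by apply/funext => n; rewrite mulr1.
  rewrite memNset; last exact/negP.
  rewrite (_ : (fun n => _) = fun=> 0); last by apply/funext => n; rewrite mulr0.
  have := Hg (tup2rv t); rewrite (negbTE Wt) => /= ->; rewrite u0.
  exact: cvg_cst.
have mR : Rdmeas (fun x => complex.Re (g x)).
  apply: mg => // [n|x Wx]; first by have [] := Lf n.
  by have := Hg x; rewrite Wx => -[].
have mI : Rdmeas (fun x => complex.Im (g x)).
  apply: mg => // [n|x Wx]; first by have [] := Lf n.
  by have := Hg x; rewrite Wx => -[].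
have mB k : Rdmeas (fun x => complex.Re (g x - f k x)) /\
            Rdmeas (fun x => complex.Im (g x - f k x)).
  have [m1 m2 _] := Lf k; split.
    rewrite (_ : (fun x => _) = (fun x => complex.Re (g x) - complex.Re (f k x))).
      exact: measurable_funB.
    by apply/funext => x; case: (g x); case: (f k x).
  rewrite (_ : (fun x => _) = (fun x => complex.Im (g x) - complex.Im (f k x))).
    exact: measurable_funB.
  by apply/funext => x; case: (g x); case: (f k x).
have bd k : (\int[mu]_t (cabs2 (g (tup2rv t) - f k (tup2rv t)))%:E <= (4 * 2^-1 ^+ k)%:E)%E.
  have [m1 m2] := mB k.
  apply: (@le_trans _ _ (\int[mu]_t ((2 * 2^-1 ^+ k)%:E * W (tup2rv t))))%E.
    apply: ge0_le_integral => //.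
    - by move=> t _; rewrite lee_fin cabs2_ge0.
    - by apply/measurable_EFinP; exact: (Rdmeas_cabs2 m1 m2).
    - exact: measurable_funeM.
    move=> t _; case: (boolP (W (tup2rv t) < +oo)%E) => Wt.
      have := Hg (tup2rv t); rewrite Wt => -[_ _ /(_ k)].
      by rewrite -lee_fin EFinM fineK ?ge0_fin_numE.
    move: Wt; rewrite -leNgt leye_eq => /eqP ->.
    by rewrite gt0_muley ?leey// lte_fin mulr_gt0// exprn_gt0// invr_gt0.
  rewrite ge0_integralZl//.
  apply: (le_trans (lee_wpmul2l _ iW)).
    by rewrite lee_fin mulr_ge0// exprn_ge0// invr_ge0.
  by rewrite -EFinM lee_fin mulrAC -natrM.
have LB k : inL2 (fun x => g x - f k x).
  have [m1 m2] := mB k; split => //; rewrite RdintE.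
  - exact: le_lt_trans (bd k) (ltry _).
  - by apply/measurable_EFinP; exact: (Rdmeas_cabs2 m1 m2).
  - by move=> x; rewrite lee_fin cabs2_ge0.
exists g => [|k]; last by rewrite -lee_fin -nrm2E.
rewrite (_ : g = fun x => (g x - f 0%N x) + f 0%N x); first exact: inL2D.
by apply/funext => x; rewrite subrK.
Qed.

End RieszFischer.

(** * Parseval's identity for a complete orthonormal family *)

Section Parseval.
Context (R : realType).
Local Notation C := R[i].

Lemma sum_le_esum (I : choiceType) (a : I -> R) (r : seq I) : (forall i, 0 <= a i) ->
  uniq r -> ((\sum_(i <- r) a i)%:E <= \esum_(i in [set: I]) (a i)%:E)%E.
Proof.
move=> a0 ur; rewrite -sumEFin fsbig_seq//.
by apply: ereal_sup_ubound; exists [set` r].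
Qed.

Lemma esum_le_sum (I : choiceType) (a : I -> R) (x : R) :
  (forall r, uniq r -> \sum_(i <- r) a i <= x) ->
  (\esum_(i in [set: I]) (a i)%:E <= x%:E)%E.
Proof.
move=> H; apply: ge_ereal_sup => _ [X [fX _] <-].
by rewrite fsbig_finite// sumEFin lee_fin H// finmap.fset_uniq.
Qed.

Context (d : nat).
Local Notation V := ('rV[R]_d).

Lemma ipBl (f g h : V -> C) : inL2 f -> inL2 g -> inL2 h ->
  ipL2 (fun x => f x - g x) h = ipL2 f h - ipL2 g h.
Proof.
move=> Lf Lg Lh; rewrite -[X in _ - X]mul1r -mulNr -ipZl// -ipDl//; last exact: inL2Z.
by congr ipL2; apply/funext => x; rewrite mulN1r.
Qed.

Lemma nrm2B (f g : V -> C) : inL2 f -> inL2 g ->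
  nrm2 (fun x => f x - g x) = nrm2 f - 2 * complex.Re (ipL2 f g) + nrm2 g.
Proof.
move=> Lf Lg; have := nrm2_sub (-1) Lf Lg.
have -> : (fun x => f x + -1 * g x) = fun x => f x - g x.
  by apply/funext => x; rewrite mulN1r.
rewrite rmorphN1 !mulN1r.
have -> : cabs2 (- 1 : C) = 1 by rewrite /cabs2 /= oppr0 expr0n sqrrN expr1n addr0.
have ReN (z : C) : complex.Re (- z) = - complex.Re z by case: z.
rewrite mul1r => /(congr1 (@complex.Re R)); rewrite !ReD !ReN Re_conj_complex /= => ->.
by ring.
Qed.

Lemma nrm2D_le (f g : V -> C) : inL2 f -> inL2 g ->
  nrm2 (fun x => f x + g x) <= 2 * nrm2 f + 2 * nrm2 g.
Proof.
move=> Lf Lg; have Lfg := inL2D Lf Lg.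
have /inL2P[_ _ i1] := Lf; have /inL2P[_ _ i2] := Lg; have /inL2P[_ _ i3] := Lfg.
rewrite /nrm2 -!rintZ// -rintD; [|exact: RdintegrableZ|exact: RdintegrableZ].
apply: le_Rintegral => //.
  by apply: (RdintegrableD (RdintegrableZ 2 i1) (RdintegrableZ 2 i2)).
by move=> t _ /=; exact: cabs2D_le.
Qed.

(** Completeness is available only as a statement about vectors orthogonal to the whole family. The
    limit G of partial sums is therefore constructed by Riesz-Fischer, and completeness is applied
    to f - G. As I is an arbitrary index type, partial sums run over duplicate-free lists that
    nearly attain the supremum S. *)
Lemma parseval (I : choiceType) (e : I -> V -> C) (f : V -> C) :
  is_onb (@inL2 R d) (@ipL2 R d) e -> inL2 f ->
  (\esum_(i in [set: I]) (cabs2 (ipL2 f (e i)))%:E = (nrm2 f)%:E)%E.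
Proof.
move=> [Le eo ec] Lf.
pose c i := ipL2 f (e i); pose g r x := \sum_(i <- r) c i * e i x.
pose s (r : seq I) := \sum_(i <- r) cabs2 (c i).
have Lce i : inL2 (fun x => c i * e i x) by exact: inL2Z.
have Lg r : inL2 (g r) by exact: (inL2_sum r Lce).
have ipg r j : uniq r -> ipL2 (g r) (e j) = if j \in r then c j else 0.
  move=> ur; rewrite (ip_suml r Lce (Le j)).
  under eq_bigr do rewrite ipZl// eo.
  elim: r ur => [_|i r IH /= /andP[ir ur]]; first by rewrite big_nil.
  rewrite big_cons IH// in_cons (eq_sym j).
  have [<-|ij] := eqVneq i j; first by rewrite mulr1 (negbTE ir) addr0.
  by rewrite mulr0 add0r.
have ipfg r : ipL2 f (g r) = rc (s r).
  rewrite (ip_sumr r Lce Lf); under eq_bigr do rewrite ipZr// mulrC -/(c _) mulcJ.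
  by rewrite /s; elim: r => [|i r IH]; rewrite ?big_nil ?big_cons ?rc0// rcD IH.
have ipgg u r : uniq u -> {subset r <= u} -> ipL2 (g u) (g r) = rc (s r).
  move=> uu ru; rewrite (ip_sumr r Lce (Lg u)).
  rewrite -ipfg (ip_sumr r Lce Lf) big_seq [RHS]big_seq; apply: eq_bigr => i ir.
  by rewrite !ipZr// ipg// ru.
have ng r : uniq r -> nrm2 (g r) = s r.
  by move=> ur; have := ipgg r r ur (fun=> id); rewrite ip_ff// => -[].
have nfg r : uniq r -> nrm2 (fun x => f x - g r x) = nrm2 f - s r.
  by move=> ur; rewrite nrm2B// ipfg ng//=; ring.
have ngg u r : uniq u -> uniq r -> {subset r <= u} -> nrm2 (fun x => g u x - g r x) = s u - s r.
  by move=> uu ur ru; rewrite nrm2B// ipgg// !ng//=; ring.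
have bessel r : uniq r -> s r <= nrm2 f.
  by move=> ur; rewrite -subr_ge0 -nfg// nrm2_ge0.
set S := (\esum_(i in _) _)%E.
have Sle : (S <= (nrm2 f)%:E)%E by apply: esum_le_sum.
have sS r : uniq r -> ((s r)%:E <= S)%E.
  by move=> ur; apply: (@sum_le_esum _ (fun i => cabs2 (c i))) => // i; exact: cabs2_ge0.
have S0 : (0 <= S)%E by apply: esum_ge0 => i _; rewrite lee_fin cabs2_ge0.
have Sfin : S \is a fin_num by rewrite ge0_fin_numE// (le_lt_trans Sle)// ltry.
have near_S (x : R) : 0 < x -> exists r, uniq r /\ fine S - x <= s r.
  move=> x0; apply: contrapT => /forallNP H.
  suff : (S <= (fine S - x)%:E)%E.
    by rewrite -[leLHS]fineK// lee_fin; move: x0; lra.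
  apply: esum_le_sum => r ur; rewrite leNgt; apply/negP => Hr.
  by apply: (H r); split => //; exact: ltW.
(* The factor 1/16 leaves room for comparing consecutive lists: 2 (1/16) 4^-k + 2 (1/16) 4^-(k+1) <=
   4^-k. *)
have e0 k : 0 < 16^-1 * (4^-1 : R) ^+ k by rewrite mulr_gt0 ?exprn_gt0 ?invr_gt0.
have [r Hr] := boolp.choice (fun k => near_S _ (e0 k)).
have rS k u : uniq u -> {subset r k <= u} -> nrm2 (fun x => g u x - g (r k) x) <= 16^-1 * 4^-1 ^+ k.
  move=> uu ru; have [urk Hrk] := Hr k; rewrite ngg//.
  by have := sS u uu; rewrite -[S]fineK// lee_fin; lra.
have Hd k : nrm2 (fun x => g (r k.+1) x - g (r k) x) <= 4^-1 ^+ k.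
  (* The chosen lists need not be nested, so both are compared with their union. *)
  pose u := undup (r k.+1 ++ r k).
  have uu : uniq u by exact: undup_uniq.
  have h1 : nrm2 (fun x => g u x - g (r k) x) <= 16^-1 * 4^-1 ^+ k.
    by apply: rS => // i; rewrite /u mem_undup mem_cat => ->; rewrite orbT.
  have h2 : nrm2 (fun x => g u x - g (r k.+1) x) <= 16^-1 * 4^-1 ^+ k.+1.
    by apply: rS => // i; rewrite /u mem_undup mem_cat => ->.
  rewrite (_ : (fun x => _) = fun x => (g u x - g (r k) x) + (-1) * (g u x - g (r k.+1) x)); last first.
    by apply/funext => x; ring.
  have N1 h : inL2 h -> nrm2 (fun x => -1 * h x) = nrm2 h.
    move=> Lh; congr rint; apply/funext => x; rewrite cabs2M.
    by rewrite /cabs2 /= oppr0 expr0n sqrrN expr1n addr0 mul1r.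
  have L1 := inL2B (Lg u) (Lg (r k)); have L2 := inL2B (Lg u) (Lg (r k.+1)).
  apply: (le_trans (nrm2D_le L1 (inL2Z _ L2))); rewrite N1//.
  move: h1 h2; rewrite exprS; have := e0 k; set y := 4^-1 ^+ k; lra.
have [G LG HG] := riesz_fischer (fun k => Lg (r k)) Hd.
have small (x : R) : 0 < x -> exists k, 4 * 2^-1 ^+ k < x /\ 4^-1 ^+ k < x.
  move=> x0.
  have : 4 * (2^-1 : R) ^+ n @[n --> \oo] --> 4 * (0 : R).
    by apply: cvgMr; apply: cvg_expr; rewrite ger0_norm ?invr_ge0// invf_lt1// ltr1n.
  rewrite mulr0 => /cvgr_lt /(_ x x0)[N _ /(_ N (leqnn N))/= HN].
  exists N; split => //; apply: le_lt_trans HN.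
  have h : (4^-1 : R) ^+ N <= 2^-1 ^+ N.
    by apply: lerXn2r; rewrite ?nnegrE ?invr_ge0// lef_pV2 ?posrE// ler_nat.
  apply: (le_trans h); rewrite ler_peMl ?exprn_ge0 ?invr_ge0// ler1n//.
have LfG : inL2 (fun x => f x - G x) by exact: inL2B.
have fG : ipL2 (fun x => f x - G x) (fun x => f x - G x) = 0.
  apply: ec => // i.
  apply: cabs2_eq0; apply/eqP; rewrite eq_le cabs2_ge0 andbT leNgt; apply/negP => p0.
  set p := cabs2 _ in p0.
  have [k [k1 k2]] : exists k, 4 * 2^-1 ^+ k < p / 4 /\ 4^-1 ^+ k < p / 4.
    by apply: small; rewrite divr_gt0.
  have [urk Hrk] := Hr k.
  have LGr := inL2B (Lg (r k)) LG; have Lfr := inL2B Lf (Lg (r k)).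
  have E : ipL2 (fun x => f x - G x) (e i) =
      ipL2 (fun x => f x - g (r k) x) (e i) + ipL2 (fun x => g (r k) x - G x) (e i).
    by rewrite -ipDl//; congr ipL2; apply/funext => x; ring.
  have : p <= 2 * cabs2 (ipL2 (fun x => f x - g (r k) x) (e i)) +
              2 * cabs2 (ipL2 (fun x => g (r k) x - G x) (e i)).
    by rewrite /p E; exact: cabs2D_le.
  (* If i is missing from the list, adding it still keeps the partial sum below S, so |c_i|^2 is at
     most the defect S - s(r k). *)
  have c1 : cabs2 (ipL2 (fun x => f x - g (r k) x) (e i)) <= 16^-1 * 4^-1 ^+ k.
    rewrite ipBl// ipg// -/(c i); case: ifPn => ir.
      by rewrite subrr cabs20 ltW.
    rewrite subr0; have := sS (i :: r k); rewrite /= ir urk => /(_ isT).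
    rewrite -[S]fineK// lee_fin /s big_cons -/(s (r k)); move: Hrk; lra.
  have c2 : cabs2 (ipL2 (fun x => g (r k) x - G x) (e i)) <= 4 * 2^-1 ^+ k.
    apply: (le_trans (cauchy_schwarz LGr (Le i))).
    have : ipL2 (e i) (e i) = 1 by rewrite eo eqxx.
    rewrite ip_ff// => -[->]; rewrite mulr1; apply: le_trans (HG k).
    rewrite (_ : nrm2 _ = nrm2 (fun x => G x - g (r k) x))//.
    congr rint; apply/funext => x; rewrite -(opprB (G x)) -mulN1r cabs2M.
    by rewrite /cabs2 /= oppr0 expr0n sqrrN expr1n addr0 mul1r.
  move: c1 c2 k1 k2 p0; set y := 4^-1 ^+ k; set z := 2^-1 ^+ k => c1 c2 k1 k2 p0.
  have y0 : 0 < y by rewrite exprn_gt0 ?invr_gt0.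
  lra.
have nfG : nrm2 (fun x => f x - G x) = 0 by move: fG; rewrite ip_ff// => -[].
apply/eqP; rewrite eq_le Sle/= -[S]fineK// lee_fin.
apply/ler_addgt0Pl => x x0.
have [k [k1 _]] := small (x / 2) ltac:(by rewrite divr_gt0).
have [urk Hrk] := Hr k.
have := sS _ urk; rewrite -[S]fineK// lee_fin.
have : nrm2 (fun x => f x - g (r k) x) <= 2 * nrm2 (fun x => f x - G x) + 2 * nrm2 (fun x => G x - g (r k) x).
  rewrite (_ : (fun x => f x - g (r k) x) = fun x => (f x - G x) + (G x - g (r k) x)).
    by apply: nrm2D_le => //; exact: inL2B.
  by apply/funext => y; ring.
rewrite nfG nfg//; have := HG k; move: k1; lra.
Qed.

End Parseval.

(** * Translations and dilations *)

Section Operators.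
Context (R : realType).
Local Notation C := R[i].

Section Affine.
Context (d : nat).
Local Notation V := ('rV[R]_d).

Lemma inL2_affine (f : V -> C) (A : 'M[R]_d) (b : V) : A \in unitmx -> inL2 f ->
  inL2 (fun x => f (x *m A + b)).
Proof.
move=> uA [m1 m2 fin]; split.
- exact: (@Rdmeas_affine R d d (fun x => complex.Re (f x))).
- exact: (@Rdmeas_affine R d d (fun x => complex.Im (f x))).
have := change_var_unit uA (f := fun x => (cabs2 (f x))%:E) b.
move=> /(_ _ _)/= H; move: fin; rewrite -H; last 2 first.
- by apply/measurable_EFinP; exact: (Rdmeas_cabs2 m1 m2).
- by move=> x; rewrite lee_fin cabs2_ge0.
have d0 : 0 < `|\det A| by rewrite normr_gt0 -unitfE -unitmxE.
set I := Rdint _ => HI; rewrite ltey; apply/eqP => Iy; move: HI; rewrite Iy.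
by rewrite gt0_muley ?ltxx ?lte_fin.
Qed.

Lemma mact1 (x : V) : mact 1%:M x = x.
Proof. by rewrite /mact trmx1 mulmx1. Qed.

Lemma mactM (A B : 'M[R]_d) (x : V) : mact (A *m B) x = mact A (mact B x).
Proof. by rewrite /mact trmx_mul mulmxA. Qed.

Lemma mactD (A : 'M[R]_d) (x y : V) : mact A (x + y) = mact A x + mact A y.
Proof. by rewrite /mact mulmxDl. Qed.

Lemma mactN (A : 'M[R]_d) (x : V) : mact A (- x) = - mact A x.
Proof. by rewrite /mact mulNmx. Qed.

Lemma mactB (A : 'M[R]_d) (x y : V) : mact A (x - y) = mact A x - mact A y.
Proof. by rewrite mactD mactN. Qed.

Lemma TrE (u : V) (f : V -> C) : Tr u f = fun x => f (x *m 1%:M + - u).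
Proof. by apply/funext => x; rewrite mulmx1. Qed.

Lemma inL2_Tr (u : V) (f : V -> C) : inL2 f -> inL2 (Tr u f).
Proof. by move=> Lf; rewrite TrE; apply: inL2_affine => //; exact: unitmx1. Qed.

Lemma TrTr (u v : V) (f : V -> C) : Tr u (Tr v f) = Tr (u + v) f.
Proof. by apply/funext => x; rewrite /Tr opprD addrA. Qed.

Lemma Tr0 (f : V -> C) : Tr 0 f = f.
Proof. by apply/funext => x; rewrite /Tr subr0. Qed.

Lemma Rdint_shift (f : V -> \bar R) (u : V) : Rdemeas f -> (forall x, 0 <= f x)%E ->
  Rdint (fun x => f (x - u)) = Rdint f.
Proof.
move=> mf f0; have := change_var_unit (unitmx1 _ _) (- u) mf f0.
rewrite det1 normr1 mul1e => <-; congr Rdint.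
by apply/funext => x; rewrite mulmx1.
Qed.

Lemma Rdrint_shift (g : V -> R) (u : V) : Rdmeas g -> Rdrint (fun x => g (x - u)) = Rdrint g.
Proof.
move=> mg; rewrite /Rdrint; congr (fine _ - fine _).
- apply: (@Rdint_shift (fun x => (Num.max (g x) 0)%:E)).
    by apply/measurable_EFinP; apply: measurable_maxr.
  by move=> x; rewrite lee_fin le_max lexx orbT.
- apply: (@Rdint_shift (fun x => (Num.max (- g x) 0)%:E)).
    by apply/measurable_EFinP; apply: measurable_maxr => //; exact: measurableT_comp.
  by move=> x; rewrite lee_fin le_max lexx orbT.
Qed.

Lemma ip_Tr (u : V) (f g : V -> C) : inL2 f -> inL2 g ->
  ipL2 (Tr u f) (Tr u g) = ipL2 f g.
Proof.
move=> Lf Lg; have [i1 i2 i3 i4] := inL2_prods Lf Lg.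
rewrite /ipL2 /Rdcint; congr Complex; apply: Rdrint_shift.
- rewrite (_ : (fun x => _) = (fun x => complex.Re (f x) * complex.Re (g x) + complex.Im (f x) * complex.Im (g x))).
    have /integrableP[/measurable_EFinP m _] := RdintegrableD i1 i2; exact: m.
  by apply/funext => x; rewrite ReM Re_conj_complex Im_conj_complex mulrN opprK.
- rewrite (_ : (fun x => _) = (fun x => complex.Im (f x) * complex.Re (g x) + - (complex.Re (f x) * complex.Im (g x)))).
    have /integrableP[/measurable_EFinP m _] := RdintegrableD i4 (RdintegrableN i3); exact: m.
  by apply/funext => x; rewrite ImM Re_conj_complex Im_conj_complex mulrN addrC.
Qed.

Lemma nrm2_Tr (u : V) (f : V -> C) : inL2 f -> nrm2 (Tr u f) = nrm2 f.
Proof.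
move=> Lf; have := ip_Tr u Lf Lf.
by rewrite !ip_ff//; [case|exact: inL2_Tr].
Qed.

End Affine.

Section Dilation.
Context (d' : nat).
Local Notation d := d'.+1.
Local Notation V := ('rV[R]_d).
Context (M : 'M[int]_d).
Local Notation Mr := (intmx R M).
Hypothesis uM : Mr \is a GRing.unit.
Local Notation a := (Num.sqrt `|(\det M)%:~R : R|).

Lemma det_intmx (A : 'M[int]_d) : \det (intmx R A) = (\det A)%:~R.
Proof. by rewrite /intmx -(det_map_mx (intmul 1)). Qed.

Lemma opow_DilE (j : int) (f : V -> C) :
  opow (Dil M) (Dilinv M) j f = fun x => rc (a ^ j) * f (mact (Mr ^ j) x).
Proof.
case: j => n /=.
  elim: n => [|n IH]; apply/funext => x.
    by rewrite /= !expr0z mul1r mact1.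
  rewrite iterS IH /Dil -mactM mulrA -rcM.
  by rewrite -[_ ^ Posz n.+1]/(_ ^+ n.+1) -[Mr ^ Posz n.+1]/(_ ^+ n.+1) exprS exprSr.
have H m : iter m (Dilinv M) f = fun x => rc (a^-1 ^+ m) * f (mact (Mr^-1 ^+ m) x).
  elim: m => [|m IH]; apply/funext => x.
    by rewrite /= !expr0 mul1r mact1.
  by rewrite iterS IH /Dilinv -mactM mulrA -rcM exprS exprSr.
by rewrite -[Dilinv M _]/(iter n.+1 (Dilinv M) f) H; apply/funext => x; rewrite !exprVn.
Qed.

Lemma Mr_expz_unit (j : int) : Mr ^ j \in unitmx.
Proof. exact: unitrXz. Qed.

Lemma inL2_opow (j : int) (f : V -> C) : inL2 f -> inL2 (opow (Dil M) (Dilinv M) j f).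
Proof.
move=> Lf; rewrite opow_DilE; apply: inL2Z.
have uA : ((Mr ^ j)^T)%R \in unitmx by rewrite unitmx_tr Mr_expz_unit.
have := inL2_affine 0 uA Lf.
by congr inL2; apply/funext => x; rewrite addr0.
Qed.

Lemma Tr_opow (j : int) (u v : V) (f : V -> C) :
  Tr u (opow (Dil M) (Dilinv M) j (Tr v f)) =
  opow (Dil M) (Dilinv M) j (Tr (mact (Mr ^ j) u + v) f).
Proof.
by rewrite !opow_DilE; apply/funext => x; rewrite /Tr mactB opprD addrA.
Qed.

Context (p : nat) (s : {perm 'I_p}).

(* The power s^(-j), for a possibly negative j. *)
Definition permz (j : int) (q : 'I_p) : 'I_p :=
  match j with Posz n => (s ^- n)%g q | Negz n => (s ^+ n.+1)%g q end.

Lemma opow_bDilE (j : int) (F : 'I_p -> V -> C) q :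
  opow (bDil M s) (bDilinv M s) j F q = opow (Dil M) (Dilinv M) j (F (permz j q)).
Proof.
case: j => n /=.
  elim: n q => [|n IH] q; first by rewrite expg0 invg1 perm1.
  by rewrite !iterS /bDil IH expgSr invMg permM.
rewrite -[bDilinv M s _]/(iter n.+1 (bDilinv M s) F) -[Dilinv M _]/(iter n.+1 (Dilinv M) _).
elim: {n}n.+1 q => [|n IH] q; first by rewrite expg0 perm1.
by rewrite !iterS /bDilinv IH expgS permM.
Qed.

(** Undoes the permutation of components at a possibly negative scale j by a natural power of [s];
    natural exponents are the ones that can be traded for powers of the integer matrix M'. *)
Lemma permzK (J i : nat) (j : int) q : (s ^+ J = 1)%g -> i = J%:Z + j :> int ->
  (s ^+ i)%g (permz j q) = q.
Proof.
move=> sJ; case: j => n /=.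
  move=> /eqP; rewrite -PoszD eqz_nat => /eqP ->.
  by rewrite -permM addnC expgD mulgA mulVg mul1g sJ perm1.
rewrite NegzE => ij; have JE : J = (n.+1 + i)%N by clear -ij; lia.
by rewrite -permM -expgD -JE sJ perm1.
Qed.

End Dilation.
End Operators.

(** * Characters of Z^d / P Z^d *)

Section Characters.
Context (R : realType).
Local Notation C := R[i].

Lemma expiD (s t : R) : expi (s + t) = expi s * expi t.
Proof. by apply: complexE; rewrite ?ReM ?ImM /= ?cosD ?sinD; ring. Qed.

Lemma expi0 : expi (0 : R) = 1.
Proof. by rewrite /expi cos0 sin0. Qed.

Lemma expiN (t : R) : expi (- t) = (expi t)^*.
Proof. by rewrite /expi cosN sinN. Qed.

Lemma expiJ (t : R) : expi t * (expi t)^* = 1.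
Proof. by rewrite -expiN -expiD subrr expi0. Qed.

Lemma expi_int (z : int) : expi (2 * pi * z%:~R : R) = 1.
Proof.
have H (n : nat) : expi (2 * pi * n%:R : R) = 1.
  elim: n => [|n IH]; first by rewrite mulr0 expi0.
  rewrite -[n.+1%:R]natr1 mulrDr expiD IH mul1r mulr1.
  by rewrite /expi mulr_natl cos2pi sin2pi.
case: z => n; first exact: H.
by rewrite NegzE intrN mulrN expiN H rmorph1.
Qed.

(** After removing the integer part, cos(2 pi f) = 1 gives sin(pi f) = 0, and on [0, 1[ this happens
    only at f = 0. *)
Lemma expi_eq1 (t : R) : expi (2 * pi * t) = 1 -> exists z : int, t = z%:~R.
Proof.
move=> e1; exists (Num.floor t).
have /andP[f1 f2] := floor_itv t.
pose f := t - (Num.floor t)%:~R.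
have f0 : 0 <= f by rewrite subr_ge0.
have fl : f < 1 by move: f2; rewrite intrD /f; lra.
have : expi (2 * pi * f) = 1.
  by rewrite mulrBr expiD e1 mul1r expiN expi_int rmorph1.
move=> [c1 _].
have : sin (pi * f) = 0.
  move: c1; rewrite -mulrA mulr_natl cos_mulr2n => c1.
  apply/eqP; rewrite -sqrf_eq0 sin2cos2; apply/eqP.
  by move: c1; rewrite mulr2n; lra.
move=> s0; apply/eqP; rewrite -subr_eq0 -/f; apply/eqP.
case: (ltgtP 0 f) f0 => // fp _.
have : 0 < sin (pi * f).
  apply: sin_gt0_pi; rewrite mulr_gt0 ?pi_gt0//=.
  by rewrite gtr_pMr ?pi_gt0.
by rewrite s0 ltxx.
Qed.

(** Reindexing by the bijection [h] shows that the sum equals [c] times itself. Both orthogonality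
    relations for characters come from this. *)
Lemma sum_shift_eq0 (I : finType) (phi : I -> C) (h : I -> I) (c : C) :
  injective h -> (forall i, phi (h i) = c * phi i) -> c != 1 -> \sum_i phi i = 0.
Proof.
move=> ih hc c1; apply/eqP.
have : (1 - c) * (\sum_i phi i) = 0.
  rewrite mulrBl mul1r mulr_sumr {1}(reindex_inj ih)/=.
  by apply/eqP; rewrite subr_eq0; apply/eqP; apply: eq_bigr => i _.
by move=> /eqP; rewrite mulf_eq0 subr_eq0 eq_sym (negbTE c1).
Qed.

Lemma dotvE d (x y : 'rV[R]_d) : dotv x y = (x *m y^T) ord0 ord0.
Proof. by rewrite mxE; apply: eq_bigr => i _; rewrite mxE. Qed.

Lemma intrvD d (k l : 'rV[int]_d) : intrv R (k + l) = intrv R k + intrv R l.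
Proof. by apply/rowP => i; rewrite !mxE intrD. Qed.
Lemma intrvN d (k : 'rV[int]_d) : intrv R (- k) = - intrv R k.
Proof. by apply/rowP => i; rewrite !mxE intrN. Qed.
Lemma intrv0 d : intrv R (0 : 'rV[int]_d) = 0.
Proof. by apply/rowP => i; rewrite !mxE. Qed.
Lemma intrv_inj d : injective (@intrv R d).
Proof. by move=> k l /rowP H; apply/rowP => i; have := H i; rewrite !mxE => /intr_inj. Qed.
Lemma intmxM d (A B : 'M[int]_d) : intmx R (A *m B) = intmx R A *m intmx R B.
Proof. exact: (map_mxM (intmul 1)). Qed.
Lemma intrv_mul d (k : 'rV[int]_d) (A : 'M[int]_d) :
  intrv R (k *m A) = intrv R k *m intmx R A.
Proof. exact: (map_mxM (intmul 1)). Qed.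
Lemma intmx_tr d (A : 'M[int]_d) : intmx R A^T = (intmx R A)^T.
Proof. by rewrite /intmx map_trmx. Qed.

Definition iact d (A : 'M[int]_d) (k : 'rV[int]_d) : 'rV[int]_d := k *m A^T.

Lemma intrv_iact d (A : 'M[int]_d) k : intrv R (iact A k) = mact (intmx R A) (intrv R k).
Proof. by rewrite /iact intrv_mul intmx_tr. Qed.

Lemma iactD d (A : 'M[int]_d) k l : iact A (k + l) = iact A k + iact A l.
Proof. exact: mulmxDl. Qed.
Lemma iactN d (A : 'M[int]_d) k : iact A (- k) = - iact A k.
Proof. exact: mulNmx. Qed.
Lemma iactM d (A B : 'M[int]_d) k : iact (A *m B) k = iact A (iact B k).
Proof. by rewrite /iact trmx_mul mulmxA. Qed.

Definition congP d (P : 'M[int]_d) (k l : 'rV[int]_d) := exists m, k - l = iact P m.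

Section Cong.
Context (d : nat) (P : 'M[int]_d).
Local Notation cg := (congP P).

Lemma cg_refl k : cg k k.
Proof. by exists 0; rewrite subrr /iact mul0mx. Qed.
Lemma cg_sym k l : cg k l -> cg l k.
Proof. by move=> [m e]; exists (- m); rewrite iactN -e opprB. Qed.
Lemma cg_trans l k m : cg k l -> cg l m -> cg k m.
Proof.
move=> [a ea] [b eb]; exists (a + b); rewrite iactD -ea -eb.
by rewrite addrA subrK.
Qed.
Lemma cgD k l k' l' : cg k l -> cg k' l' -> cg (k + k') (l + l').
Proof. by move=> [a ea] [b eb]; exists (a + b); rewrite iactD -ea -eb opprD addrACA. Qed.

(* Even the zero class gets a nonzero representative: the decay of the coarse scales needs
   its translation vector to be nonzero. *)
Lemma residue_classes : (0 < d)%N -> \det P != 0 ->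
  exists n0 (K : 'I_n0 -> 'rV[int]_d), [/\ forall s, K s != 0,
    forall s s', cg (K s) (K s') -> s = s' & forall k, exists s, cg k (K s)].
Proof.
move=> d0 P0; pose p := `|\det P|%N.
have p0 : (0 < p)%N by rewrite absz_gt0.
(* Since P adj(P) = det P, the lattice P Z^d contains |det P| Z^d, so the vectors with entries in
   [0, p[ meet every class. Below, [f] selects one of them in each class. *)
pose B : finType := {ffun 'I_d -> 'I_p}.
pose v (b : B) : 'rV[int]_d := \row_i (b i)%:Z.
have cv k : exists b, cg k (v b).
  pose r i := `|(k ord0 i %% p%:Z)%Z|%N.
  have rE i : (r i)%:Z = (k ord0 i %% p%:Z)%Z.
    by rewrite /r gez0_abs// modz_ge0// eqz_nat -lt0n.
  have rp i : (r i < p)%N by rewrite -ltz_nat rE ltz_pmod// ltz_nat.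
  exists [ffun i => Ordinal (rp i)].
  pose z : 'rV[int]_d := \row_i (k ord0 i %/ p%:Z)%Z.
  exists (sgz (\det P) *: (z *m (\adj P)^T)).
  rewrite /iact -scalemxAl -mulmxA -trmx_mul mul_mx_adj tr_scalar_mx mul_mx_scalar scalerA.
  rewrite -abszEsg.
  by apply/rowP => i; rewrite !mxE ffunE /= rE {1}(divz_eq (k ord0 i) p%:Z) addrK mulrC.
pose f (b : B) : B := odflt b [pick b' | `[< cg (v b) (v b') >]].
have fc b : cg (v b) (v (f b)).
  rewrite /f; case: pickP => [b' /asboolP//|/(_ b)/asboolP []]; exact: cg_refl.
have ff b b' : cg (v b) (v b') -> f b = f b'.
  move=> bb'; rewrite /f (eq_pick (Q := fun b1 => `[< cg (v b') (v b1) >])).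
    case: pickP => [b1 //|/(_ b')/asboolP []]; exact: cg_refl.
  move=> b1; apply/asboolP/asboolP => H.
    exact: cg_trans (cg_sym bb') H.
  exact: cg_trans bb' H.
pose S := [set f b | b : B].
pose K0 (s : 'I_#|S|) := v (enum_val s).
pose e : 'rV[int]_d := iact P (delta_mx ord0 (Ordinal d0)).
have e0 : e != 0.
  apply: contra_neq P0 => e0; rewrite -det_tr; apply/eqP/det0P.
  exists (delta_mx ord0 (Ordinal d0)) => //.
  by apply/eqP => /rowP/(_ (Ordinal d0))/eqP; rewrite !mxE !eqxx.
pose K s := if K0 s == 0 then e else K0 s.
have KK0 s : cg (K s) (K0 s).
  rewrite /K; case: eqP => [->|_]; last exact: cg_refl.
  by exists (delta_mx ord0 (Ordinal d0)); rewrite subr0.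
exists #|S|, K; split.
- by move=> s; rewrite /K; case: ifPn.
- move=> s s' ss'; apply: enum_val_inj.
  have : cg (K0 s) (K0 s').
    exact: cg_trans (cg_sym (KK0 s)) (cg_trans ss' (KK0 s')).
  rewrite /K0; case/imsetP: (enum_valP s) => b _ ->; case/imsetP: (enum_valP s') => b' _ -> bb'.
  by apply: ff; exact: cg_trans (fc b) (cg_trans bb' (cg_sym (fc b'))).
- move=> k; have [b kb] := cv k.
  have fbS : f b \in S by apply/imsetP; exists b.
  exists (enum_rank_in fbS (f b)).
  apply: cg_trans kb (cg_trans (fc b) (cg_sym _)).
  by apply: cg_trans (KK0 _) _; rewrite /K0 enum_rankK_in//; exact: cg_refl.
Qed.

End Cong.

(** * Orthogonality relations and the action of M' on classes *)

Section Orthogonality.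
Context (d' : nat).
Local Notation d := d'.+1.
Context (P M' : 'M[int]_d) (p : nat) (th : 'I_p -> 'rV[R]_d) (sigma : {perm 'I_p}).
Local Notation Pr := (intmx R P).
Hypothesis uP : Pr \in unitmx.
Hypothesis rth : reps Pr^T th.
Hypothesis hs : forall q, in_Zd (mact (intmx R M')^T (th q) - th (sigma q)).
Local Notation cg := (congP P).

Definition chi (k : 'rV[int]_d) (q : 'I_p) : C := expi (2 * pi * dotv (intrv R k) (th q)).

Lemma dotvDr (x y z : 'rV[R]_d) : dotv x (y + z) = dotv x y + dotv x z.
Proof. by rewrite !dotvE linearD/= mulmxDr mxE. Qed.
Lemma dotvDl (x y z : 'rV[R]_d) : dotv (x + y) z = dotv x z + dotv y z.
Proof. by rewrite !dotvE mulmxDl mxE. Qed.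
Lemma dotv_mact (A : 'M[R]_d) (x y : 'rV[R]_d) : dotv (mact A x) y = dotv x (mact A^T y).
Proof. by rewrite !dotvE /mact trmxK trmx_mul mulmxA. Qed.

Lemma dotv_int (k l : 'rV[int]_d) : exists z : int, dotv (intrv R k) (intrv R l) = z%:~R.
Proof.
exists (\sum_i k ord0 i * l ord0 i); rewrite /dotv rmorph_sum /=.
by apply: eq_bigr => i _; rewrite !mxE intrM.
Qed.

Lemma expi_dotv_int (k : 'rV[int]_d) (x : 'rV[R]_d) : in_Zd x ->
  expi (2 * pi * dotv (intrv R k) x) = 1.
Proof. by move=> [l ->]; have [z ->] := dotv_int k l; exact: expi_int. Qed.

Lemma expi_dotv_cong (k : 'rV[int]_d) (x y : 'rV[R]_d) : in_Zd (x - y) ->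
  expi (2 * pi * dotv (intrv R k) x) = expi (2 * pi * dotv (intrv R k) y).
Proof.
move=> xy; rewrite -[x](subrK y) dotvDr mulrDr expiD.
by rewrite expi_dotv_int// mul1r.
Qed.

Lemma chiD k l q : chi (k + l) q = chi k q * chi l q.
Proof. by rewrite /chi intrvD dotvDl mulrDr expiD. Qed.

Lemma chi0 q : chi 0 q = 1.
Proof. by rewrite /chi intrv0 dotvE mul0mx mxE mulr0 expi0. Qed.

Lemma chi_th q : exists l, th q = intrv R l *m invmx Pr.
Proof.
have [H _ _ _] := rth; have [l ->] := H q; exists l.
by rewrite /mact trmx_inv trmxK.
Qed.

Lemma chi_P m q : chi (iact P m) q = 1.
Proof.
rewrite /chi intrv_iact dotv_mact; apply: expi_dotv_int.
have [l ->] := chi_th q; exists l.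
by rewrite /mact trmxK mulmxKV.
Qed.

Lemma chi_cong k l q : cg k l -> chi k q = chi l q.
Proof. by move=> [m e]; rewrite -[k](subrK l) e chiD chi_P mul1r. Qed.

(** The points theta_q represent in particular the images of the unit vectors under the inverse
    transpose of P. Pairing k with such an image yields a coordinate of P^(-1) k, which is thus an
    integer. *)
Lemma chi_sep k : (forall q, chi k q = 1) -> cg k 0.
Proof.
move=> k1; have [_ _ H _] := rth.
suff H1 i : exists z : int, mact (invmx Pr) (intrv R k) ord0 i = z%:~R.
  have [z Hz] := boolp.choice H1.
  exists (\row_i z i); apply: (@intrv_inj d); rewrite subr0 intrv_iact.
  rewrite (_ : intrv R (\row_i z i) = mact (invmx Pr) (intrv R k)).
    by rewrite -mactM mulmxV// mact1.
  by apply/rowP => i; rewrite !mxE -Hz mxE.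
apply: expi_eq1; have [q Hq] := H (delta_mx ord0 i).
rewrite (_ : mact _ _ _ _ = dotv (intrv R k) (mact (invmx Pr^T) (intrv R (delta_mx ord0 i)))).
  by rewrite (expi_dotv_cong _ Hq); exact: k1.
rewrite -[invmx Pr^T]trmxK -dotv_mact trmx_inv trmxK.
rewrite /dotv (bigD1 i)//= big1 ?addr0 => [|j ji]; last by rewrite !mxE (negbTE ji) andbF mulr0.
have -> : intrv R (delta_mx ord0 i) ord0 i = 1 by rewrite !mxE !eqxx.
by rewrite mulr1.
Qed.

(** Duality: the permutation of the theta_q by the transpose of M' is traded for multiplication of k
    by M'. *)
Lemma chi_sigma k q : chi k (sigma q) = chi (iact M' k) q.
Proof.
by rewrite /chi intrv_iact dotv_mact (expi_dotv_cong _ (hs q)).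
Qed.

Lemma chi_sigmaX k q n : chi k ((sigma ^+ n)%g q) = chi (iact (M' ^+ n) k) q.
Proof.
elim: n k q => [|n IH] k q.
  by rewrite expg0 perm1 expr0 /iact trmx1 mulmx1.
by rewrite expgS permM IH chi_sigma -iactM exprS.
Qed.

Lemma sum_chi k : \sum_q chi k q = (if `[< cg k 0 >] then p%:R else 0).
Proof.
case: asboolP => kP.
  under eq_bigr do rewrite (chi_cong _ kP) chi0.
  by rewrite sumr_const card_ord.
have [q0 q01] : exists q0, chi k q0 != 1.
  apply: contrapT => /forallNP H; apply: kP; apply: chi_sep => q.
  by have := H q; case: eqP => // _ [].
have [_ ri re _] := rth.
(* Translation by theta_q0 permutes the representatives modulo Z^d and multiplies the summand by chi
   k q0, which differs from 1. *)
have /boolp.choice[h Hh] : forall q, exists q', in_Zd (th q + th q0 - th q').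
  move=> q; have [l ->] := chi_th q; have [l0 ->] := chi_th q0.
  have [q' Hq'] := re (l + l0); exists q'.
  by move: Hq'; rewrite /mact trmx_inv trmxK intrvD mulmxDl.
apply: (@sum_shift_eq0 _ _ h (chi k q0)) => //.
  move=> q q' hqq; apply: ri.
  have [a ea] := Hh q; have [b eb] := Hh q'; exists (a - b).
  by rewrite intrvD intrvN -ea -eb hqq; apply/rowP => i; rewrite !mxE; ring.
move=> q; rewrite /chi -(expi_dotv_cong _ (Hh q)) dotvDr mulrDr expiD mulrC //.
Qed.

Context (n0 : nat) (K : 'I_n0 -> 'rV[int]_d).
Hypothesis Kinj : forall s s', cg (K s) (K s') -> s = s'.
Hypothesis Ksurj : forall k, exists s, cg k (K s).

(** The dual relation, summing over classes. If the character of theta_q - theta_q' were trivial,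
    testing it on unit vectors would make this difference integral, forcing q = q'; otherwise some
    shift k0 of the classes kills the sum. *)
Lemma sum_chiJ q q' : \sum_s chi (K s) q * (chi (K s) q')^* = (if q == q' then n0%:R else 0).
Proof.
case: eqP => [->|qq'].
  under eq_bigr do rewrite expiJ.
  by rewrite sumr_const card_ord.
pose phi k := chi k q * (chi k q')^*.
have phiD k l : phi (k + l) = phi k * phi l by rewrite /phi !chiD rmorphM/=; ring.
have phiE k : phi k = expi (2 * pi * dotv (intrv R k) (th q - th q')).
  rewrite /phi /chi -expiN -expiD; congr expi.
  have dN (x y : 'rV[R]_d) : dotv x (- y) = - dotv x y.
    by rewrite !dotvE linearN/= mulmxN mxE.
  by rewrite dotvDr dN; ring.
have [k0 k01] : exists k0, phi k0 != 1.
  apply: contrapT => /forallNP H; apply: qq'; have [_ ri _ _] := rth; apply: ri.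
  have H1 i : exists z : int, (th q - th q') ord0 i = z%:~R.
    apply: expi_eq1; have := H (delta_mx ord0 i); rewrite phiE.
    rewrite /dotv (bigD1 i)//= big1 ?addr0 => [|j ji]; last by rewrite !mxE (negbTE ji) andbF mul0r.
    have -> : intrv R (delta_mx ord0 i) ord0 i = 1 by rewrite !mxE !eqxx.
    by rewrite mul1r; case: eqP => // _ [].
  have [z Hz] := boolp.choice H1; exists (\row_i z i).
  by apply/rowP => i; rewrite Hz !mxE.
have /boolp.choice[h Hh] := fun s => Ksurj (K s + k0).
apply: (@sum_shift_eq0 _ (fun s => phi (K s)) h (phi k0)) => //.
  move=> s s' hss; apply: Kinj; have := Hh s; rewrite hss => H.
  have := cgD (cg_trans H (cg_sym (Hh s'))) (cg_refl P (- k0)).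
  by rewrite !addrK.
move=> s; rewrite mulrC -phiD /phi.
by rewrite !(chi_cong _ (Hh s)).
Qed.

(** Double counting of the sum of all chi (K s) q. Summed over q first, only the class of 0
    contributes, and gives p; summed over s first, only the index with theta = 0 contributes, and
    gives n0. *)
Lemma card_classes : (0 < p)%N -> n0 = p.
Proof.
move=> p0; have [_ _ _ r0] := rth.
have th0 : th (Ordinal p0) = 0 by exact: r0.
have : \sum_s \sum_q chi (K s) q = \sum_q \sum_s chi (K s) q by exact: exchange_big.
have [s0 Hs0] := Ksurj 0.
under eq_bigr do rewrite sum_chi.
rewrite (bigD1 s0)//= big1 => [|s ss0]; last first.
  case: asboolP => // H; move: ss0; rewrite (Kinj (cg_trans H Hs0)) eqxx //.
case: asboolP => [_|[]]; last exact: cg_sym.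
have c1 k : chi k (Ordinal p0) = 1.
  by rewrite /chi th0 dotvE trmx0 mulmx0 mxE mulr0 expi0.
have E q : \sum_s chi (K s) q = if q == Ordinal p0 then n0%:R else 0.
  by rewrite -sum_chiJ; apply: eq_bigr => s _; rewrite c1 rmorph1 mulr1.
rewrite (eq_bigr _ (fun q _ => E q)) -big_mkcond/= big_pred1_eq addr0.
by move=> /eqP; rewrite eqr_nat => /eqP.
Qed.

End Orthogonality.
End Characters.

(** * Powers of an expanding matrix *)

Section Expansive.
Context (R : realType).
Local Notation C := R[i].

Definition cnorm (z : C) : R := complex.Re `|z|.

Lemma cnormE (z : C) : `|z| = rc (cnorm z).
Proof. exact: complexE. Qed.

Lemma cnormM (z w : C) : cnorm (z * w) = cnorm z * cnorm w.
Proof. by rewrite /cnorm normrM !cnormE ReM /= mulr0 subr0. Qed.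

Lemma cnorm_ge0 (z : C) : 0 <= cnorm z.
Proof. by have := normr_ge0 z; rewrite cnormE lecE /= => /andP[]. Qed.

Lemma cnormB (z w : C) : cnorm (z - w) <= cnorm z + cnorm w.
Proof.
have := ler_normB z w; rewrite !cnormE -rcD lecE /= => /andP[_].
by [].
Qed.

Lemma cnorm_rc (x : R) : cnorm (rc x) = `|x|.
Proof. by rewrite /cnorm (_ : rc x = x%:C%C)// normc_def /= expr0n addr0 sqrtr_sqr. Qed.

Lemma contraction_cvg0 (x y : nat -> R) (rho : R) : 0 <= rho -> rho < 1 ->
  (forall n, 0 <= x n) -> (forall n, x n.+1 <= rho * (x n + y n)) ->
  (forall e : R, 0 < e -> exists n0, forall n, (n0 <= n)%N -> y n <= e) ->
  forall e : R, 0 < e -> exists n0, forall n, (n0 <= n)%N -> x n <= e.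
Proof.
move=> r0 r1 x0 xS yc e e0.
have e2 : 0 < e / 2 by rewrite divr_gt0.
have r1' : 0 < 1 - rho by rewrite subr_gt0.
(* With y <= (e/2)(1 - rho) the level e/2 is not exceeded again: rho (e/2 + (e/2)(1 - rho)) =
   (e/2)(1 - (1 - rho)^2). *)
have [n1 Hn1] := yc (e / 2 * (1 - rho)) (mulr_gt0 e2 r1').
have H k : x (n1 + k)%N <= rho ^+ k * x n1 + e / 2.
  elim: k => [|k IH]; first by rewrite addn0 expr0 mul1r lerDl ltW// divr_gt0.
  rewrite addnS; apply: (le_trans (xS _)).
  have yk := Hn1 _ (leq_addr k n1).
  apply: (@le_trans _ _ (rho * (rho ^+ k * x n1 + e / 2 + e / 2 * (1 - rho)))).
    by apply: ler_wpM2l => //; exact: lerD.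
  rewrite exprS; set z := rho ^+ k * x n1.
  rewrite -[rho * rho ^+ k * _]mulrA -/z.
  have : 0 <= e / 2 * (1 - rho) ^+ 2 by rewrite mulr_ge0 ?sqr_ge0// ltW// divr_gt0.
  lra.
have : (x n1) * rho ^+ n @[n --> \oo] --> (x n1) * 0.
  by apply: cvgMr; apply: cvg_expr; rewrite ger0_norm.
rewrite mulr0 => /cvgr_lt /(_ (e / 2) e2)[N _ HN].
exists (n1 + N)%N => n nN.
have -> : n = (n1 + (n - n1))%N by rewrite subnKC// (leq_trans _ nN)// leq_addr.
apply: (le_trans (H _)).
have : (N <= n - n1)%N by rewrite leq_subRL ?(leq_trans _ nN)// leq_addr.
by move=> /HN /=; rewrite mulrC; lra.
Qed.

Context (d' : nat).
Local Notation d := d'.+1.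
Context (M : 'M[int]_d).
Local Notation Mr := (intmx R M).
Let Mc : 'M[C]_d := map_mx (fun z : int => z%:~R) M.
Hypothesis exM : forall lam : C, eigenvalue Mc lam -> 1 < `|lam|.

Let McE : Mc = map_mx (real_complex R) Mr.
Proof. by apply/matrixP => i j; rewrite !mxE rmorph_int. Qed.

Lemma expansive_unit : Mr \is a GRing.unit.
Proof.
rewrite -[_ \is a _]/(Mr \in unitmx) unitmxE unitfE; apply/eqP => d0.
have : eigenvalue Mc 0.
  have /eqP/det0P[v v0 vM] : \det Mc = 0 by rewrite McE det_map_mx d0 rmorph0.
  by apply/eigenvalueP; exists v => //; rewrite vM scale0r.
by move/exM; rewrite normr0 ltr10.
Qed.

Let uMc : Mc \is a GRing.unit.
Proof.
rewrite -[_ \is a _]/(Mc \in unitmx) McE map_unitmx; exact: expansive_unit.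
Qed.

(* If (M - l) X = Y then M^-(n+1) X = l^-1 (M^-n X - M^-(n+1) Y), a contraction as |l| > 1. *)
Lemma horner_roots_cvg0 (rs : seq C) (X : 'M[C]_d) :
  (forall l, l \in rs -> 1 < `|l|) ->
  horner_mx Mc (\prod_(l <- rs) ('X - l%:P)) * X = 0 ->
  forall i j (e : R), 0 < e -> exists n0, forall n, (n0 <= n)%N -> cnorm ((Mc^-1 ^+ n * X) i j) <= e.
Proof.
elim: rs X => [|l rs IH] X Hrs HX i j e e0.
  rewrite big_nil rmorph1 mul1r in HX; exists 0%N => n _.
  by rewrite HX mulr0 mxE /cnorm normr0 /= ltW.
pose Y := (Mc - l%:M) * X.
have HY : horner_mx Mc (\prod_(l <- rs) ('X - l%:P)) * Y = 0.
  rewrite -HX big_cons mulrC rmorphM /= -mulrA; congr (_ * (_ * _)).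
  by rewrite rmorphB /= horner_mx_X horner_mx_C.
have l1 : 1 < `|l| by apply: Hrs; rewrite mem_head.
have l0 : l != 0 by apply: contraTneq l1 => ->; rewrite normr0 ltr10.
have rec n : (Mc^-1 ^+ n.+1 * X) i j =
    l^-1 * ((Mc^-1 ^+ n * X) i j - (Mc^-1 ^+ n.+1 * Y) i j).
  have -> : Mc^-1 ^+ n.+1 * Y = Mc^-1 ^+ n * X - l *: (Mc^-1 ^+ n.+1 * X).
    rewrite /Y mulrBl mulrBr exprSr -!mulrA mulKr//; congr (_ - _).
    by rewrite -[l%:M * X]/(l%:M *m X) mul_scalar_mx -!scalerAr.
  have E (U W : 'M[C]_d) : (U - l *: W) i j = U i j - l * W i j by rewrite !mxE.
  by rewrite E opprB addrC subrK mulKf.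
apply: (@contraction_cvg0 _ (fun n => cnorm ((Mc^-1 ^+ n.+1 * Y) i j)) (cnorm l^-1)) => //.
- exact: cnorm_ge0.
- have : cnorm l * cnorm l^-1 = 1 by rewrite -cnormM divff// /cnorm normr1.
  have : 1 < cnorm l by move: l1; rewrite cnormE ltcE /= => /andP[_].
  have := cnorm_ge0 l^-1; nra.
- by move=> n; exact: cnorm_ge0.
- move=> n; rewrite rec cnormM ler_wpM2l ?cnorm_ge0//; exact: cnormB.
- move=> e1 e10; have [n0 Hn0] := IH Y (fun l' H => Hrs l' (mem_behead (s := l :: rs) H)) HY i j e1 e10.
  by exists n0 => n nn; apply: Hn0; rewrite leqW.
Qed.

(** By Cayley-Hamilton the product of the factors M - l over all roots l of the characteristic
    polynomial annihilates X = 1, so [horner_roots_cvg0] applies to the identity matrix. *)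
Lemma expansive_cvg0 (e : R) : 0 < e ->
  exists n0, forall n, (n0 <= n)%N -> forall i j, `|(Mr^-1 ^+ n) i j| <= e.
Proof.
move=> e0.
have [rs Hrs] := closed_field_poly_normal (char_poly Mc).
rewrite (monicP (char_poly_monic _)) scale1r in Hrs.
have Hl l : l \in rs -> 1 < `|l|.
  move=> lr; apply: exM; rewrite eigenvalue_root_char Hrs.
  by rewrite root_prod_XsubC.
have H0 : horner_mx Mc (\prod_(l <- rs) ('X - l%:P)) * 1 = 0.
  by rewrite mulr1 -Hrs; exact: Cayley_Hamilton.
have /boolp.choice[n0 Hn0] : forall ij : 'I_d * 'I_d, exists n0, forall n, (n0 <= n)%N ->
    `|(Mr^-1 ^+ n) ij.1 ij.2| <= e.
  move=> [i j]; have [n0 Hn0] := horner_roots_cvg0 Hl H0 i j e0.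
  exists n0 => n /Hn0 /=; rewrite mulr1.
  have -> : Mc^-1 ^+ n = map_mx (real_complex R) (Mr^-1 ^+ n).
    rewrite McE -[(map_mx _ Mr)^-1]/(invmx _) -map_invmx.
    by rewrite -(rmorphXn (map_mx (real_complex R))).
  by rewrite mxE cnorm_rc.
exists (\max_ij n0 ij) => n nn i j.
by apply: (Hn0 (i, j)); apply: leq_trans nn; exact: leq_bigmax.
Qed.

End Expansive.

(** * Decay of the coarse scales *)

Section Boxes.
Context (R : realType) (d : nat).
Local Notation C := R[i].
Local Notation V := ('rV[R]_d).
Local Notation mu := (lebesgueRd R d).

Definition inbox (r : R) (x : V) := [forall i, `|x ord0 i| <= r].
Definition box_indic (r : R) (x : V) : R := (inbox r x)%:R.

Lemma inbox_le (r s : R) x : r <= s -> inbox r x -> inbox s x.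
Proof. by move=> rs /forallP H; apply/forallP => i; exact: le_trans (H i) rs. Qed.

Lemma box_indic_ge0 r x : 0 <= box_indic r x. Proof. exact: ler0n. Qed.
Lemma box_indic_le1 r x : box_indic r x <= 1. Proof. by rewrite /box_indic; case: inbox. Qed.

Lemma Rdmeas_box_indic r : Rdmeas (box_indic r).
Proof.
rewrite /Rdmeas (_ : _ \o _ = fun t : d.-tuple R => \prod_i \1_(`[- r, r]%classic) (tnth t i)).
  apply: measurable_prod => i _.
  have mi : measurable_fun setT (\1_(`[- r, r]%classic) : R -> R) by exact: measurable_indic.
  exact: (measurableT_comp mi (measurable_tnth i)).
apply/funext => t /=; rewrite /box_indic /inbox.
have E i : \1_(`[- r, r]%classic) (tnth t i) = (`|tup2rv t ord0 i| <= r)%R%:R :> R.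
  by rewrite indicE mem_setE in_itv /= mxE ler_norml.
under eq_bigr do rewrite E.
case: forallP => [H|/forallP/forallPn[i Hi]]; first by rewrite big1// => i _; rewrite H.
by rewrite (bigD1 i)//= (negbTE Hi) mul0r.
Qed.

Lemma inbox_mact (A : 'M[R]_d) (c r : R) (x : V) : (forall i j, `|A i j| <= c) -> 0 <= c ->
  inbox r x -> inbox (d%:R * c * r) (mact A x).
Proof.
move=> Ac c0 /forallP xr; apply/forallP => i; rewrite mxE.
apply: (le_trans (ler_norm_sum _ _ _)).
apply: (@le_trans _ _ (\sum_(j < d) c * r)); last first.
  by rewrite sumr_const card_ord -mulrA mulr_natl.
apply: ler_sum => j _; rewrite normrM mulrC mxE.
by apply: ler_pM.
Qed.

Lemma inbox_max (x : V) : exists r, 0 <= r /\ inbox r x.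
Proof.
exists (\sum_i `|x ord0 i|); split; first by rewrite sumr_ge0.
by apply/forallP => i; rewrite (bigD1 i)//= lerDl sumr_ge0.
Qed.

(** Dominated convergence in the form used twice: for the mass of f outside growing boxes, and for
    the mass of the generators on the points whose orbit comes close to -w. *)
Lemma integral_vanishing_sets (h : V -> R) (A : nat -> set (d.-tuple R)) : Rdintegrable h ->
  (forall x, 0 <= h x) -> (forall k, measurable (A k)) ->
  {ae mu, forall t, exists k0, forall k, (k0 <= k)%N -> ~ A k t} ->
  forall e : R, 0 < e -> exists k0, forall k, (k0 <= k)%N ->
    (\int[mu]_t (\1_(A k) t * h (tup2rv t))%:E <= e%:E)%E.
Proof.
move=> ih h0 mA aeA e e0.
have /integrableP[mh _] := ih.
have [] := @dominated_convergence _ _ _ mu setT measurableT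
  (fun k t => (\1_(A k) t * h (tup2rv t))%:E) (cst 0%E) (fun t => (h (tup2rv t))%:E).
- move=> k; apply/measurable_EFinP; apply: measurable_funM; first exact: measurable_indic.
  exact/measurable_EFinP.
- exact: measurable_cst.
- apply: filterS aeA => t [k0 Hk0] _; apply: cvg_near_cst.
  by exists k0 => // k /= /Hk0 Ak; rewrite indicE memNset// mul0r.
- exact: ih.
- apply: aeW => t k _ /=; rewrite lee_fin normrM ger0_norm ?indicE// (ger0_norm (h0 _)).
  by rewrite ler_piMl//; case: (_ \in _).
move=> _ _; rewrite integral0 => /fine_cvgP[_ /cvgrPdist_lt/(_ e e0)] => H.
have H1 k : (0 <= \int[mu]_t (\1_(A k) t * h (tup2rv t))%:E)%E.
  by apply: integral_ge0 => t _; rewrite lee_fin mulr_ge0// indicE.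
have H2 k : (\int[mu]_t (\1_(A k) t * h (tup2rv t))%:E < +oo)%E.
  have [_ + ] := integrableP _ _ _ ih; apply: le_lt_trans.
  apply: ge0_le_integral => //.
  - by move=> t _; rewrite lee_fin mulr_ge0// indicE.
  - apply/measurable_EFinP; apply: measurable_funM; first exact: measurable_indic.
    exact/measurable_EFinP.
  - exact: measurableT_comp.
  - move=> t _; rewrite lee_fin ger0_norm// ler_piMl// indicE; by case: (_ \in _).
case: H => k0 _ Hk0; exists k0 => k /Hk0 /=.
rewrite sub0r normrN ger0_norm ?fine_ge0// => /ltW.
by rewrite -lee_fin fineK// ge0_fin_numE.
Qed.

Lemma inL2_bounded (b : V -> R) (f : V -> C) : Rdmeas b -> (forall x, `|b x| <= 1) ->
  inL2 f -> inL2 (fun x => rc (b x) * f x).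
Proof.
move=> mb b1 /inL2P[m1 m2 i].
have n1 : Rdmeas (fun x => complex.Re (rc (b x) * f x)).
  rewrite (_ : (fun x => _) = (fun x => b x * complex.Re (f x))).
    exact: measurable_funM.
  by apply/funext => x; rewrite ReM /= mul0r subr0.
have n2 : Rdmeas (fun x => complex.Im (rc (b x) * f x)).
  rewrite (_ : (fun x => _) = (fun x => b x * complex.Im (f x))).
    exact: measurable_funM.
  by apply/funext => x; rewrite ImM /= mul0r addr0.
apply/inL2P; split => //; apply: (Rdintegrable_le _ i); first exact: Rdmeas_cabs2.
move=> x; rewrite ger0_norm ?cabs2_ge0// cabs2M cabs2_rc ler_piMl ?cabs2_ge0//.
by rewrite -real_normK ?num_real// expr_le1.
Qed.

Lemma nrm2_outside_box (f : V -> C) (e : R) : inL2 f -> 0 < e -> exists2 r : R, 0 < r &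
  nrm2 (fun x => rc (1 - box_indic r x) * f x) <= e.
Proof.
move=> Lf e0; have /inL2P[m1 m2 i] := Lf.
pose A (k : nat) := [set t : d.-tuple R | ~~ inbox k%:R (tup2rv t)].
have mA k : measurable (A k).
  have := @Rdmeas_box_indic k%:R measurableT [set 0] (measurable_set1 _).
  rewrite setTI (_ : _ @^-1` _ = A k)//; apply/seteqP; split => t /=; rewrite /box_indic /A/=.
    by case: inbox => // /eqP; rewrite oner_eq0.
  by case: inbox.
have aeA : {ae mu, forall t, exists k0, forall k, (k0 <= k)%N -> ~ A k t}.
  apply: aeW => t; have [r [r0 Hr]] := inbox_max (tup2rv t).
  exists (Num.trunc r).+1 => k rk; apply/negP; rewrite negbK; apply: inbox_le Hr.
  have : r < (Num.trunc r).+1%:R by rewrite -truncn_lt_nat.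
  by move=> /ltW /le_trans; apply; rewrite ler_nat.
have [k0 Hk] := integral_vanishing_sets i (fun=> cabs2_ge0 _) mA aeA e0.
(* The index k0 + 1, rather than k0, makes the radius positive. *)
have Hk0 := Hk _ (leqnSn k0).
exists k0.+1%:R => //.
have L1 : inL2 (fun x => rc (1 - box_indic k0.+1%:R x) * f x).
  have mb : Rdmeas (fun x => 1 - box_indic k0.+1%:R x) by apply: measurable_funB => //; exact: Rdmeas_box_indic.
  apply: inL2_bounded => // x.
  by rewrite ger0_norm ?subr_ge0 ?box_indic_le1// gerBl box_indic_ge0.
rewrite -lee_fin; apply: le_trans Hk0; rewrite -nrm2E//.
rewrite le_eqVlt; apply/orP; left; apply/eqP; apply: eq_integral => t _.
rewrite cabs2M cabs2_rc /box_indic indicE; congr ((_ * _)%:E).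
case: (boolP (inbox _ _)) => H.
  by rewrite subrr expr0n memNset// /A/= H.
by rewrite subr0 expr1n mem_set.
Qed.

End Boxes.

(** * Bound for one coefficient at a coarse scale *)

Section CoefficientBound.
Context (R : realType) (d' : nat).
Local Notation d := d'.+1.
Local Notation C := R[i].
Local Notation V := ('rV[R]_d).
Local Notation mu := (lebesgueRd R d).
Context (M : 'M[int]_d) (n : nat) (Psi : 'I_n -> V -> C).
Local Notation Mr := (intmx R M).
Local Notation a := (Num.sqrt `|(\det M)%:~R : R|).
Hypothesis uM : Mr \is a GRing.unit.
Hypothesis LPsi : forall i, inL2 (Psi i).

Lemma inL2_affine_sys jki : inL2 (affine_sys M Psi jki).
Proof. by case: jki => [[j k] i]; apply: inL2_opow => //; exact: inL2_Tr. Qed.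

Lemma det_exprn (A : 'M[R]_d) k : \det (A ^+ k) = (\det A) ^+ k.
Proof.
elim: k => [|k IH]; first by rewrite !expr0 det1.
by rewrite !exprS -IH -det_mulmx.
Qed.

Lemma dil_const2 (k : nat) : (a ^ (- k%:Z)) ^+ 2 = `|\det (Mr ^ (- k%:Z))^T|.
Proof.
rewrite det_tr -!exprnN -[(Mr ^+ k)^-1]/(invmx (Mr ^+ k)) det_inv det_exprn det_intmx.
rewrite normrV ?unitfE; last first.
  by rewrite expf_neq0// -det_intmx -unitfE -unitmxE.
by rewrite exprVn normrX -exprM mulnC exprM sqr_sqrtr.
Qed.

Lemma mactK (k : nat) (x : V) : mact (Mr ^+ k) (mact (Mr ^ (- k%:Z)) x) = x.
Proof.
rewrite -exprnN -mactM -[_ *m _]/(Mr ^+ k * Mr ^- k) divrr ?mact1//.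
exact: unitrX.
Qed.

Lemma mactVK (k : nat) (x : V) : mact (Mr^-1 ^+ k) (mact (Mr ^+ k) x) = x.
Proof.
rewrite exprVn -mactM -[_ *m _]/(Mr ^- k * Mr ^+ k) mulVr ?mact1//.
exact: unitrX.
Qed.

(** The function T_(-u) f lives where x + u is in the box of radius r, so Cauchy-Schwarz may be
    applied with the affine vector cut off there. Substituting x = M^N (y + m), N = J + l, turns the
    square norm of the cut-off vector into an integral of |psi(y)|^2 over M^N (y + m) + u in the
    box; applying M^-J to this condition gives M^l (y + m) + w in the box of radius e. *)
Lemma coarse_coef_bound (f : V -> C) (w : V) (r e : R) (J l : nat) m i :
  inL2 f -> (forall x, ~~ inbox r x -> f x = 0) ->
  (forall x, inbox r x -> inbox e (mact (Mr^-1 ^+ J) x)) ->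
  ((cabs2 (ipL2 (Tr (- mact (Mr ^+ J) w) f) (affine_sys M Psi (- (J + l)%N%:Z, m, i))))%:E <=
   (nrm2 f)%:E * \int[mu]_t (box_indic e (mact (Mr ^+ l) (tup2rv t + intrv R m) + w)%R *
                             cabs2 (Psi i (tup2rv t)))%:E)%E.
Proof.
move=> Lf f0 re; set u := mact (Mr ^+ J) w; set h := Tr (- u) f.
pose N := (J + l)%N; rewrite -/N; set g := affine_sys _ _ _.
have Lg : inL2 g by exact: inL2_affine_sys.
have Lh : inL2 h by exact: inL2_Tr.
pose g1 x := rc (box_indic r (x + u)) * g x.
have mb : Rdmeas (fun x => box_indic r (x + u)).
  have := Rdmeas_affine 1%:M u (@Rdmeas_box_indic R d r).
  by congr Rdmeas; apply/funext => x; rewrite mulmx1.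
have Lg1 : inL2 g1.
  by apply: inL2_bounded => // x; rewrite ger0_norm ?box_indic_ge0// box_indic_le1.
have -> : ipL2 h g = ipL2 h g1.
  rewrite /ipL2; congr Rdcint; apply/funext => x; rewrite /g1 /h /Tr opprK /box_indic.
  case: (boolP (inbox _ _)) => H; first by rewrite mul1r.
  by rewrite f0// !mul0r.
have := cauchy_schwarz Lh Lg1; rewrite nrm2_Tr// -lee_fin EFinM => /le_trans; apply.
apply: lee_wpmul2l; first by rewrite lee_fin nrm2_ge0.
pose A := (Mr ^ (- N%:Z))^T.
have uA : A \in unitmx by rewrite unitmx_tr; exact: Mr_expz_unit.
pose F y := (box_indic r (mact (Mr ^+ N) (y + intrv R m) + u) * cabs2 (Psi i y))%:E.
have [m1 m2 _] := LPsi i.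
have mF : Rdemeas F.
  apply/measurable_EFinP; apply: measurable_funM; last exact: (Rdmeas_cabs2 m1 m2).
  have := Rdmeas_affine (Mr ^+ N)^T (mact (Mr ^+ N) (intrv R m) + u) (@Rdmeas_box_indic R d r).
  by congr measurable_fun; apply/funext => t /=; rewrite mactD addrA.
have F0 y : (0 <= F y)%E by rewrite lee_fin mulr_ge0 ?box_indic_ge0 ?cabs2_ge0.
have -> : ((nrm2 g1)%:E = Rdint F)%E.
  have [k1 k2 _] := Lg1.
  rewrite -(change_var_unit uA (- intrv R m) mF F0) -RdintZ//; last first.
    exact: Rdemeas_affine.
  rewrite -nrm2E// -(@RdintE R d (fun x => (cabs2 (g1 x))%:E)).
  - congr Rdint; apply/funext => x; rewrite -EFinM; congr EFin.
    rewrite /g1 /g /affine_sys opow_DilE !cabs2M !cabs2_rc -dil_const2.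
    rewrite /Tr -/(mact (Mr ^ (- N%:Z)) x) subrK mactK.
    have -> : box_indic r (x + u) ^+ 2 = box_indic r (x + u) by rewrite /box_indic; case: inbox; rewrite ?expr1n ?expr0n.
    by rewrite mulrCA.
  - by apply/measurable_EFinP; exact: (Rdmeas_cabs2 k1 k2).
  - by move=> x; rewrite lee_fin cabs2_ge0.
rewrite RdintE//; apply: ge0_le_integral => //.
- apply/measurable_EFinP; apply: measurable_funM; last exact: (Rdmeas_cabs2 m1 m2).
  have := Rdmeas_affine (Mr ^+ l)^T (mact (Mr ^+ l) (intrv R m) + w) (@Rdmeas_box_indic R d e).
  by congr measurable_fun; apply/funext => t /=; rewrite mactD addrA.
- move=> t _; rewrite lee_fin ler_wpM2r ?cabs2_ge0// /box_indic.
  case: (boolP (inbox r _)) => H; last exact: ler0n.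
  suff -> : inbox e (mact (Mr ^+ l) (tup2rv t + intrv R m) + w) by [].
  rewrite -[X in inbox e X](mactVK J).
  by apply: re; rewrite [X in inbox r X]mactD -mactM -[_ *m _]/(Mr ^+ J * Mr ^+ l) -exprD.
Qed.

End CoefficientBound.

(** * Orbit points close to -w *)

Section Counting.
Context (R : realType) (d' : nat).
Local Notation d := d'.+1.
Local Notation C := R[i].
Local Notation V := ('rV[R]_d).
Local Notation mu := (lebesgueRd R d).
Context (M : 'M[int]_d).
Local Notation Mr := (intmx R M).
Hypothesis uM : Mr \is a GRing.unit.
Hypothesis M0 : forall e : R, 0 < e ->
  exists n0, forall n, (n0 <= n)%N -> forall i j, `|(Mr^-1 ^+ n) i j| <= e.
Context (w : V).
Hypothesis w0 : w != 0.

Definition orbit_pt (l : nat) (m : 'rV[int]_d) (y : V) := mact (Mr ^+ l) (y + intrv R m) + w.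

(* Two points M^l (y + m) and M^(l+t) (y + m) near -w force t to be bounded, as M^-t shrinks
   the second one below the size of the first; so l mod t and the bounded shift m determine
   the point. *)
Lemma count_box (I : finType) : exists2 eta : R, 0 < eta & exists c : nat,
  forall (y : V) (L : seq (nat * 'rV[int]_d * I)), uniq L ->
    (forall b, b \in L -> inbox eta (orbit_pt b.1.1 b.1.2 y)) -> (size L <= c)%N.
Proof.
have [i0 wi0] : exists i0, w ord0 i0 != 0.
  apply: contrapT => /forallNP H; move/eqP: w0; apply; apply/rowP => i; rewrite [RHS]mxE.
  by have := H i; case: eqP => // _ [].
(* Half of a nonzero coordinate of w: a point within eta of -w keeps this coordinate at least eta in
   modulus. *)
pose eta := `|w ord0 i0| / 2.
have eta0 : 0 < eta by rewrite divr_gt0 ?normr_gt0.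
exists eta => //.
have [rho [rho0 wrho]] := inbox_max w.
pose r := eta + rho.
have r0 : 0 < r by rewrite ltr_wpDr.
have dp : 0 < (d%:R : R) by rewrite ltr0n.
(* Chosen so that a matrix with entries at most c maps the box of radius r into that of radius
   eta/2, which contradicts the lower bound eta on the coordinate i0. *)
pose c := eta / (2 * d%:R * r).
have c0 : 0 < c by rewrite divr_gt0// !mulr_gt0.
have dcr : d%:R * c * r = eta / 2.
  by rewrite /c; field; rewrite !gt_eqF.
have [t0 Ht0] := M0 c0.
(* One bound for the entries of all powers of M^-1: c from t0 on, a finite sum before. It confines y
   + m whatever l is. *)
pose B := c + \sum_(l < t0) \sum_i \sum_j `|(Mr^-1 ^+ l) i j|.
have HB l i j : `|(Mr^-1 ^+ l) i j| <= B.
  have [tl|lt] := leqP t0 l.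
    apply: (le_trans (Ht0 l tl i j)); rewrite lerDl.
    by do 3 (apply: sumr_ge0 => ? _).
  rewrite (le_trans _ (_ : \sum_(l < t0) \sum_i \sum_j `|(Mr^-1 ^+ l) i j| <= B))//; last first.
    by rewrite lerDr ltW.
  rewrite (bigD1 (Ordinal lt))//= (bigD1 i)//= (bigD1 j)//= -!addrA lerDl.
  by rewrite !addr_ge0//; do ?(apply: sumr_ge0 => ? _).
have B0 : 0 <= B by exact: le_trans (normr_ge0 _) (HB 0%N ord0 ord0).
pose b0 := d%:R * B * r.
have b00 : 0 <= b0 by rewrite !mulr_ge0// ltW.
pose b1 := (Num.trunc b0).+1.
have b01 : b0 < b1%:R by rewrite -truncn_lt_nat.
(* Distinct scales congruent modulo t1 differ by at least t1 > t0; the successor also makes the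
   modulus positive. *)
pose t1 := t0.+1.
exists #|{: 'I_t1 * {ffun 'I_d -> 'I_(b1.*2.+3)} * I}| => y L uL HL.
have zbox b : b \in L -> inbox r (mact (Mr ^+ b.1.1) (y + intrv R b.1.2)) /\
    eta <= `|mact (Mr ^+ b.1.1) (y + intrv R b.1.2) ord0 i0|.
  move=> /HL; rewrite /orbit_pt; set z := mact _ _ => /forallP H; split.
    apply/forallP => i; have := H i; rewrite mxE => Hi.
    rewrite -[z ord0 i](addrK (w ord0 i)) (le_trans (ler_normB _ _))//.
    by apply: lerD => //; move/forallP: wrho.
  have := H i0; rewrite mxE => Hi.
  have : `|w ord0 i0| <= `|z ord0 i0 + w ord0 i0| + `|z ord0 i0|.
    rewrite -{1}[w ord0 i0](addKr (z ord0 i0)) addrC; exact: ler_normB.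
  have : `|w ord0 i0| = eta + eta by rewrite /eta; field.
  lra.
have mbox b i : b \in L -> `|(y ord0 i + (b.1.2 ord0 i)%:~R)| <= b0.
  move=> /zbox[Hb _]; have /forallP/(_ i) := inbox_mact (HB b.1.1) B0 Hb.
  by rewrite mactVK// !mxE.
(* The shift m is recorded relative to the integer part of y, which makes the size of the code,
   hence the bound on the count, independent of y. *)
pose phi (b : nat * 'rV[int]_d * I) : 'I_t1 * {ffun 'I_d -> 'I_(b1.*2.+3)} * I :=
  (inord (b.1.1 %% t1)%N,
   [ffun i => inord (absz (b.1.2 ord0 i + Num.floor (y ord0 i) + b1.+1%:Z)%R)], b.2).
have mrange b i : b \in L -> exists2 k, (k < b1.*2.+3)%N &
    b.1.2 ord0 i + Num.floor (y ord0 i) + b1.+1%:Z = k%:Z.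
  move=> bL; have := mbox b i bL; rewrite ler_norml => /andP[h1 h2].
  have /andP[g1 g2] := floor_itv (y ord0 i); rewrite intrD in g2.
  set z := b.1.2 ord0 i + Num.floor (y ord0 i).
  have zE : z%:~R = (b.1.2 ord0 i)%:~R + (Num.floor (y ord0 i))%:~R :> R by rewrite intrD.
  have zl : z < b1%:Z.
    by rewrite -(ltr_int R) zE -[b1%:Z%:~R]/(b1%:R); move: h2 b01 g1; lra.
  have zg : - b1.+1%:Z < z.
    rewrite -(ltr_int R) zE intrN -[b1.+1%:Z%:~R]/(b1.+1%:R) -natr1.
    by move: h1 b01 g2; lra.
  have z0 : 0 <= z + b1.+1%:Z by rewrite -lerBlDr sub0r ltW.
  exists (absz (z + b1.+1%:Z)%R); last by rewrite gez0_abs.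
  rewrite -ltz_nat gez0_abs// (@lt_trans _ _ (b1%:Z + b1.+1%:Z))// ?ltrD2r//.
  by rewrite -PoszD ltz_nat addnS addnn !ltnS leqW.
have phi_inj : {in L &, injective phi}.
  move=> [[l m] i] [[l' m'] i'] bL b'L [/(congr1 val) /= ll /ffunP mm ii].
  rewrite !inordK ?ltn_pmod// in ll.
  have {}mm : m = m'.
    apply/rowP => k; have := mm k; rewrite !ffunE => /(congr1 val) /=.
    have [k1 k1l e1] := mrange _ k bL; have [k2 k2l e2] := mrange _ k b'L.
    move: e1 e2 => /= e1 e2; rewrite e1 e2 !absz_nat !inordK// => k12.
    by move: e1; rewrite k12 -e2 => /addIr /addIr.
  suff lE : l = l' by rewrite lE mm ii.
  rewrite -{}mm in b'L *.
  have key (s s' : nat) j j' : (s, m, j) \in L -> (s', m, j') \in L -> (s %% t1)%N = (s' %% t1)%N -> ~ (s < s')%N.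
    move=> sL s'L ss' lt.
    have st : (t0 <= s' - s)%N.
      have : (t1 %| s' - s)%N by rewrite -eqn_mod_dvd ?(ltnW lt)//; apply/eqP.
      by move=> /dvdn_leq; rewrite subn_gt0 lt => /(_ isT)/ltnW.
    have [H1 _] := zbox _ s'L; have [_ H2] := zbox _ sL.
    have /forallP/(_ i0) := inbox_mact (Ht0 _ st) (ltW c0) H1.
    rewrite /= -{2}(subnK (ltnW lt)) exprD mactM mactVK// dcr.
    by move: H2 => /=; lra.
  case: (ltngtP l l') => //.
    by move/(key _ _ _ _ bL b'L ll).
  by move/(key _ _ _ _ b'L bL (esym ll)).
rewrite -(size_map phi); have um : uniq (map phi L) by rewrite map_inj_in_uniq.
by rewrite -(card_uniqP um); exact: max_card.
Qed.

(** Otherwise arbitrarily many distinct pairs (l, m) in the box of radius eta could be collected,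
    each new one from a box too small to contain the previous points, against [count_box]. *)
Lemma box_avoid (y : V) : (forall l m, orbit_pt l m y != 0) ->
  exists2 e : R, 0 < e & forall l m, ~~ inbox e (orbit_pt l m y).
Proof.
move=> y0; have [eta eta0 [c Hc]] := count_box unit.
apply: contrapT => /forall2NP H.
have sep (L : seq (nat * 'rV[int]_d * unit)) : exists2 e : R, 0 < e <= eta &
    forall b, b \in L -> ~~ inbox e (orbit_pt b.1.1 b.1.2 y).
  elim: L => [|b L [e /andP[e0 ee] He]]; first by exists eta; rewrite ?eta0/=.
  have [i Hi] : exists i, orbit_pt b.1.1 b.1.2 y ord0 i != 0.
    apply: contrapT => /forallNP H1; move/eqP: (y0 b.1.1 b.1.2); apply.
    by apply/rowP => i; rewrite [RHS]mxE; have := H1 i; case: eqP => // _ [].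
  pose e' := Num.min e (`|orbit_pt b.1.1 b.1.2 y ord0 i| / 2).
  have e'0 : 0 < e' by rewrite lt_min e0 divr_gt0 ?normr_gt0.
  exists e'; first by rewrite e'0 (le_trans _ ee)// ge_min lexx.
  move=> b'; rewrite in_cons => /orP[/eqP->|/He].
    apply/negP => /forallP/(_ i); apply/negP; rewrite -ltNge.
    have : e' <= `|orbit_pt b.1.1 b.1.2 y ord0 i| / 2 by rewrite ge_min lexx orbT.
    by move: Hi; rewrite -normr_gt0; lra.
  by apply: contra; apply: inbox_le; rewrite ge_min lexx.
have ex k : exists L : seq (nat * 'rV[int]_d * unit), [/\ uniq L, size L = k &
    forall b, b \in L -> inbox eta (orbit_pt b.1.1 b.1.2 y)].
  elim: k => [|k [L [uL sL HL]]]; first by exists [::].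
  have [e /andP[e0 ee] He] := sep L.
  have [l [m Hlm]] : exists l m, inbox e (orbit_pt l m y).
    apply: contrapT => H1; case: (H e); first by rewrite e0.
    by apply => l m; apply/negP => H2; apply: H1; exists l, m.
  exists ((l, m, tt) :: L); split=> /=.
  - by rewrite uL andbT; apply/negP => /He /=; rewrite Hlm.
  - by rewrite sL.
  - by move=> b; rewrite in_cons => /orP[/eqP->|/HL//] /=; exact: inbox_le Hlm.
have [L [uL sL HL]] := ex c.+1.
by have := Hc y L uL HL; rewrite sL ltnn.
Qed.

Lemma hyperplane_null (c : R) : mu [set t : d.-tuple R | tnth t ord0 = c] = 0%E.
Proof.
have mH : measurable [set t : d.-tuple R | tnth t ord0 = c].
  have := @measurable_tnth _ R d ord0 measurableT [set c] (measurable_set1 _).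
  by rewrite setTI.
set H := [set t | _] in mH *.
rewrite -[H]setIT -integral_indic//.
pose g (x : V) : \bar R := ((x ord0 ord0 == c)%:R)%:E.
have gE : (fun t => (\1_H t)%:E) = g \o @tup2rv R d.
  apply/funext => t /=; rewrite /g mxE indicE; congr ((nat_of_bool _)%:R%:E).
  by apply/idP/eqP => [/set_mem//|Ht]; exact: mem_set.
have mg : Rdemeas g.
  by rewrite /Rdemeas -gE; apply/measurable_EFinP; exact: measurable_indic.
have g0 x : (0 <= g x)%E by rewrite lee_fin.
transitivity (Rdint g); first by rewrite RdintE//; congr (integral _ _ _).
rewrite (@Rdint_row R d' g).
rewrite (_ : (fun x => _) = (fun x => Rdint (fun y : 'rV_d' => g (row_mx x%:M y))) \_ [set c]).
  by rewrite -integral_mkcond integral_set1.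
apply/funext => x; rewrite patchE; case: ifPn => // /negP xc.
rewrite (_ : (fun y => _) = fun=> 0%E).
  rewrite RdintE//; first by rewrite integral0.
  exact: measurable_cst.
apply/funext => y; rewrite /g.
have -> : (row_mx x%:M y : 'rV[R]_(1 + d')) ord0 ord0 = x.
  rewrite mxE; case: splitP => // j _; by rewrite !ord1 mxE eqxx mulr1n.
by case: eqP => // xc'; case: xc; exact: mem_set.
Qed.

(** For each of the countably many (l, m) the equation determines y, and the hyperplane fixing the
    first coordinate of that solution is already null. *)
Lemma ae_orbit_pt_neq0 : {ae mu, forall t, forall l m, orbit_pt l m (tup2rv t) != 0}.
Proof.
pose F (k : nat) : set (d.-tuple R) :=
  if unpickle k is Some (l, m) then
    [set t | tnth t ord0 = (mact (Mr^-1 ^+ l) (- w) - intrv R m) ord0 ord0] else set0.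
have nF k : mu.-negligible (F k).
  rewrite /F; case: unpickle => [[l m]|]; last exact: negligible_set0.
  apply/negligibleP; last exact: hyperplane_null.
  have := @measurable_tnth _ R d ord0 measurableT [set ((mact (Mr^-1 ^+ l) (- w) - intrv R m) ord0 ord0)] (measurable_set1 _).
  by rewrite setTI.
apply: (negligibleS _ (negligible_bigcup nF)) => t /=.
move=> /existsNP[l /existsNP[m /negP]]; rewrite negbK => /eqP H.
exists (pickle (l, m)) => //; rewrite /F pickleK /=.
have -> : - w = mact (Mr ^+ l) (tup2rv t + intrv R m).
  by apply/eqP; rewrite eq_sym -addr_eq0 -/(orbit_pt l m _) H.
by rewrite mactVK// addrK mxE.
Qed.

End Counting.

Lemma ltN_absz (j : int) (J : nat) : j < - J%:Z -> j = - (J + (absz j - J))%N%:Z.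
Proof. by lia. Qed.

Lemma absz_leN (j : int) (J : nat) : (absz j <= J)%N -> - J%:Z <= j.
Proof. by lia. Qed.

(** * The sum over all coarse scales *)

Section Tail.
Context (R : realType) (d' : nat).
Local Notation d := d'.+1.
Local Notation C := R[i].
Local Notation V := ('rV[R]_d).
Local Notation mu := (lebesgueRd R d).
Context (M : 'M[int]_d) (n : nat) (Psi : 'I_n -> V -> C).
Local Notation Mr := (intmx R M).
Local Notation idx := (int * 'rV[int]_d * 'I_n)%type.
Hypothesis uM : Mr \is a GRing.unit.
Hypothesis M0 : forall e : R, 0 < e ->
  exists n0, forall n, (n0 <= n)%N -> forall i j, `|(Mr^-1 ^+ n) i j| <= e.
Hypothesis LPsi : forall i, inL2 (Psi i).
Context (w : V).
Hypothesis w0 : w != 0.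

Definition below (J : nat) : set idx := [set b | b.1.1 < - J%:Z].

Lemma Rdintegrable_sum (I : Type) (s : seq I) (g : I -> V -> R) :
  (forall i, Rdintegrable (g i)) -> Rdintegrable (fun x => \sum_(i <- s) g i x).
Proof.
move=> ig; elim: s => [|i s IH].
  rewrite /Rdintegrable (_ : _ \o _ = cst 0%E); first exact: integrable0.
  by apply/funext => t /=; rewrite big_nil.
have := RdintegrableD (ig i) IH.
by congr Rdintegrable; apply/funext => x; rewrite big_cons.
Qed.

Lemma measurable_inbox_orbit (e : R) l m :
  measurable [set t : d.-tuple R | inbox e (orbit_pt M w l m (tup2rv t))].
Proof.
have := Rdmeas_affine (Mr ^+ l)^T (mact (Mr ^+ l) (intrv R m) + w) (@Rdmeas_box_indic R d e).
move=> /(_ measurableT [set 1] (measurable_set1 _)); rewrite setTI.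
congr measurable; apply/seteqP; split => t /=.
  rewrite /orbit_pt mactD addrA /box_indic; case: inbox => // /eqP.
  by rewrite eq_sym oner_eq0.
by rewrite /orbit_pt mactD addrA /box_indic => ->.
Qed.

(** Summing [coarse_coef_bound] under the integral sign leaves at most |f|^2 times c times the mass
    of the generators on [A k]. The sets [A k] shrink to a null set and do not involve J; J only has
    to be large enough for M^-J to carry the box of f into the box of radius 1/(k+1). *)
Lemma coarse_scales_small_box (f : V -> C) (r e : R) : inL2 f -> 0 <= r ->
  (forall x, ~~ inbox r x -> f x = 0) -> 0 < e ->
  exists J0, forall J, (J0 <= J)%N ->
  (\esum_(b in below J) (cabs2 (ipL2 (Tr (- mact (Mr ^+ J) w) f) (affine_sys M Psi b)))%:E <= e%:E)%E.
Proof.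
move=> Lf r0 f0 e0; have [eta eta0 [c Hc]] := count_box uM M0 w0 'I_n.
pose S (y : V) : R := \sum_i cabs2 (Psi i y).
have S0 y : 0 <= S y by apply: sumr_ge0 => i _; exact: cabs2_ge0.
have iS : Rdintegrable S.
  by apply: Rdintegrable_sum => i; have /inL2P[] := LPsi i.
pose A (k : nat) : set (d.-tuple R) :=
  [set t | exists l m, inbox k.+1%:R^-1 (orbit_pt M w l m (tup2rv t))].
have mA k : measurable (A k).
  pose F (j : nat) : set (d.-tuple R) := if unpickle j is Some (l, m) then
    [set t | inbox k.+1%:R^-1 (orbit_pt M w l m (tup2rv t))] else set0.
  rewrite (_ : A k = \bigcup_j F j).
    apply: bigcupT_measurable => j; rewrite /F; case: unpickle => [[l m]|]; last exact: measurable0.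
    exact: measurable_inbox_orbit.
  apply/seteqP; split => t.
    by move=> [l [m H]]; exists (pickle (l, m)) => //; rewrite /F pickleK.
  by move=> [j _]; rewrite /F; case: unpickle => [[l m] H|//]; exists l, m.
have small (x : R) : 0 < x -> exists k0, forall k, (k0 <= k)%N -> k.+1%:R^-1 <= x.
  move=> x0; exists (Num.trunc x^-1) => k kk.
  rewrite -[leRHS]invrK lef_pV2 ?posrE ?invr_gt0// ltW//.
  by rewrite -truncn_lt_nat ?invr_ge0 ?ltW// ltnS.
have aeA : {ae mu, forall t, exists k0, forall k, (k0 <= k)%N -> ~ A k t}.
  apply: filterS (ae_orbit_pt_neq0 uM w) => t Ht.
  have [x x0 Hx] := box_avoid uM M0 w0 Ht; have [k0 Hk0] := small x x0.
  exists k0 => k /Hk0 kx [l [m H]]; have := Hx l m.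
  by rewrite (inbox_le kx H).
(* Scaled so that nrm2 f * c * E <= e; the added ones keep the denominator positive. *)
pose E := e / ((nrm2 f + 1) * (c%:R + 1)).
have n1 : 0 < nrm2 f + 1 by rewrite ltr_wpDl// nrm2_ge0.
have c1 : 0 < c%:R + 1 :> R by rewrite ltr_wpDl.
have E0 : 0 < E by rewrite divr_gt0// mulr_gt0.
have [k0 Hk0] := integral_vanishing_sets iS S0 mA aeA E0.
have [k1 Hk1] := small eta eta0.
(* Large enough both for a small integral over [A k] and for the radius to be within reach of
   [count_box]. *)
pose k := maxn k0 k1; pose eps : R := k.+1%:R^-1.
have eps0 : 0 < eps by rewrite invr_gt0.
have epseta : eps <= eta by apply: Hk1; exact: leq_maxr.
have intA := Hk0 k (leq_maxl _ _).
have dp : 0 < (d%:R : R) by rewrite ltr0n.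
have r1 : 0 < r + 1 by rewrite ltr_wpDl.
pose q := eps / (d%:R * (r + 1)).
have q0 : 0 < q by rewrite divr_gt0// mulr_gt0.
have [J0 HJ0] := M0 q0.
exists J0 => J JJ0.
have re x : inbox r x -> inbox eps (mact (Mr^-1 ^+ J) x).
  move=> xr; apply: inbox_le (inbox_mact (HJ0 J JJ0) (ltW q0) xr).
  rewrite [leRHS](_ : eps = d%:R * q * (r + 1)); last by rewrite /q; field; rewrite !gt_eqF.
  by apply: ler_wpM2l; [rewrite mulr_ge0 ?ltW|rewrite lerDl].
apply: ge_ereal_sup => _ [X [fX XJ] <-]; rewrite fsbig_finite//.
set rr := finmap.enum_fset _.
have urr : uniq rr by exact: finmap.fset_uniq.
have Hrr b : b \in rr -> b.1.1 < - J%:Z.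
  by move=> brr; apply: XJ; apply: set_mem; rewrite -(in_fset_set fX).
pose lb (b : idx) : nat := (absz b.1.1 - J)%N.
have lbE b : b \in rr -> b.1.1 = - (J + lb b)%N%:Z.
  by move=> /Hrr; exact: ltN_absz.
pose G (b : idx) (t : d.-tuple R) : R :=
  box_indic eps (orbit_pt M w (lb b) b.1.2 (tup2rv t)) * cabs2 (Psi b.2 (tup2rv t)).
have G0 b t : 0 <= G b t by rewrite mulr_ge0 ?box_indic_ge0 ?cabs2_ge0.
have mG b : measurable_fun setT (EFin \o G b).
  have [m1 m2 _] := LPsi b.2; apply/measurable_EFinP; apply: measurable_funM.
    have := Rdmeas_affine (Mr ^+ lb b)^T (mact (Mr ^+ lb b) (intrv R b.1.2) + w) (@Rdmeas_box_indic R d eps).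
    by congr measurable_fun; apply/funext => t /=; rewrite /orbit_pt mactD addrA.
  exact: (Rdmeas_cabs2 m1 m2).
have step1 : (\sum_(b <- rr) (cabs2 (ipL2 (Tr (- mact (Mr ^+ J) w) f) (affine_sys M Psi b)))%:E <=
    (nrm2 f)%:E * \sum_(b <- rr) \int[mu]_t (G b t)%:E)%E.
  rewrite ge0_sume_distrr; last by move=> b _; apply: integral_ge0 => t _; rewrite lee_fin.
  rewrite big_seq [leRHS]big_seq; apply: lee_sum => b brr.
  have bE : b = (- (J + lb b)%N%:Z, b.1.2, b.2).
    by rewrite -(lbE b brr); case: (b) => [[]].
  by have := coarse_coef_bound uM LPsi w (lb b) b.1.2 b.2 Lf f0 re; rewrite -bE.
apply: (le_trans step1).
(* At a given point at most c indices contribute, each by at most S y, and none does so off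
   [A k]. *)
have pw t : \sum_(b <- rr) G b t <= c%:R * (\1_(A k) t * S (tup2rv t)).
  set y := tup2rv t.
  pose P (b : idx) := inbox eps (orbit_pt M w (lb b) b.1.2 y).
  have H1 : \sum_(b <- rr) G b t <= (count P rr)%:R * S y.
    rewrite -sum1_count natr_sum mulr_suml [leRHS]big_mkcond; apply: ler_sum => b _.
    rewrite /G -/y /box_indic -/(P b); case: (P b); last by rewrite !mul0r.
    by rewrite !mul1r /S (bigD1 b.2)//= lerDl sumr_ge0// => i _; exact: cabs2_ge0.
  apply: (le_trans H1); rewrite mulrA ler_wpM2r ?S0//.
  case: (posnP (count P rr)) => [->|]; first by rewrite mulr_ge0// indicE.
  rewrite -has_count => /hasP[b brr Pb]; rewrite indicE mem_set; last first.
    by exists (lb b), b.1.2.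
  rewrite mulr1 ler_nat -size_filter.
  pose phi (b : idx) : nat * 'rV[int]_d * 'I_n := (lb b, b.1.2, b.2).
  rewrite -(size_map phi); apply: (Hc y).
    rewrite map_inj_in_uniq ?filter_uniq//.
    move=> b1 b2; rewrite !mem_filter => /andP[_ b1r] /andP[_ b2r] [el em ei].
    have := lbE _ b1r; have := lbE _ b2r; rewrite el => <-.
    by case: b1 b2 em ei {b1r b2r el} => [[? ?] ?] [[? ?] ?] /= -> -> ->.
  move=> _ /mapP[b' + ->]; rewrite mem_filter => /andP[Pb' _] /=.
  exact: inbox_le Pb'.
rewrite -ge0_integral_sum//; last by move=> b t _; rewrite lee_fin.
apply: (@le_trans _ _ ((nrm2 f)%:E * (c%:R * E)%:E))%E; last first.
  rewrite -EFinM lee_fin /E.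
  have : nrm2 f * (c%:R * (e / ((nrm2 f + 1) * (c%:R + 1)))) =
    e * ((nrm2 f / (nrm2 f + 1)) * (c%:R / (c%:R + 1))).
    by field; rewrite !gt_eqF.
  move=> ->; rewrite ger_pMr// mulr_ile1 ?divr_ge0 ?nrm2_ge0// ?(ltW n1) ?(ltW c1)//;
  by rewrite ler_pdivrMr// mul1r lerDl.
apply: lee_wpmul2l; first by rewrite lee_fin nrm2_ge0.
rewrite EFinM.
apply: (@le_trans _ _ (c%:R%:E * \int[mu]_t (\1_(A k) t * S (tup2rv t))%:E))%E; last first.
  by apply: lee_wpmul2l; rewrite ?lee_fin.
have mAS : measurable_fun setT (fun t : d.-tuple R => (\1_(A k) t * S (tup2rv t))%:E).
  apply/measurable_EFinP; apply: measurable_funM; first exact: measurable_indic.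
  by have /integrableP[/measurable_EFinP] := iS.
have AS0 t : (0 <= (\1_(A k) t * S (tup2rv t))%:E)%E.
  by rewrite lee_fin mulr_ge0// indicE.
rewrite -ge0_integralZl//.
apply: ge0_le_integral => //.
- by move=> t _; apply: sume_ge0 => b _; rewrite lee_fin.
- by apply: emeasurable_sum => b; exact: mG.
- exact: measurable_funeM.
- by move=> t _; rewrite sumEFin -EFinM lee_fin.
Qed.

Context (B : R).
Hypothesis B0 : 0 < B.
Hypothesis bessel : forall f, inL2 f ->
  (\esum_(b in [set: idx]) (cabs2 (ipL2 f (affine_sys M Psi b)))%:E <= (B * nrm2 f)%:E)%E.

(** The Bessel bound controls the part of f outside a large box by its norm, which translations
    preserve; hence this part is small for every J at once. *)
Lemma coarse_scales_small (f : V -> C) (e : R) : inL2 f -> 0 < e ->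
  exists J0, forall J, (J0 <= J)%N ->
  (\esum_(b in below J) (cabs2 (ipL2 (Tr (- mact (Mr ^+ J) w) f) (affine_sys M Psi b)))%:E <= e%:E)%E.
Proof.
move=> Lf e0.
(* Outside mass e/(4B) costs at most e/4 by Bessel, the box part costs e/4, and [cabs2D_le] doubles
   both, for a total of e. *)
have [r r0 Hr] := nrm2_outside_box Lf (divr_gt0 e0 (mulr_gt0 (ltr0Sn R 3) B0)).
pose f2 x := rc (1 - box_indic r x) * f x; pose f1 x := rc (box_indic r x) * f x.
have L2 : inL2 f2.
  apply: inL2_bounded => //.
    by apply: measurable_funB => //; exact: Rdmeas_box_indic.
  by move=> x; rewrite ger0_norm ?subr_ge0 ?box_indic_le1// gerBl box_indic_ge0.
have L1 : inL2 f1.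
  apply: inL2_bounded => //; first exact: Rdmeas_box_indic.
  by move=> x; rewrite ger0_norm ?box_indic_ge0// box_indic_le1.
have f10 x : ~~ inbox r x -> f1 x = 0 by rewrite /f1 /box_indic => /negbTE ->; rewrite mul0r.
have [J0 HJ0] := coarse_scales_small_box L1 (ltW r0) f10 (divr_gt0 e0 (ltr0Sn R 3)).
exists J0 => J /HJ0 H1; set u := - mact _ w in H1 *.
have fE : Tr u f = fun x => Tr u f1 x + Tr u f2 x.
  apply/funext => x; rewrite /Tr /f1 /f2 -mulrDl -rcD.
  by rewrite [box_indic _ _ + _]addrC subrK mul1r.
have E b : (cabs2 (ipL2 (Tr u f) (affine_sys M Psi b)) <=
    2 * cabs2 (ipL2 (Tr u f1) (affine_sys M Psi b)) + 2 * cabs2 (ipL2 (Tr u f2) (affine_sys M Psi b)))%R.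
  have Lb := inL2_affine_sys uM LPsi b.
  have -> : ipL2 (Tr u f) (affine_sys M Psi b) =
     ipL2 (Tr u f1) (affine_sys M Psi b) + ipL2 (Tr u f2) (affine_sys M Psi b).
    by rewrite fE (ipDl (inL2_Tr u L1) (inL2_Tr u L2) Lb).
  exact: cabs2D_le.
have c0 g b : 0 <= cabs2 (ipL2 g (affine_sys M Psi b)) by exact: cabs2_ge0.
apply: (@le_trans _ _ (\esum_(b in below J)
   ((2 * cabs2 (ipL2 (Tr u f1) (affine_sys M Psi b)))%:E + (2 * cabs2 (ipL2 (Tr u f2) (affine_sys M Psi b)))%:E)))%E.
  by apply: le_esum => b _; rewrite -EFinD lee_fin.
rewrite esumD; last 2 first.
- by move=> b _; rewrite lee_fin mulr_ge0.
- by move=> b _; rewrite lee_fin mulr_ge0.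
have Z g : (\esum_(b in below J) (2 * cabs2 (ipL2 (Tr u g) (affine_sys M Psi b)))%:E =
   \esum_(b in below J) (cabs2 (ipL2 (Tr u g) (affine_sys M Psi b)))%:E +
   \esum_(b in below J) (cabs2 (ipL2 (Tr u g) (affine_sys M Psi b)))%:E)%E.
  rewrite -esumD; try by move=> b _; rewrite lee_fin.
  by apply: eq_esum => b _; rewrite -EFinD mulr_natl mulr2n.
rewrite !Z.
have H2 : (\esum_(b in below J) (cabs2 (ipL2 (Tr u f2) (affine_sys M Psi b)))%:E <= (e / 4)%:E)%E.
  apply: (@le_trans _ _ (\esum_(b in [set: idx]) (cabs2 (ipL2 (Tr u f2) (affine_sys M Psi b)))%:E))%E.
    rewrite (esumID (below J) [set: idx]); last by move=> b _; rewrite lee_fin.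
    by rewrite setTI leeDl// esum_ge0// => b _; rewrite lee_fin.
  apply: (le_trans (bessel (inL2_Tr u L2))); rewrite nrm2_Tr// lee_fin.
  apply: (le_trans (ler_wpM2l (ltW B0) Hr)).
  rewrite le_eqVlt; apply/orP; left; apply/eqP; field.
  by rewrite gt_eqF.
apply: (le_trans (leeD (leeD H1 H1) (leeD H2 H2))).
by rewrite -!EFinD lee_fin; lra.
Qed.

End Tail.

(** * Decomposition of the bold system *)

Section Main.
Context (R : realType) (d' : nat).
Local Notation d := d'.+1.
Local Notation C := R[i].
Local Notation V := ('rV[R]_d).
Context (M P M' : 'M[int]_d) (p n : nat) (th : 'I_p -> V) (sigma : {perm 'I_p})
  (Psi : 'I_n -> V -> C) (K : 'I_p -> 'rV[int]_d).
Local Notation Mr := (intmx R M).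
Local Notation Pr := (intmx R P).
Local Notation idx := (int * 'rV[int]_d * 'I_n)%type.
Local Notation X := (affine_sys M Psi).
Local Notation bX := (bold_affine_sys M P th sigma Psi).
Local Notation cg := (congP P).
Local Notation chi := (chi th).
Hypothesis uM : Mr \is a GRing.unit.
Hypothesis uP : Pr \in unitmx.
Hypothesis p0 : (0 < p)%N.
Hypothesis M'E : Pr *m Mr *m invmx Pr = intmx R M'.
Hypothesis rth : reps Pr^T th.
Hypothesis hs : forall q, in_Zd (mact (intmx R M')^T (th q) - th (sigma q)).
Hypothesis LPsi : forall i, inL2 (Psi i).
Hypothesis Kinj : forall s s', cg (K s) (K s') -> s = s'.
Hypothesis Ksurj : forall k, exists s, cg k (K s).

Local Notation cp := (rc (Num.sqrt (p%:R : R))^-1 : C).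

Lemma invsqrtp_sqr : cp * cp * p%:R = 1.
Proof.
rewrite -rcM (_ : p%:R = rc p%:R); last first.
  by elim: (p) => // k IH; rewrite -!natr1 rcD -IH.
rewrite -rcM -expr2 exprVn sqr_sqrtr// mulVf//.
by rewrite pnatr_eq0 -lt0n.
Qed.

Lemma chiJ k q : chi k q * (chi k q)^* = 1.
Proof. exact: expiJ. Qed.

Lemma chi_eq_cg k l : (forall q, chi k q = chi l q) -> cg k l.
Proof.
move=> kl; have [m] : cg (k - l) 0.
  apply: (chi_sep uP rth) => q.
  have : chi (k - l) q * chi l q = chi l q by rewrite -chiD subrK kl.
  move=> /(congr1 (fun z => z * (chi l q)^*)).
  by rewrite -mulrA chiJ mulr1.
by rewrite subr0 => e; exists m.
Qed.

(** The isometry V_s; [unlift] below is its adjoint, see [ipH_lift]. *)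
Definition lift (s : 'I_p) (g : V -> C) : 'I_p -> V -> C :=
  fun q x => (cp * chi (K s) q) * g x.
Definition unlift (s : 'I_p) (F : 'I_p -> V -> C) : V -> C :=
  fun x => \sum_q (cp * (chi (K s) q)^*) * F q x.
Definition shift (J : nat) (s : 'I_p) : V :=
  mact (Mr ^+ J) (mact (invmx Pr) (intrv R (K s))).
(** The absolute value is only a coercion to nat: the map is used on scales j >= -J, where j + J >=
    0. *)
Definition relabel (J : nat) (sb : 'I_p * idx) : idx :=
  (sb.2.1.1, iact (M' ^+ absz (sb.2.1.1 + J%:Z)%R) (K sb.1) + iact P sb.2.1.2, sb.2.2).

Lemma invP_M' k : invmx Pr *m intmx R M' ^+ k = Mr ^+ k *m invmx Pr.
Proof.
elim: k => [|k IH]; first by rewrite !expr0 mulmx1 mul1mx.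
rewrite !exprSr -[_ * intmx R M']/(_ *m intmx R M') mulmxA IH -M'E.
by rewrite !mulmxA mulmxKV// -mulmxA.
Qed.

Lemma intmxX (A : 'M[int]_d) k : intmx R (A ^+ k) = intmx R A ^+ k.
Proof.
elim: k => [|k IH]; last by rewrite !exprS -[A * _]/(A *m _) intmxM IH.
by apply/matrixP => i j; rewrite !expr0 !mxE mulrb; case: eqP.
Qed.

(** With k = M'^(j+J) k_s + P m, the term P m has trivial phase and M'^(j+J) acts as sigma^(j+J) on
    q, which cancels the sigma^(-j) of the dilation since sigma^J = 1. The translation vector is
    P^(-1) k = M^j u + m, because P^(-1) M' = M P^(-1), and M^j u passes through D^j as the
    translation u. *)
Lemma bold_relabel (J : nat) (s : 'I_p) (b : idx) : (sigma ^+ J = 1)%g ->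
  ~ below J b -> bX (relabel J (s, b)) = lift s (Tr (shift J s) (X b)).
Proof.
case: b => [[j m] i] sJ /negP; rewrite /below /= -leNgt => Jj.
rewrite /relabel /=; set t := absz _.
have tE : t%:Z = J%:Z + j.
  by rewrite /t gez0_abs; [rewrite addrC|rewrite -lerBlDr sub0r].
set k := _ + _.
apply/funext => q; apply/funext => x.
rewrite /bold_affine_sys (opow_bDilE M) /lift Tr_opow// !opow_DilE//.
rewrite /bTr /Sop /Tr.
have -> : expi (2 * pi * dotv (intrv R k) (th (permz sigma j q))) = chi (K s) q.
  rewrite -/(chi k _) /k chiD (chi_P uP rth) mulr1 -(chi_sigmaX hs).
  by rewrite (permzK q sJ tE).
have -> : mact (invmx Pr) (intrv R k) = mact (Mr ^ j) (shift J s) + intrv R m.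
  rewrite /k intrvD !intrv_iact mactD -[mact (invmx Pr) (mact Pr _)]mactM mulVmx// mact1.
  congr (_ + _); rewrite -mactM intmxX invP_M' mactM /shift -[RHS]mactM; congr mact.
  by rewrite -[RHS]/(Mr ^ j * Mr ^ J%:Z) -exprzDr// addrC -tE.
by rewrite !mulrA; congr (_ * _); ring.
Qed.

Lemma iactP_inj m m' : iact P m = iact P m' -> m = m'.
Proof.
move=> /(congr1 (@intrv R d)); rewrite !intrv_iact => /(congr1 (mact (invmx Pr))).
by rewrite -!mactM mulVmx// !mact1 => /intrv_inj.
Qed.

(** M' acts bijectively on the classes modulo P because sigma acts bijectively on the characters,
    which separate classes. Hence k determines the class s at each scale, and then m, by injectivity
    of P. *)
Lemma relabel_bij (J : nat) : set_bij ([set: 'I_p] `*`` (fun=> ~` below J)) (~` below J) (relabel J).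
Proof.
split.
- by move=> [s [[j m] i]] [].
- move=> [s [[j m] i]] [s' [[j' m'] i']] _ _ [<- e <-].
  have ss : s = s'.
    apply: Kinj; apply: chi_eq_cg => q.
    set t := absz _ in e.
    have := congr1 (fun k => chi k ((sigma ^- t)%g q)) e.
    by rewrite !chiD !(chi_P uP rth) !mulr1 -!(chi_sigmaX hs) -permM mulVg perm1.
  by move: e; rewrite -ss => /addrI /iactP_inj ->.
- move=> [[j k] i] Jj; set t := absz (j + J%:Z).
  (* M'^t' inverts M'^t on classes, as t + t' is a multiple of the order of sigma. *)
  pose t' := (t * #[sigma]%g.-1)%N.
  have tt' q : (sigma ^+ t')%g ((sigma ^+ t)%g q) = q.
    rewrite -permM -expgD /t' -mulnS prednK ?order_gt0// mulnC expgM expg_order expg1n.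
    by rewrite perm1.
  have [s Hs] := Ksurj (iact (M' ^+ t') k).
  have [m Hm] : cg k (iact (M' ^+ t) (K s)).
    apply: chi_eq_cg => q; rewrite -(chi_sigmaX hs) -(chi_cong uP rth _ Hs) -(chi_sigmaX hs).
    by rewrite tt'.
  exists (s, (j, m, i)); first by split.
  by rewrite /relabel /= -/t -Hm addrC subrK.
Qed.

Lemma inL2_unlift s (F : 'I_p -> V -> C) : inH F -> inL2 (unlift s F).
Proof. by move=> LF; apply: inL2_sum => q; apply: inL2Z; exact: LF. Qed.

Lemma ipH_lift s (F : 'I_p -> V -> C) (g : V -> C) : inH F -> inL2 g ->
  ipH F (lift s g) = ipL2 (unlift s F) g.
Proof.
move=> LF Lg; rewrite /unlift ip_suml//; last by move=> q; apply: inL2Z; exact: LF.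
apply: eq_bigr => q _; rewrite ipZr// ipZl//.
by rewrite rmorphM/= conj_rc.
Qed.

Lemma inH_lift s g : inL2 g -> inH (lift s g).
Proof. by move=> Lg q; exact: inL2Z. Qed.

Lemma ipH_lift2 s s' (g g' : V -> C) : inL2 g -> inL2 g' ->
  ipH (lift s g) (lift s' g') = if s == s' then ipL2 g g' else 0.
Proof.
move=> Lg Lg'; rewrite ipH_lift//; last exact: inH_lift.
have -> : unlift s' (lift s g) = fun x => (cp * cp * \sum_q chi (K s - K s') q) * g x.
  apply/funext => x; rewrite /unlift /lift mulr_sumr mulr_suml; apply: eq_bigr => q _.
  have -> : chi (K s - K s') q = chi (K s) q * (chi (K s') q)^*.
    rewrite chiD; congr (_ * _).
    rewrite -[LHS]mul1r -(chiJ (K s') q) mulrAC -chiD subrr chi0 mul1r//.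
  by ring.
rewrite ipZl// (sum_chi uP rth); case: eqP => [->|ss'].
  by rewrite subrr asboolT ?invsqrtp_sqr ?mul1r//; exact: cg_refl.
rewrite asboolF ?mulr0 ?mul0r// => -[m]; rewrite subr0 => e.
by apply: ss'; apply: Kinj; exists m.
Qed.

(** Pointwise in x this is Parseval's identity for the characters of the finite group Z^d / P Z^d,
    in the form [sum_chiJ]. *)
Lemma sum_nrm2_unlift (F : 'I_p -> V -> C) : inH F ->
  \sum_s nrm2 (unlift s F) = \sum_q nrm2 (F q).
Proof.
move=> LF.
have rint_sum (G : 'I_p -> V -> C) : (forall s, inL2 (G s)) ->
    \sum_s nrm2 (G s) = rint (fun x => \sum_s cabs2 (G s x)).
  move=> LG; elim: (index_enum _) => [|s r IH].
    rewrite big_nil /rint (_ : _ \o _ = fun=> 0); last by apply/funext => t /=; rewrite big_nil.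
    by rewrite /Rintegral integral0.
  rewrite big_cons IH -rintD.
  - by congr rint; apply/funext => x; rewrite big_cons.
  - by have /inL2P[] := LG s.
  - by apply: Rdintegrable_sum => s'; have /inL2P[] := LG s'.
rewrite !rint_sum//; last by move=> s; exact: inL2_unlift.
congr rint; apply/funext => x.
suff : rc (\sum_s cabs2 (unlift s F x)) = rc (\sum_q cabs2 (F q x)) by case.
have rcS (h : 'I_p -> R) : rc (\sum_s h s) = \sum_s rc (h s).
  by elim: (index_enum _) => [|s r IH]; rewrite ?big_nil// !big_cons rcD IH.
rewrite !rcS.
transitivity (\sum_q \sum_q' (cp * cp * \sum_s chi (K s) q' * (chi (K s) q)^*) * (F q x * (F q' x)^*)).
  have E s : rc (cabs2 (unlift s F x)) = \sum_q \sum_q'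
      (cp * (chi (K s) q)^* * F q x) * (cp * (chi (K s) q')^* * F q' x)^*.
    by rewrite -mulcJ /unlift rmorph_sum big_distrlr.
  rewrite (eq_bigr _ (fun s _ => E s)).
  rewrite exchange_big; apply: eq_bigr => q _; rewrite exchange_big; apply: eq_bigr => q' _ /=.
  rewrite mulr_sumr mulr_suml; apply: eq_bigr => s _.
  by rewrite !rmorphM/= conj_rc conjCK; ring.
apply: eq_bigr => q _; rewrite (bigD1 q)//= [X in _ + X]big1 => [|q' q'q]; last first.
  by rewrite (sum_chiJ uP rth Kinj Ksurj) (negbTE q'q) mulr0 mul0r.
by rewrite (sum_chiJ uP rth Kinj Ksurj) eqxx invsqrtp_sqr mul1r addr0 mulcJ.
Qed.

Lemma ipH_ff (F : 'I_p -> V -> C) : inH F -> ipH F F = rc (\sum_q nrm2 (F q)).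
Proof.
move=> LF; rewrite /ipH; under eq_bigr do rewrite ip_ff//.
by elim: (index_enum _) => [|s r IH]; rewrite ?big_nil// !big_cons rcD IH.
Qed.

Lemma inH_bold b : inH (bX b).
Proof.
case: b => [[j k] i] q; rewrite /bold_affine_sys (opow_bDilE M).
by apply: inL2_opow => //; apply: inL2Z; apply: inL2_Tr; exact: inL2Z.
Qed.

Lemma ipH_bold (J : nat) s b F : (sigma ^+ J = 1)%g -> ~ below J b -> inH F ->
  ipH F (bX (relabel J (s, b))) = ipL2 (Tr (- shift J s) (unlift s F)) (X b).
Proof.
move=> sJ Jb LF; have Lb := inL2_affine_sys uM LPsi b.
rewrite bold_relabel// ipH_lift//; last exact: inL2_Tr.
rewrite -[RHS](ip_Tr (shift J s) (inL2_Tr _ (inL2_unlift s LF)) Lb).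
by rewrite TrTr subrr Tr0.
Qed.

Lemma esum_bold (J : nat) F : (sigma ^+ J = 1)%g -> inH F ->
  (\esum_(b in ~` below J) (cabs2 (ipH F (bX b)))%:E =
   \sum_s \esum_(b in ~` below J)
     (cabs2 (ipL2 (Tr (- shift J s) (unlift s F)) (X b)))%:E)%E.
Proof.
move=> sJ LF; rewrite (reindex_esum _ _ _ _ (relabel_bij J)).
rewrite -(@esum_esum R _ _ [set: 'I_p] (fun=> ~` below J)
   (fun s b => (cabs2 (ipH F (bX (relabel J (s, b)))))%:E)); last first.
  by move=> s b _ _; rewrite lee_fin cabs2_ge0.
have -> : [set: 'I_p] = [set` index_enum 'I_p].
  by apply/seteqP; split => // s _ /=; exact: mem_index_enum.
rewrite esum_fset//; last by move=> s _; apply: esum_ge0 => b _; rewrite lee_fin cabs2_ge0.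
rewrite -fsbig_seq ?index_enum_uniq//; apply: eq_bigr => s _; apply: eq_esum => b Jb.
by rewrite ipH_bold.
Qed.

Lemma exists_period (J0 : nat) : exists2 J, (J0 <= J)%N & (sigma ^+ J = 1)%g.
Proof.
exists (#[sigma]%g * J0)%N; first by rewrite leq_pmull// order_gt0.
by rewrite expgM expg_order expg1n.
Qed.

Lemma esum_below_split (a : idx -> \bar R) J : (forall b, 0 <= a b)%E ->
  (\esum_(b in [set: idx]) a b = \esum_(b in below J) a b + \esum_(b in ~` below J) a b)%E.
Proof. by move=> a0; rewrite (esumID (below J))// !setTI. Qed.

Hypothesis K0 : forall s, K s != 0.
Hypothesis M0 : forall e : R, 0 < e ->
  exists n0, forall n, (n0 <= n)%N -> forall i j, `|(Mr^-1 ^+ n) i j| <= e.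

Lemma frame_lift A B : is_frame (@inL2 R d) (@ipL2 R d) X A B ->
  is_frame (@inH R d p) (@ipH R d p) bX A B.
Proof.
move=> [A0 B0 LX HX]; split=> //; first exact: inH_bold.
move=> F LF; rewrite ipH_ff//= -sum_nrm2_unlift//.
have LG s := inL2_unlift s LF.
have HX' f : inL2 f -> ((A * nrm2 f)%:E <= \esum_(b in [set: idx]) (cabs2 (ipL2 f (X b)))%:E)%E /\
   (\esum_(b in [set: idx]) (cabs2 (ipL2 f (X b)))%:E <= (B * nrm2 f)%:E)%E.
  by move=> Lf; have := HX f Lf; rewrite ip_ff.
have c0 f b : (0 <= (cabs2 (ipL2 f (X b)))%:E)%E by rewrite lee_fin cabs2_ge0.
have cH0 b : (0 <= (cabs2 (ipH F (bX b)))%:E)%E by rewrite lee_fin cabs2_ge0.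
have w0 s : mact (invmx Pr) (intrv R (K s)) != 0.
  apply: contra_neq (K0 s) => /(congr1 (mact Pr)); rewrite -mactM mulmxV// mact1.
  rewrite [RHS](_ : _ = intrv R 0); first exact: intrv_inj.
  by rewrite intrv0 /mact mul0mx.
split.
  (* Lower bound up to e: each of the p pieces may lose e/p to its coarse scales, and J is a period
     of sigma beyond all p thresholds. *)
  apply/lee_addgt0Pr => e e0.
  have ep : 0 < e / p%:R by rewrite divr_gt0 ?ltr0n.
  have /boolp.choice[J0 HJ0] := fun s => coarse_scales_small uM M0 LPsi (w0 s) B0 (fun f Lf => (HX' f Lf).2) (LG s) ep.
  have [J JJ sJ] := exists_period (\max_s J0 s).
  apply: (@le_trans _ _ (\esum_(b in ~` below J) (cabs2 (ipH F (bX b)))%:E + e%:E))%E; last first.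
    by rewrite leeD2r// (esum_below_split J)// leeDr// esum_ge0.
  rewrite esum_bold//.
  have -> : e = \sum_(s < p) (e / p%:R).
    by rewrite sumr_const card_ord -[RHS]mulr_natr mulfVK// pnatr_eq0 -lt0n.
  rewrite mulr_sumr -!sumEFin -big_split/=; apply: lee_sum => s _.
  rewrite -(nrm2_Tr (- shift J s) (LG s)).
  apply: (le_trans (HX' _ (inL2_Tr _ (LG s))).1).
  rewrite (esum_below_split J)// addeC leeD2l//.
  by apply: HJ0; apply: leq_trans JJ; exact: leq_bigmax.
(* Upper bound: a finite list of indices lies in the scales j >= -J for some period J, where the
   decomposition is exact. *)
apply: esum_le_sum => r ur.
have [J JJ sJ] := exists_period (\max_(b <- r) absz b.1.1).
have rJ b : b \in r -> ~ below J b.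
  move=> br; rewrite /below /=; apply/negP; rewrite -leNgt.
  by apply: absz_leN; apply: leq_trans JJ; exact: leq_bigmax_seq.
rewrite -lee_fin -sumEFin fsbig_seq//.
apply: (@le_trans _ _ (\esum_(b in ~` below J) (cabs2 (ipH F (bX b)))%:E))%E.
  by apply: ereal_sup_ubound; exists [set` r] => //; split.
rewrite esum_bold// mulr_sumr -sumEFin; apply: lee_sum => s _.
rewrite -(nrm2_Tr (- shift J s) (LG s)).
apply: le_trans (HX' _ (inL2_Tr _ (LG s))).2.
by rewrite (esum_below_split J)// leeDr// esum_ge0.
Qed.

(** All phases are 1 at k = P m, so the affine system sits inside the bold one through S. *)
Lemma bold_P (j : int) m i : bX (j, iact P m, i) = @Sop R d p (X (j, m, i)).
Proof.
apply/funext => q; rewrite /bold_affine_sys (opow_bDilE M) /affine_sys /Sop !opow_DilE//.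
apply/funext => x; rewrite /bTr /Sop /Tr.
rewrite -/(chi (iact P m) _) (chi_P uP rth) mul1r.
by rewrite intrv_iact -mactM mulVmx// mact1 mulrCA.
Qed.

Lemma inH_S f : inL2 f -> inH (@Sop R d p f).
Proof. by move=> Lf q; exact: inL2Z. Qed.

Lemma ipH_S f g : inL2 f -> inL2 g -> ipH (@Sop R d p f) (@Sop R d p g) = ipL2 f g.
Proof.
move=> Lf Lg; transitivity (\sum_(q < p) cp * cp * ipL2 f g).
  apply: eq_bigr => q _; rewrite /Sop ipZl//; last exact: inL2Z.
  by rewrite ipZr// conj_rc mulrA.
by rewrite sumr_const card_ord -[LHS]mulr_natr mulrAC invsqrtp_sqr mul1r.
Qed.

Lemma sum_chi_permz k j : ~ cg k 0 -> \sum_q chi k (permz sigma j q) = 0.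
Proof.
move=> kP; transitivity (\sum_q chi k q); last by rewrite (sum_chi uP rth) asboolF.
have pinj : injective (permz sigma j).
  by case: j => l q q' /=; exact: perm_inj.
by rewrite [RHS](reindex_inj pinj).
Qed.

(** All components of S f coincide, so the inner product contains the sum of a nontrivial character
    over the permuted components. With [bold_P], testing the bold system on S f therefore sees
    exactly the affine system. *)
Lemma ipH_S_bold0 f (j : int) k i : inL2 f -> ~ cg k 0 -> ipH (@Sop R d p f) (bX (j, k, i)) = 0.
Proof.
move=> Lf kP.
pose g := opow (Dil M) (Dilinv M) j (Tr (mact (invmx Pr) (intrv R k)) (Psi i)).
have Lg : inL2 g by apply: inL2_opow => //; exact: inL2_Tr.
have E q : bX (j, k, i) q = fun x => (cp * chi k (permz sigma j q)) * g x.
  rewrite /bold_affine_sys (opow_bDilE M) /g !opow_DilE//.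
  by apply/funext => x; rewrite /bTr /Sop /Tr -/(chi k _); ring.
rewrite /ipH /Sop; under eq_bigr => q _.
  rewrite E ipZl ?ipZr//; last exact: inL2Z.
  over.
rewrite /=; under eq_bigr => q _.
  rewrite rmorphM/= conj_rc mulrA.
  rewrite (_ : cp * (cp * (chi k (permz sigma j q))^*) * ipL2 f g =
    (cp * cp * ipL2 f g) * (chi k (permz sigma j q))^*); last by ring.
  over.
by rewrite /= -mulr_sumr -rmorph_sum/= sum_chi_permz// rmorph0 mulr0.
Qed.

Lemma esum_S f : inL2 f ->
  (\esum_(b in [set: idx]) (cabs2 (ipH (@Sop R d p f) (bX b)))%:E =
   \esum_(b in [set: idx]) (cabs2 (ipL2 f (X b)))%:E)%E.
Proof.
move=> Lf; pose e (b : idx) : idx := (b.1.1, iact P b.1.2, b.2).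
have c0 b : (0 <= (cabs2 (ipH (@Sop R d p f) (bX b)))%:E)%E by rewrite lee_fin cabs2_ge0.
rewrite (esumID (e @` setT) [set: idx])//= !setTI.
rewrite [X in (_ + X)%E]esum1 ?adde0; last first.
  move=> [[j k] i] H; rewrite ipH_S_bold0 ?cabs20// => -[m]; rewrite subr0 => km.
  by apply: H; exists (j, m, i) => //; rewrite /e /= -km.
rewrite esum_image; last first.
  by move=> [[j m] i] [[j' m'] i'] _ _ [-> /iactP_inj -> ->].
apply: eq_esum => -[[j m] i] _; rewrite -[e _]/(j, iact P m, i) bold_P ipH_S//.
exact: (inL2_affine_sys uM LPsi (j, m, i)).
Qed.

Lemma frame_unlift A B : is_frame (@inH R d p) (@ipH R d p) bX A B ->
  is_frame (@inL2 R d) (@ipL2 R d) X A B.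
Proof.
move=> [A0 B0 _ HX]; split=> //; first exact: inL2_affine_sys.
by move=> f Lf; have := HX _ (inH_S Lf); rewrite ipH_S// esum_S.
Qed.

Lemma onb_unlift : is_onb (@inH R d p) (@ipH R d p) bX -> is_onb (@inL2 R d) (@ipL2 R d) X.
Proof.
move=> [_ o c]; have LX := inL2_affine_sys uM LPsi; split=> //.
  move=> [[j m] i] [[j' m'] i']; rewrite -ipH_S// -!bold_P o.
  congr (if _ then _ else _); apply/eqP/eqP; last by case=> -> -> ->.
  by case=> -> /iactP_inj -> ->.
move=> f Lf f0; rewrite -ipH_S//; apply: c; first exact: inH_S.
move=> [[j k] i]; have [[m]|kP] := pselect (cg k 0); last exact: ipH_S_bold0.
by rewrite subr0 => ->; rewrite bold_P ipH_S.
Qed.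

Lemma onb_lift : is_onb (@inL2 R d) (@ipL2 R d) X -> is_onb (@inH R d p) (@ipH R d p) bX.
Proof.
move=> onbX; have [LX o c] := onbX; split; first exact: inH_bold.
  (* Only two vectors are involved, so one J puts both in the exact decomposition, with orthogonal
     ranges for distinct classes and invariance under translation within a class. *)
  move=> b b'; have [J JJ sJ] := exists_period (maxn (absz b.1.1) (absz b'.1.1)).
  have below_abs (b1 : idx) : (absz b1.1.1 <= J)%N -> (~` below J) b1.
    by move=> bJ; apply/negP; rewrite -leNgt; exact: absz_leN.
  have [_ inj surj] := relabel_bij J.
  have [[s c1] [_ /= H1] E1] := surj b (below_abs b (leq_trans (leq_maxl _ _) JJ)).
  have [[s' c2] [_ /= H2] E2] := surj b' (below_abs b' (leq_trans (leq_maxr _ _) JJ)).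
  rewrite -E1 -E2 !bold_relabel// ipH_lift2; try exact: inL2_Tr.
  have key : relabel J (s, c1) = relabel J (s', c2) -> (s, c1) = (s', c2).
    by apply: inj; apply: mem_set; split.
  have [ss'|ss'] := eqVneq s s'.
    rewrite -ss' in key *; rewrite ip_Tr// o; congr (if _ then _ else _).
    by apply/eqP/eqP => [->//|/key[]].
  by case: eqP => // /key[es _]; rewrite es eqxx in ss'.
move=> F LF F0.
(* An orthonormal basis is a frame with bounds 1, 1; the lower bound carried over to H forces a
   vector orthogonal to the bold system to have norm 0. *)
have fr : is_frame (@inL2 R d) (@ipL2 R d) X 1 1.
  by split=> // f Lf; rewrite (parseval onbX Lf) ip_ff//= !mul1r.
have [_ _ _ /(_ F LF)[H _]] := frame_lift fr.
move: H; rewrite esum1; last by move=> b _; rewrite F0 cabs20.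
rewrite ipH_ff//= mul1r lee_fin => H.
suff -> : \sum_q nrm2 (F q) = 0 by [].
by apply/eqP; rewrite eq_le H sumr_ge0// => q _; exact: nrm2_ge0.
Qed.

End Main.

(** * The component of index 0 *)

Section FirstComponent.
Context (R : realType) (d' : nat).
Local Notation d := d'.+1.
Local Notation V := ('rV[R]_d).
Context (M P : 'M[int]_d) (p n : nat) (th : 'I_p -> V) (sigma : {perm 'I_p})
  (Psi : 'I_n -> V -> R[i]) (A : 'M[R]_d) (B : 'M[R]_d).
Hypothesis rth : reps A th.
Hypothesis hs : forall q, in_Zd (mact B (th q) - th (sigma q)).

(** The zero representative is mapped to 0, so component 0 is never mixed with the others and its
    phase is always 1. *)
Lemma sigma_fix (q0 : 'I_p) : val q0 = 0%N -> sigma q0 = q0.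
Proof.
move=> q00; have [_ ri _ r0] := rth; have th0 := r0 q0 q00.
apply/esym/ri; move: (hs q0); rewrite th0.
by rewrite /mact mul0mx.
Qed.

Lemma permz_fix (q0 : 'I_p) j : val q0 = 0%N -> permz sigma j q0 = q0.
Proof.
move=> q00; have sX k : (sigma ^+ k)%g q0 = q0.
  elim: k => [|k IH]; first by rewrite expg0 perm1.
  by rewrite expgS permM sigma_fix.
case: j => k /=; last exact: sX.
by rewrite -{1}(sX k) permK.
Qed.

Lemma bold_first_component (q0 : 'I_p) jki : val q0 = 0%N ->
  bold_affine_sys M P th sigma Psi jki q0 = oversampled_affine_sys p M P Psi jki.
Proof.
case: jki => [[j k] i] q00; have [_ _ _ r0] := rth.
rewrite /bold_affine_sys /oversampled_affine_sys (opow_bDilE M) permz_fix// !opow_DilE//.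
apply/funext => x; rewrite /bTr /Sop /Tr r0// dotvE trmx0 mulmx0 mxE mulr0 expi0 mul1r.
by rewrite mulrCA.
Qed.

End FirstComponent.

Theorem theorem3p1 (R : realType) (d : nat) (M P : 'M[int]_d) (p n : nat)
    (thetas : 'I_p -> 'rV[R]_d) (sigma : {perm 'I_p})
    (Psi : 'I_n -> 'rV[R]_d -> R[i]) :
  (0 < d)%N ->
  (forall lam : R[i],
      eigenvalue (map_mx (fun z : int => z%:~R) M : 'M[R[i]]_d) lam -> 1 < `|lam|) ->
  \det P != 0 ->
  p = `|\det P|%N ->
  admissible R M P ->
  (* thetas = the representatives theta*_q of (P^* )^{-1} Z^d / Z^d, theta*_0 = 0 *)
  reps (intmx R P)^T thetas ->
  (* sigma = sigma*: M'^* theta*_q = theta*_{sigma q} mod Z^d, M' = P M P^{-1} *)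
  (forall q, in_Zd
     (mact (intmx R P *m intmx R M *m invmx (intmx R P))^T (thetas q) - thetas (sigma q))) ->
  (forall i, inL2 (Psi i)) ->
  (forall A B : R,
     is_frame (@inL2 R d) (@ipL2 R d) (affine_sys M Psi) A B <->
     is_frame (@inH R d p) (@ipH R d p) (bold_affine_sys M P thetas sigma Psi) A B) /\
  (is_onb (@inL2 R d) (@ipL2 R d) (affine_sys M Psi) <->
   is_onb (@inH R d p) (@ipH R d p) (bold_affine_sys M P thetas sigma Psi)) /\
  (forall q0 : 'I_p, val q0 = 0%N ->
     forall jki : int * 'rV[int]_d * 'I_n,
       bold_affine_sys M P thetas sigma Psi jki q0 =
       oversampled_affine_sys p M P Psi jki).
Proof.
case: d M P thetas Psi => // d' M P th Psi _ exM detP pE [[M' M'E] _] rth hs LPsi.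
have uP : intmx R P \in unitmx.
  by rewrite unitmxE unitfE det_intmx intr_eq0.
have uM := expansive_unit exM; have M0 := expansive_cvg0 exM.
have p0 : (0 < p)%N by rewrite pE absz_gt0.
have hs' q : in_Zd (mact (intmx R M')^T (th q) - th (sigma q)) by rewrite -M'E.
have [n0 [K [K0 Kinj Ksurj]]] := @residue_classes d'.+1 P isT detP.
(* There are as many classes as characters, so the classes can be indexed by ['I_p] as the
   components are. *)
have n0p : n0 = p := card_classes uP rth Kinj Ksurj p0.
rewrite {}n0p in K K0 Kinj Ksurj.
split; [|split] => [A B||q0 q00 jki].
- split; first exact: (frame_lift uM uP p0 M'E rth hs' LPsi Kinj Ksurj K0 M0).
  exact: (frame_unlift uM uP p0 rth LPsi).
- split; first exact: (onb_lift uM uP p0 M'E rth hs' LPsi Kinj Ksurj K0 M0).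
  exact: (onb_unlift uM uP p0 rth LPsi).
- exact (bold_first_component M P Psi rth hs jki q00).
Qed.
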